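(* Let $\Gamma$ be a metric graph with an isometric action of a finite group $K$. Then there exists a $K$-invariant effective divisor $D$ on $\Gamma$ such that the rational map $\phi_{|D|^K}$ associated to the $K$-invariant linear system $|D|^K$ maps distinct $K$-orbits to distinct points.
   Context: Metric graph: the underlying ($\infty$-)metric space of an edge-weighted graph $(G,l)$, where $G$ is a finite connected nonempty multigraph (loops allowed) and $l:E(G)\to\mathbb{R}_{>0}\cup\{\infty\}$ may take the value $\infty$ only on leaf edges (edges adjacent to a vertex of valence one). Each edge $e$ is identified with $[0,l(e)]$; if $l(e)=\infty$ the leaf end of $e$ is identified with $\infty$ and is called a point at infinity. A divisor is an element $D=\sum D(x)\cdot x$ of the free abelian group on the points of $\Gamma$; effective means all $D(x)\ge0$; $K$-invariant means $D(\sigma(x))=D(x)$ for $\sigma\in K$. A rational function is the constant $-\infty$ or a piecewise linear function with integer slopes and finitely many pieces, taking values $\pm\infty$ only at points at infinity. For $f\not\equiv-\infty$, $\mathrm{div}(f)=\sum_x\mathrm{ord}_x(f)\cdot x$, with $\mathrm{ord}_x(f)$ the sum of outgoing slopes of $f$ at $x$ ($0$ if $\Gamma$ is a singleton). $R(D)=\{f\not\equiv-\infty: D+\mathrm{div}(f)\ge0\}\cup\{-\infty\}$, $R(D)^K=\{f\in R(D): f\circ\sigma=f\ \forall\sigma\in K\}$; $R(D)^K$ is a finitely generated tropical semimodule over $\boldsymbol{T}=(\mathbb{R}\cup\{-\infty\},\oplus=\max,\odot=+)$ under pointwise operations. $|D|^K$ is the set of $K$-invariant effective divisors linearly equivalent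 to $D$, identified with $R(D)^K$ modulo additive constants. $\boldsymbol{TP}^{n-1}=(\boldsymbol{T}^{n}\setminus\{(-\infty,\dots,-\infty)\})/\sim$, where $\boldsymbol{x}\sim\boldsymbol{y}$ iff $\boldsymbol{x}=\boldsymbol{y}+(\lambda,\dots,\lambda)$ for some real $\lambda$. For a minimal generating set $\{f_1,\dots,f_n\}$ of $R(D)^K$ (unique up to order and additive constants), $\phi_{|D|^K}(x)=(f_1(x):\cdots:f_n(x))\in\boldsymbol{TP}^{n-1}$ (extended continuously at points at infinity).
   Formalization: The isometric action is also required to be continuous at the points at infinity; otherwise the claim fails: on [−∞,∞] the map x ↦ −x on finite points, fixing both ends, preserves distances, yet every invariant map sends the two ends to the same point. *)

(* Defs.v *)
From HB Require Import structures.
From mathcomp Require Import all_boot all_order all_algebra all_fingroup.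
From mathcomp Require Import finmap all_classical all_reals all_analysis.

Set Implicit Arguments.
Unset Strict Implicit.
Unset Printing Implicit Defensive.

Import Order.TTheory GRing.Theory Num.Theory.
Import numFieldNormedType.Exports.

Local Open Scope classical_set_scope.
Local Open Scope ring_scope.
Local Open Scope quotient_scope.
Local Open Scope ereal_scope.

(* Multigraphs may have loops and parallel edges.  Every edge is given an
   (otherwise irrelevant) orientation, chosen so that an edge of infinite
   length points towards a leaf end; a loop counts twice in the valence. *)
Section Valence.
Variables (V E : finType) (src tgt : E -> V).

Definition valence (v : V) : nat :=
  (#|[set e | src e == v]%SET| + #|[set e | tgt e == v]%SET|)%N.

Definition adjacent : rel V := fun u v =>
  [exists e, ((src e == u) && (tgt e == v)) || ((src e == v) && (tgt e == u))].

End Valence.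

Record weighted_graph (R : realType) := WeightedGraph {
  vertex : finType;
  edge : finType;
  src : edge -> vertex;
  tgt : edge -> vertex;
  len : edge -> \bar R;
  graph_nonempty : (0 < #|vertex|)%N;
  graph_connected : forall u v, connect (adjacent src tgt) u v;
  len_gt0 : forall e, 0 < len e;
  len_infinite : forall e, len e = +oo -> valence src tgt (tgt e) = 1%N
}.

Section MetricGraph.
Context {R : realType}.
Implicit Type G : weighted_graph R.

(* The points of the metric graph of [G]: its vertices, and the points
   (e, t) with 0 < t < len e in the interiors of its edges. *)
Definition in_interior G : pred (edge G * R) :=
  fun x => (0 < x.2)%R && (x.2%:E < len x.1).

Inductive points G : Type :=
| Vertex of vertex G
| Interior of {x : edge G * R | in_interior x}.

HB.instance Definition _ G := gen_eqMixin (points G).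
HB.instance Definition _ G := gen_choiceMixin (points G).

(* The identification of [0, len e] with the edge [e], extended to the whole of
   \bar R by the retraction of \bar R onto [0, len e]. *)
Definition edge_pt G (e : edge G) (t : \bar R) : points G :=
  if t <= 0 then Vertex (src e)
  else if @insub _ _ {x | in_interior x} (e, fine t) is Some p then Interior p
  else Vertex (tgt e).

Definition at_infinity G (x : points G) : Prop :=
  exists2 e : edge G, len e = +oo & x = edge_pt e +oo.

(* The topology is the quotient topology of the disjoint union of the compact
   intervals [0, len e].  Since [edge_pt e] factors through a retraction, it
   does not matter whether preimages are taken in [0, len e] or in \bar R. *)
Definition points_open G (U : set (points G)) : Prop :=
  forall e : edge G, open (edge_pt e @^-1` U).

Lemma points_openT G : points_open [set: points G].
Proof. by move=> e; rewrite preimage_setT; exact: openT. Qed.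

Lemma points_openI G : setI_closed (@points_open G).
Proof. by move=> A B oA oB e; rewrite preimage_setI; exact: openI. Qed.

Lemma points_open_bigU G (I : Type) (f : I -> set (points G)) :
  (forall i, points_open (f i)) -> points_open (\bigcup_i f i).
Proof.
by move=> of_ e; rewrite preimage_bigcup; apply: bigcup_open => i _; exact: of_.
Qed.

HB.instance Definition _ G := isOpenTopological.Build (points G)
  (@points_openT G) (@points_openI G) (@points_open_bigU G).

(* [chain x y L]: a chain of finitely many edge segments, of total length [L],
   joins [x] to [y]. *)
Inductive chain G : points G -> points G -> \bar R -> Prop :=
| chain_nil x : chain x x 0
| chain_cons (e : edge G) (s t : \bar R) y L :
    0 <= s <= len e -> 0 <= t <= len e -> chain (edge_pt e t) y L ->
    chain (edge_pt e s) y (`|t - s| + L).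

Definition dist G (x y : points G) : \bar R :=
  ereal_inf [set L | chain x y L].

(* Points at infinity are at distance +oo from all other points, so that [dist]
   alone does not see to which end of the graph they belong; hence the
   requirement that the action be by homeomorphisms. *)
Definition isometric_action G (K : finGroupType)
    (to : {action K &-> points G}) : Prop :=
  forall k : K, continuous (fun x => to x k) /\
    forall x y, dist (to x k) (to y k) = dist x y.

Definition orbit_of G (K : finGroupType) (to : {action K &-> points G})
    (x : points G) : set (points G) := [set to x k | k in [set: K]].

Definition divisor G := {fsfun points G -> int with 0%R}.

Definition effective G (D : divisor G) : Prop := forall x, (0 <= D x)%R.

Definition invariant_divisor G (K : finGroupType)
    (to : {action K &-> points G}) (D : divisor G) : Prop :=
  forall k x, D (to x k) = D x.

Definition affine_on G (f : points G -> \bar R) (e : edge G) (a b : \bar R)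
    (m : int) : Prop :=
  exists c : R, forall t : R, a < t%:E < b ->
    f (edge_pt e t%:E) = (c + m%:~R * t)%:E.

(* [s] lists the (finitely many) break points of [f] on [e]. *)
Definition piecewise_linear_on G (f : points G -> \bar R) (e : edge G) : Prop :=
  exists s : seq R, forall a b : \bar R, 0 <= a -> a < b -> b <= len e ->
    (forall t : R, t \in s -> ~ a < t%:E < b) ->
    exists m : int, affine_on f e a b m.

Definition rational_function G (f : points G -> \bar R) : Prop :=
  f = cst -oo \/
  [/\ continuous f,
      forall x, ~ at_infinity x -> f x \is a fin_num &
      forall e, piecewise_linear_on f e].

(* Slopes of [f] along [e] just after and just before [t], in the direction of
   the edge.  They exist and are unique when [f] is a rational function other
   than [cst -oo], so that the default value 0 is irrelevant. *)
Definition slope_after G (f : points G -> \bar R) (e : edge G) (t : \bar R) :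
    int :=
  xget 0%R [set m | exists2 b, t < b <= len e & affine_on f e t b m].

Definition slope_before G (f : points G -> \bar R) (e : edge G) (t : \bar R) :
    int :=
  xget 0%R [set m | exists2 a, 0 <= a < t & affine_on f e a t m].

Definition ord G (f : points G -> \bar R) (x : points G) : int :=
  match x with
  | Vertex v => (\sum_(e | src e == v) slope_after f e 0
              - \sum_(e | tgt e == v) slope_before f e (len e))%R
  | Interior p => let: (e, t) := val p in
             (slope_after f e t%:E - slope_before f e t%:E)%R
  end.

(* R(D) *)
Definition linear_system_functions G (D : divisor G) :
    set (points G -> \bar R) :=
  [set f | [/\ rational_function f, f <> cst -oo &
               forall x, (0 <= D x + ord f x)%R]] `|` [set cst -oo].

(* R(D)^K *)
Definition invariant_linear_system_functions G (K : finGroupType)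
    (to : {action K &-> points G}) (D : divisor G) :
    set (points G -> \bar R) :=
  [set f | linear_system_functions D f /\ forall k x, f (to x k) = f x].

(* The scalars are the elements of \bar R other than +oo.  Recall that
   -oo + +oo = -oo, so that the scalar -oo sends every function to [cst -oo]. *)
Definition tropical_span (X : Type) (S : set (X -> \bar R)) :
    set (X -> \bar R) :=
  [set g | exists n (f : 'I_n -> X -> \bar R) (a : 'I_n -> \bar R),
     [/\ forall i, S (f i), forall i, a i < +oo &
         forall x, g x = \big[maxe/-oo]_(i < n) (a i + f i x)]].

Definition minimal_generating_set (X : Type) (M S : set (X -> \bar R)) : Prop :=
  tropical_span S = M /\
  forall S', S' `<=` S -> tropical_span S' = M -> S' = S.

End MetricGraph.

Section TropicalProjectiveSpace.
Variables (R : realType) (n : nat).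

(* T^n minus (-oo, ..., -oo), with the subspace topology *)
Definition tvec : Type := set_type [set u : 'rV[\bar R]_n |
  (forall i, u ord0 i < +oo) /\ exists i, u ord0 i <> -oo].

Definition tcoord (u : tvec) (i : 'I_n) : \bar R := (set_val u) ord0 i.

Definition tequiv : rel tvec := fun u v =>
  `[< exists lambda : R, forall i, tcoord u i = tcoord v i + lambda%:E >].

Lemma tequiv_refl : reflexive tequiv.
Proof. by move=> u; apply/asboolP; exists 0%R => i; rewrite adde0. Qed.

Lemma tequiv_sym : symmetric tequiv.
Proof.
have h u v : tequiv u v -> tequiv v u.
  move=> /asboolP[l H]; apply/asboolP; exists (- l)%R => i.
  by rewrite H -addeA -EFinD subrr adde0.
by move=> u v; apply/idP/idP; exact: h.
Qed.

Lemma tequiv_trans : transitive tequiv.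
Proof.
move=> v u w /asboolP[l H] /asboolP[l' H']; apply/asboolP.
by exists (l' + l)%R => i; rewrite H H' -addeA -EFinD.
Qed.

Canonical tequiv_equiv := EquivRel tequiv tequiv_refl tequiv_sym tequiv_trans.

(* TP^(n-1), with the quotient topology *)
Definition tproj : Type := quotient_topology {eq_quot tequiv_equiv}.

End TropicalProjectiveSpace.

(* [phi] is the map x |-> (f_1(x) : ... : f_n(x)) for some minimal generating
   set {f_1, ..., f_n} of R(D)^K, extended continuously at the points at
   infinity. *)
Definition associated_rational_map (R : realType) (G : weighted_graph R)
    (K : finGroupType) (to : {action K &-> points G}) (D : divisor G)
    (n : nat) (phi : points G -> tproj R n) : Prop :=
  exists f : 'I_n -> points G -> \bar R,
    [/\ injective f,
        minimal_generating_set (invariant_linear_system_functions to D)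
          (range f),
        continuous phi &
        forall x, ~ at_infinity x ->
          exists2 u : tvec R n,
            phi x = \pi_(tproj R n) u & forall i, tcoord u i = f i x].

(* Main.v *)
(* Let D be a large multiple of the sum of the K-orbits of the vertices which are
   not at infinity.  On each edge, adding to a member of R(D) a fixed function,
   which compensates the interior part of D, makes it convex with bounded slopes,
   hence a maximum of finitely many affine functions.  So R(D) is described by
   finitely many coordinates, subject to finitely many tropical linear
   inequalities, and is finitely generated by the double description method;
   then so is R(D)^K, by the maxima over k in K of the f o k, for f a generator.
   That R(D) is K-stable comes from a metric description of slopes: spheres of
   small radius r around x consist of one point on each germ at x, and a
   continuous function of r whose difference quotients are integers is affine.

   For each x a member of R(D), built from spikes of slopes at most 2 centered at
   the support of D, has a strict maximum at x among the points not closer than x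
   to the support of D.  If K x <> K y, and x is not farther from the support
   than y, the maximum of its translates takes different values at x and y.  This
   proves the claim: as the constants belong to R(D)^K, the values at x of the
   members of R(D)^K can be recovered from phi x. *)

Require Import Defs.
From HB Require Import structures.
From mathcomp Require Import all_boot all_order all_algebra all_fingroup.
From mathcomp Require Import finmap all_classical all_reals all_analysis.
From mathcomp Require Import ring lra zify.

Set Implicit Arguments.
Unset Strict Implicit.
Unset Printing Implicit Defensive.

Import Order.TTheory GRing.Theory Num.Theory.
Import numFieldNormedType.Exports.

Local Open Scope classical_set_scope.
Local Open Scope ring_scope.
Local Open Scope quotient_scope.
Local Open Scope ereal_scope.

(** * Finitely generated tropical cones *)

Section TropicalAlgebra.
Context {R : realType}.
Implicit Types a b : \bar R.

(** Convexity on single edges gives no bound on slopes; the bound is global. Sum the inequality D +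
    div f >= 0 over the finite vertices where f >= c. In this sum an edge contributes at most the
    mass of D in its interior, because an edge leaving the set goes down towards its other end;
    since the whole sum is at least minus the mass of D at the vertices, no single edge can
    contribute a very negative amount. Letting c be the value of f at an end of an edge bounds the
    outgoing slopes of that edge.

    D avoids the points at infinity, so that effectivity there only says that f does not increase
    towards the leaf end.

    The factor 2: to single out a point x off the support, the spike running from a nearest support
    point towards x has slope 1 and all other spikes have slope 2, so that x beats every point at
    least as far from the support. Hence the multiplicity of D must be at least twice the number of
    germs at each support point.

    At infinity the map is known only by continuity, which determines it because the tropical
    projective space is Hausdorff. *)

Lemma adde_maxr a x y : a + maxe x y = maxe (a + x) (a + y).
Proof.
have [xy|/ltW yx] := leP x y.
  by rewrite (max_r (leeD2l a xy)).
by rewrite (max_l (leeD2l a yx)).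
Qed.

Lemma bigmaxe_ltey (I : Type) (r : seq I) (F : I -> \bar R) :
  (forall i, F i < +oo) -> \big[maxe/-oo]_(i <- r) F i < +oo.
Proof. by move=> F_lt; elim/big_ind: _ => // x y xlt ylt; rewrite gt_max xlt. Qed.

Lemma bigmaxeNy (I : Type) (r : seq I) : \big[maxe/-oo]_(i <- r) -oo = -oo :> \bar R.
Proof. by elim/big_ind: _ => // x y -> ->; rewrite maxxx. Qed.

Lemma bigmaxe_max (I : Type) (r : seq I) (F G : I -> \bar R) :
  \big[maxe/-oo]_(i <- r) maxe (F i) (G i) =
  maxe (\big[maxe/-oo]_(i <- r) F i) (\big[maxe/-oo]_(i <- r) G i).
Proof.
elim: r => [|i r IH]; first by rewrite !big_nil maxxx.
by rewrite !big_cons IH maxACA.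
Qed.

Lemma adde_bigmaxr (I : Type) (r : seq I) a (F : I -> \bar R) :
  a + \big[maxe/-oo]_(i <- r) F i = \big[maxe/-oo]_(i <- r) (a + F i).
Proof.
elim: r => [|i r IH]; first by rewrite !big_nil addeNy.
by rewrite !big_cons adde_maxr IH.
Qed.

Lemma bigmaxe_attained (I : finType) (F : I -> \bar R) :
  \big[maxe/-oo]_i F i != -oo -> exists i, \big[maxe/-oo]_i F i = F i.
Proof.
elim/big_ind: _ => [/eqP//|x y IHx IHy|i _ _]; last by exists i.
by rewrite /maxe; case: ifP => _.
Qed.

Section Span.
Context {X : Type}.
Implicit Types (S : set (X -> \bar R)) (f g h s : X -> \bar R).

Lemma tropical_span_cons S a s g : S s -> a < +oo -> tropical_span S g ->
  tropical_span S (fun x => maxe (a + s x) (g x)).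
Proof.
move=> Ss alt [n [f [c [Sf clt gE]]]].
exists n.+1, (fun i => if unlift ord0 i is Some j then f j else s),
  (fun i => if unlift ord0 i is Some j then c j else a); split.
- by move=> i; case: unliftP.
- by move=> i; case: unliftP.
- move=> x; rewrite big_ord_recl unlift_none gE; congr maxe.
  by apply: eq_bigr => i _; rewrite liftK.
Qed.

Lemma tropical_spanNy S : tropical_span S (cst -oo).
Proof.
by exists 0%N, (fun _ _ => -oo), (fun _ => 0); split => [[]//|[]//|x];
  rewrite big_ord0.
Qed.

Lemma tropical_span_ind S (P : (X -> \bar R) -> Prop) : P (cst -oo) ->
  (forall a s g, a < +oo -> S s -> P g -> P (fun x => maxe (a + s x) (g x))) ->
  forall g, tropical_span S g -> P g.
Proof.
move=> P0 Pc g [n [f [c [Sf clt gE]]]].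
have -> : g = fun x => \big[maxe/-oo]_(i < n) (c i + f i x) by apply/funext.
elim: n f c Sf clt {gE} => [|n IH] f c Sf clt.
  by rewrite (_ : (fun _ => _) = cst -oo)//; apply/funext => x; rewrite big_ord0.
rewrite (_ : (fun _ => _) = fun x => maxe (c ord0 + f ord0 x)
  (\big[maxe/-oo]_(i < n) (c (lift ord0 i) + f (lift ord0 i) x))); last first.
  by apply/funext => x; rewrite big_ord_recl.
apply: Pc => //.
exact: (IH (fun i => f (lift ord0 i)) (fun i => c (lift ord0 i))).
Qed.

Lemma tropical_span_max S g h : tropical_span S g -> tropical_span S h ->
  tropical_span S (fun x => maxe (g x) (h x)).
Proof.
move=> Sg Sh; move: g Sg; apply: tropical_span_ind => [|a s g alt Ss IH].
  by rewrite (_ : (fun _ => _) = h)//; apply/funext => x; rewrite maxNye.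
rewrite (_ : (fun _ => _) = fun x => maxe (a + s x) (maxe (g x) (h x))).
  exact: tropical_span_cons.
by apply/funext => x; rewrite maxA.
Qed.

Lemma tropical_span_scale S a g : a < +oo -> tropical_span S g ->
  tropical_span S (fun x => a + g x).
Proof.
move=> alt; move: g; apply: tropical_span_ind => [|b s g blt Ss IH].
  rewrite (_ : (fun _ => _) = cst -oo); first exact: tropical_spanNy.
  by apply/funext => x; rewrite addeNy.
rewrite (_ : (fun _ => _) = fun x => maxe ((a + b) + s x) (a + g x)).
  by apply: tropical_span_cons => //; exact: lte_add_pinfty.
by apply/funext => x; rewrite adde_maxr addeA.
Qed.

Lemma sub_tropical_span S : S `<=` tropical_span S.
Proof.
move=> s Ss; rewrite (_ : s = fun x => maxe (0 + s x) (cst -oo x)).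
  by apply: tropical_span_cons => //; exact: tropical_spanNy.
by apply/funext => x; rewrite maxeNy add0e.
Qed.

Lemma tropical_span_bigmax S (I : Type) (r : seq I) (F : I -> X -> \bar R) :
  (forall i, tropical_span S (F i)) ->
  tropical_span S (fun x => \big[maxe/-oo]_(i <- r) F i x).
Proof.
move=> SF; elim: r => [|i r IH].
  rewrite (_ : (fun _ => _) = cst -oo); first exact: tropical_spanNy.
  by apply/funext => x; rewrite big_nil.
rewrite (_ : (fun _ => _) =
  fun x => maxe (F i x) (\big[maxe/-oo]_(i <- r) F i x)).
  exact: tropical_span_max.
by apply/funext => x; rewrite big_cons.
Qed.

Lemma tropical_span_min S T : S `<=` tropical_span T ->
  tropical_span S `<=` tropical_span T.
Proof.
move=> ST; apply: tropical_span_ind => [|a s g alt Ss Tg].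
  exact: tropical_spanNy.
by apply: tropical_span_max => //; apply: tropical_span_scale => //; exact: ST.
Qed.

(** The [F i] themselves need not lie in the span: replacing each one by a member of the span
    between it and the total maximum leaves that maximum unchanged. *)
Lemma tropical_span_squeeze T n (F : 'I_n -> X -> \bar R) :
  (forall i, exists t, [/\ tropical_span T t, forall x, F i x <= t x &
     forall x, t x <= \big[maxe/-oo]_(j < n) F j x]) ->
  tropical_span T (fun x => \big[maxe/-oo]_(j < n) F j x).
Proof.
move=> /choice[t tP].
rewrite (_ : (fun _ => _) = fun x => \big[maxe/-oo]_(j < n) t j x).
  by apply: tropical_span_bigmax => i; have [] := tP i.
apply/funext => x; apply/le_anti/andP; split.
  by apply: le_bigmax2 => i _; have [_ + _] := tP i; exact.
by apply: bigmax_le; [exact: leNye|move=> i _; have [_ _] := tP i; exact].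
Qed.

End Span.

Section DoubleDescription.
Context {I : finType}.
Implicit Types (v g alpha beta : I -> \bar R) (S : set (I -> \bar R)).

(** The tropical linear form with coefficients [alpha]. It serves both to write the inequalities
    cutting out a cone and to evaluate, at a point of the graph, the function given by a coordinate
    vector. *)
Definition tdot alpha v := \big[maxe/-oo]_i (alpha i + v i).

Lemma tdot_max alpha g h :
  tdot alpha (fun i => maxe (g i) (h i)) = maxe (tdot alpha g) (tdot alpha h).
Proof.
by rewrite /tdot -bigmaxe_max; apply: eq_bigr => i _; rewrite adde_maxr.
Qed.

Lemma tdot_scale alpha a g : tdot alpha (fun i => a + g i) = a + tdot alpha g.
Proof.
rewrite /tdot adde_bigmaxr; apply: eq_bigr => i _.
by rewrite addeCA.
Qed.

Lemma tdotNy alpha : tdot alpha (cst -oo) = -oo.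
Proof.
rewrite /tdot -[RHS](bigmaxeNy (index_enum I)); apply: eq_bigr => i _.
by rewrite addeNy.
Qed.

Lemma tdot_bigmax alpha J (r : seq J) (F : J -> I -> \bar R) :
  tdot alpha (fun i => \big[maxe/-oo]_(j <- r) F j i) =
  \big[maxe/-oo]_(j <- r) tdot alpha (F j).
Proof.
elim: r => [|j r IH].
  rewrite big_nil -[RHS](tdotNy alpha); congr tdot.
  by apply/funext => i; rewrite big_nil.
rewrite big_cons -IH -tdot_max; congr tdot.
by apply/funext => i; rewrite big_cons.
Qed.

Lemma tdot_combination alpha v n (c : 'I_n -> \bar R) (f : 'I_n -> I -> \bar R) :
  (forall x, v x = \big[maxe/-oo]_(i < n) (c i + f i x)) ->
  tdot alpha v = \big[maxe/-oo]_(i < n) (c i + tdot alpha (f i)).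
Proof.
move=> /funext ->; rewrite tdot_bigmax; apply: eq_bigr => i _; exact: tdot_scale.
Qed.

Lemma tdot_ltey alpha v : (forall i, alpha i < +oo) -> (forall i, v i < +oo) ->
  tdot alpha v < +oo.
Proof. by move=> ha hv; apply: bigmaxe_ltey => i; exact: lte_add_pinfty. Qed.

(* One step of the double description method: a generator g of S inside the
   half-space and a generator g' outside of it are combined into a point of the
   bounding hyperplane. *)
Definition half_space_gens S alpha beta : set (I -> \bar R) :=
  [set g | S g /\ tdot alpha g <= tdot beta g] `|`
  [set w | exists g g', [/\ S g /\ tdot alpha g <= tdot beta g,
     S g' /\ tdot beta g' < tdot alpha g' &
     w = fun i => maxe (tdot alpha g' + g i) (tdot beta g + g' i)]].

Lemma half_space_gens_finite S alpha beta :
  finite_set S -> finite_set (half_space_gens S alpha beta).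
Proof.
move=> finS; rewrite /half_space_gens finite_setU; split.
  by apply: sub_finite_set finS => g [].
apply: (@sub_finite_set _ _ ((fun gg : _ * _ => fun i =>
  maxe (tdot alpha gg.2 + gg.1 i) (tdot beta gg.1 + gg.2 i)) @` (S `*` S))).
  by move=> w [g [g' [[Sg _] [Sg' _] ->]]]; exists (g, g').
by apply: finite_image; exact: finite_setX.
Qed.

Lemma half_space_gens_ltey S alpha beta :
  (forall i, alpha i < +oo) -> (forall i, beta i < +oo) ->
  (forall g, S g -> forall i, g i < +oo) ->
  forall g, half_space_gens S alpha beta g -> forall i, g i < +oo.
Proof.
move=> alt blt Slt g [[/Slt//]|[g1 [g2 [[/Slt s1 _] [/Slt s2 _] ->]]]] i.
by rewrite gt_max !lte_add_pinfty//; exact: tdot_ltey.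
Qed.

(** For a point v of the half-space, written as a combination of generators, only the terms with a
    generator outside need work. Such a term is compensated by the term k attaining [tdot beta v],
    whose generator lies inside: the combination of the two generators, suitably scaled, lies above
    the offending term and below v, and [tropical_span_squeeze] applies. *)
Lemma half_space_span S alpha beta :
  (forall i, alpha i < +oo) -> (forall i, beta i < +oo) ->
  (forall g, S g -> forall i, g i < +oo) ->
  tropical_span S `&` [set v | tdot alpha v <= tdot beta v] =
  tropical_span (half_space_gens S alpha beta).
Proof.
move=> alt blt Slt; apply/seteqP; split; last first.
  apply: tropical_span_ind => [|a s g alt' Ss [Sg]].
    by split; [exact: tropical_spanNy|rewrite /= !tdotNy].
  rewrite /= => gle.
  have [Ss' sle] : tropical_span S s /\ tdot alpha s <= tdot beta s.
    case: Ss => [[Ss sle]|[g1 [g2 [[S1 le1] [S2 lt2] ->]]]].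
      by split=> //; exact: sub_tropical_span.
    split.
      have S1' := sub_tropical_span S1; have S2' := sub_tropical_span S2.
      by apply: tropical_span_max; apply: tropical_span_scale => //;
        apply: tdot_ltey => // i; exact: Slt.
    rewrite !tdot_max !tdot_scale ge_max; apply/andP; split.
      by rewrite le_max leeD2l.
    by rewrite [_ + tdot alpha _]addeC le_max leeD2l.
  split; first by apply: tropical_span_max => //; exact: tropical_span_scale.
  rewrite /= !tdot_max !tdot_scale ge_max !le_max leeD2l//=.
  by rewrite gle orbT.
move=> v [[n [f [c [Sf clt vE]]]] /= vle].
have -> : v = fun x => \big[maxe/-oo]_(i < n) (c i + f i x) by apply/funext.
apply: tropical_span_squeeze => j.
have [le_j|lt_j] := leP (tdot alpha (f j)) (tdot beta (f j)).
  exists (fun i => c j + f j i); split=> [|//|x].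
    apply: tropical_span_scale => //; apply: sub_tropical_span; left; split=> //.
  exact: (le_bigmax _ (fun j => c j + f j x)).
have [cj|cj] := eqVneq (c j) -oo.
  exists (cst -oo); split; [exact: tropical_spanNy|by move=> x; rewrite cj|].
  by move=> x; exact: leNye.
have alphav := tdot_combination alpha vE.
have betav := tdot_combination beta vE.
have aj_fin : tdot alpha (f j) \is a fin_num.
  by rewrite fin_numElt tdot_ltey ?(le_lt_trans _ lt_j) ?leNye// => i; exact: Slt.
have cj_fin : c j \is a fin_num by rewrite fin_numE cj lt_eqF.
have le_jv : c j + tdot alpha (f j) <= tdot beta v.
  apply: le_trans vle; rewrite alphav.
  exact: (le_bigmax _ (fun j => c j + tdot alpha (f j))).
have bv_fin : tdot beta v != -oo.
  have : c j + tdot alpha (f j) \is a fin_num by rewrite fin_numD cj_fin.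
  rewrite fin_numElt => /andP[+ _] => /lt_le_trans/(_ le_jv).
  by rewrite ltNye.
have [k bvk] : exists k, tdot beta v = c k + tdot beta (f k).
  by move: bv_fin; rewrite betav => /bigmaxe_attained.
have bk_fin : tdot beta (f k) \is a fin_num /\ c k \is a fin_num.
  move: bv_fin; rewrite bvk adde_eq_ninfty negb_or => /andP[ck bk].
  rewrite !fin_numE ck bk !lt_eqF//.
  by apply: tdot_ltey => // i; exact: Slt.
case: bk_fin => bk_fin ck_fin.
(* The generator [f k] is inside because c k + alpha(f k) <= alpha(v) <= beta(v) = c k + beta(f k),
   and [c k] is finite. *)
have le_k : tdot alpha (f k) <= tdot beta (f k).
  have : c k + tdot alpha (f k) <= c k + tdot beta (f k).
    rewrite -bvk; apply: le_trans vle; rewrite alphav.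
    exact: (le_bigmax _ (fun j => c j + tdot alpha (f j))).
  by rewrite leeD2lE.
(* The scalar turns the part of the combination coming from [f j] into exactly c j + f j; the part
   coming from [f k] is then at most c k + f k, since c j + alpha(f j) <= beta(v) = c k + beta(f
   k). *)
exists (fun i => (c j - tdot beta (f k)) +
  maxe (tdot alpha (f j) + f k i) (tdot beta (f k) + f j i)); split.
- apply: tropical_span_scale.
    by apply: lte_add_pinfty => //; move: bk_fin; rewrite -fin_numN fin_numElt => /andP[].
  by apply: sub_tropical_span; right; exists (f k), (f j).
- move=> x; rewrite adde_maxr le_max; apply/orP; right.
  by rewrite addeA subeK.
- move=> x; rewrite adde_maxr ge_max; apply/andP; split.
    apply: le_trans (le_bigmax _ (fun j => c j + f j x) k).
    rewrite addeA leeD2r//.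
    rewrite addeAC leeBlDr// -bvk//.
  rewrite addeA subeK//.
  exact: (le_bigmax _ (fun j => c j + f j x)).
Qed.

Definition tropical_cone (cons : seq ((I -> \bar R) * (I -> \bar R))) :
    set (I -> \bar R) :=
  [set v | (forall i, v i < +oo) /\
    forall p, List.In p cons -> tdot p.1 v <= tdot p.2 v].

(** One half-space is intersected at a time, starting from the whole space, which is generated by
    the tropical unit vectors. *)
Lemma tropical_cone_finitely_generated cons :
  (forall p, List.In p cons -> (forall i, p.1 i < +oo) /\ (forall i, p.2 i < +oo)) ->
  exists S, [/\ finite_set S, forall g, S g -> forall i, g i < +oo &
    tropical_span S = tropical_cone cons].
Proof.
elim: cons => [_|[alpha beta] cons IH cons_lt].
  exists (range (fun j i : I => if i == j then 0 else -oo)); split.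
  - by apply: finite_image; exact: finite_finset.
  - by move=> _ [j _ <-] i; case: ifP.
  - apply/seteqP; split.
      apply: tropical_span_ind => [|a s g alt [j _ <-] [glt _]]; split=> // i.
      by rewrite gt_max glt andbT lte_add_pinfty//; case: ifP.
    move=> v [vlt _].
    rewrite (_ : v = fun i =>
      \big[maxe/-oo]_(j : I) (v j + (if i == j then 0 else -oo))).
      apply: tropical_span_bigmax => j; apply: tropical_span_scale => //.
      by apply: sub_tropical_span; exists j.
    apply/funext => i; apply/le_anti/andP; split.
      apply: le_trans (le_bigmax _ _ i).
      by rewrite eqxx adde0.
    apply: bigmax_le => [|j _]; first exact: leNye.
    by case: eqP => [->|_]; rewrite ?adde0 ?addeNy ?leNye.
have [|S [finS Slt SE]] := IH.
  by move=> p pin; apply: cons_lt; right.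
have [alt blt] := cons_lt (alpha, beta) (or_introl erefl).
exists (half_space_gens S alpha beta); split.
- exact: half_space_gens_finite.
- exact: half_space_gens_ltey.
- rewrite -half_space_span// SE; apply/seteqP; split=> v.
    by move=> [[vlt vc] /= vh]; split=> // p [<-|]//; exact: vc.
  move=> [vlt vc]; split; last exact: (vc (alpha, beta) (or_introl erefl)).
  by split=> // p pin; apply: vc; right.
Qed.

(** Transfers finite generation from a cone of coordinate vectors to the functions these vectors
    describe. *)
Lemma tropical_span_image X (w : X -> I -> \bar R) S :
  (fun v x => tdot (w x) v) @` tropical_span S =
  tropical_span ((fun v x => tdot (w x) v) @` S).
Proof.
apply/seteqP; split.
  move=> _ [v [n [f [c [Sf clt vE]]]] <-].
  exists n, (fun i x => tdot (w x) (f i)), c; split=> // [i|x].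
    by exists (f i).
  exact: tdot_combination.
apply: tropical_span_ind => [|a _ _ alt [s Ss <-] [v Sv <-]].
  exists (cst -oo); first exact: tropical_spanNy.
  by apply/funext => x; rewrite tdotNy.
exists (fun i => maxe (a + s i) (v i)); first exact: tropical_span_cons.
by apply/funext => x; rewrite tdot_max tdot_scale.
Qed.

End DoubleDescription.

End TropicalAlgebra.

(** * Induction along intervals of the extended real line *)

Section ExtendedReals.
Context {R : realType}.
Implicit Types (a b : \bar R).

Lemma ereal_between a b : a < b -> exists r : R, a < r%:E < b.
Proof.
case: a => [a| |]; case: b => [b| |]//.
- rewrite lte_fin => ab; exists ((a + b) / 2)%R; rewrite !lte_fin; apply/andP; lra.
- by move=> _; exists (a + 1)%R; rewrite lte_fin ltry ltrDl ltr01.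
- by move=> _; exists (b - 1)%R; rewrite lte_fin ltNyr gtrBl ltr01.
- by move=> _; exists 0%R; rewrite ltNyr ltry.
Qed.

(** Let T be the supremum of the points up to which P holds throughout. P passes to T from the left,
    and if T < v it would pass beyond T on the right. This takes the place of compactness of the
    edges, including those of infinite length. *)
Lemma ereal_induction (P : \bar R -> Prop) (u v : \bar R) : u <= v -> P u ->
  (forall t, u <= t < v -> P t ->
     exists2 b, t < b & forall s, t < s < b -> s <= v -> P s) ->
  (forall t, u < t <= v -> (forall s, u <= s < t -> P s) -> P t) ->
  P v.
Proof.
move=> uv Pu Pright Pleft.
pose S := [set t | u <= t <= v /\ forall s, u <= s <= t -> P s].
have Su : S u.
  by split=> [|s]; [rewrite lexx uv|rewrite -eq_le => /eqP <-].
pose T := ereal_sup S.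
have uT : u <= T by exact: ereal_sup_ubound.
have Tv : T <= v by apply: ge_ereal_sup => t [/andP[]].
have PltT s : u <= s < T -> P s.
  move=> /andP[us /ereal_sup_gt[t [_ Pt] st]]; apply: Pt.
  by rewrite us ltW.
have PT : P T.
  have [->//|uT'] := eqVneq T u.
  by apply: Pleft => //; rewrite lt_neqAle eq_sym uT' uT.
have ST : forall s, u <= s <= T -> P s.
  move=> s /andP[us]; rewrite le_eqVlt => /predU1P[->//|sT].
  by apply: PltT; rewrite us.
move: Tv; rewrite le_eqVlt => /predU1P[<-//|Tv]; exfalso.
have [b Tb Pb] := Pright T (introT andP (conj uT Tv)) PT.
have [|r /andP[Tr rmin]] := @ereal_between T (mine b v).
  by rewrite lt_min Tb.
have : S r%:E.
  have rv : r%:E <= v.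
    by apply: ltW; apply: (lt_le_trans rmin); rewrite ge_min lexx orbT.
  split; first by rewrite rv andbT (le_trans uT)// ltW.
  move=> s /andP[us sr]; have [sT|Ts] := leP s T; first by apply: ST; rewrite us.
  apply: Pb; last exact: le_trans rv.
  rewrite Ts (le_lt_trans sr)//; apply: (lt_le_trans rmin).
  by rewrite ge_min lexx.
by move=> /ereal_sup_ubound; rewrite leNgt Tr.
Qed.

Lemma real_induction (P : R -> Prop) (u v : R) : (u <= v)%R -> P u ->
  (forall t, (u <= t < v)%R -> P t ->
     exists2 d : R, (0 < d)%R & forall s, (t < s < t + d)%R -> (s <= v)%R -> P s) ->
  (forall t, (u < t <= v)%R -> (forall s, (u <= s < t)%R -> P s) -> P t) ->
  P v.
Proof.
move=> uv Pu Pright Pleft.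
apply: (@ereal_induction (fun t => P (fine t)) u%:E v%:E) => //.
- case=> [t| |]; [|by rewrite ltNge !leey|by rewrite leeNy_eq].

  rewrite lee_fin lte_fin => tuv /(Pright _ tuv)[d d0 Pd].
  exists (t + d)%:E; first by rewrite lte_fin ltrDl.
  by case=> [s| |]//=; rewrite ?lte_fin ?lee_fin//=; exact: Pd.
- case=> [t| |]; [|by rewrite leye_eq andbF|by rewrite ltNge !leNye].
  rewrite lte_fin lee_fin => tuv Pt; apply: Pleft => // s.
  by have := Pt s%:E; rewrite lee_fin lte_fin.
Qed.

End ExtendedReals.

(** * Edges and germs *)

Section EdgePoints.
Context {R : realType} {G : weighted_graph R}.
Implicit Types (e : edge G) (x y z : points G) (v : vertex G).

Lemma edge_pt_le0 e (t : \bar R) : t <= 0 -> edge_pt e t = Vertex (src e).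
Proof. by rewrite /edge_pt => ->. Qed.

Lemma edge_pt0 e : edge_pt e 0 = Vertex (src e).
Proof. exact: edge_pt_le0. Qed.

Lemma edge_pt_ge e (t : \bar R) : len e <= t -> edge_pt e t = Vertex (tgt e).
Proof.
move=> let_; rewrite /edge_pt leNgt (lt_le_trans (len_gt0 e) let_)/=.
case: insubP => [p|//]; rewrite /in_interior/= => /andP[t0 tl] _.
case: t let_ t0 tl => [t| |]//=; rewrite ?ltxx// => lt _.
by rewrite ltNge lt.
Qed.

Lemma edge_ptE e (t : R) (t_in : in_interior (e, t)) :
  edge_pt e t%:E = Interior (exist _ (e, t) t_in).
Proof.
have /andP[/= t0 tl] := t_in.
rewrite /edge_pt leNgt lte_fin t0/= insubT.
by congr Interior; exact: val_inj.
Qed.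

(** Presents an interior point as [edge_pt e t], so that vertices and interior points are handled by
    the same statements about [edge_pt]. *)
Variant point_spec : points G -> Type :=
| PointVertex v : point_spec (Vertex v)
| PointInterior e (t : R) of (0 < t)%R & t%:E < len e : point_spec (edge_pt e t%:E).

Lemma pointP x : point_spec x.
Proof.
case: x => [v|[[e t] t_in]]; first exact: PointVertex.
rewrite -edge_ptE; have /andP[t0 tl] := t_in; exact: PointInterior.
Qed.

Lemma edge_pt_inj e e' (t : R) (s : \bar R) : (0 < t)%R -> t%:E < len e ->
  edge_pt e t%:E = edge_pt e' s -> e' = e /\ s = t%:E.
Proof.
move=> t0 tl; have t_in : in_interior (e, t) by rewrite /in_interior/= t0.
rewrite edge_ptE.
have [/edge_pt_le0 ->//|s0] := leP s 0.
have [/edge_pt_ge ->//|] := leP (len e') s.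
case: s s0 => [s| |]//; last by move=> _; rewrite ltNge leey.
rewrite lte_fin => s0 sl.
have s_in : in_interior (e', s) by rewrite /in_interior/= s0.
by rewrite edge_ptE => -[-> ->].
Qed.

Lemma edge_pt_vertex e (s : \bar R) v : edge_pt e s = Vertex v ->
  (s <= 0 /\ v = src e) \/ (len e <= s /\ v = tgt e).
Proof.
have [s0|s0] := leP s 0; first by rewrite edge_pt_le0// => -[<-]; left.
have [sl|] := leP (len e) s; first by rewrite edge_pt_ge// => -[<-]; right.
case: s s0 => [s| |]//; last by move=> _; rewrite ltNge leey.
rewrite lte_fin => s0 sl.
have s_in : in_interior (e, s) by rewrite /in_interior/= s0.
by rewrite edge_ptE.
Qed.

Lemma at_infinityP x :
  at_infinity x <-> exists2 e, len e = +oo & x = Vertex (tgt e).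
Proof.
by split=> -[e le ->]; exists e => //; rewrite edge_pt_ge ?leey.
Qed.

Lemma infinite_leaf e e' : len e = +oo -> tgt e' = tgt e -> e' = e.
Proof.
move=> /len_infinite; rewrite /valence => /eqP val1 te.
have : (#|[set e0 | tgt e0 == tgt e]%SET| <= 1)%N.
  by move: val1 => /eqP <-; rewrite leq_addl.
by move=> /card_le1_eqP; apply; rewrite inE ?te.
Qed.

Lemma src_not_leaf e e' : len e = +oo -> src e' <> tgt e.
Proof.
move=> /len_infinite; rewrite /valence => val1 se.
have h1 : (0 < #|[set e0 | src e0 == tgt e]%SET|)%N.
  by apply/card_gt0P; exists e'; rewrite inE se.
have h2 : (0 < #|[set e0 | tgt e0 == tgt e]%SET|)%N.
  by apply/card_gt0P; exists e; rewrite inE.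
lia.
Qed.

Lemma src_finite e : ~ at_infinity (Vertex (src e)).
Proof. by move=> /at_infinityP[e' le' [/(src_not_leaf le')]]. Qed.

Lemma tgt_finite e : len e <> +oo -> ~ at_infinity (Vertex (tgt e)).
Proof. by move=> le /at_infinityP[e' le' [/(infinite_leaf le') ee']]; apply: le; rewrite ee'. Qed.

Lemma finite_tgt_len e v : ~ at_infinity (Vertex v) -> tgt e = v -> len e <> +oo.
Proof. by move=> vfin ev le; apply: vfin; apply/at_infinityP; exists e; rewrite ?ev. Qed.

Lemma edge_pt_finite e (t : R) : t%:E <= len e -> ~ at_infinity (edge_pt e t%:E).
Proof.
move=> tl /at_infinityP[e' le'] /edge_pt_vertex[[_ /esym]|[lt /esym/(infinite_leaf le')]].
  exact: src_not_leaf.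
by move=> ee'; move: lt; rewrite ee' le'.
Qed.

Lemma finite_vertex : exists v : vertex G, ~ at_infinity (Vertex v).
Proof.
have /card_gt0P[v _] := graph_nonempty G.
have [/at_infinityP[e _ _]|] := pselect (at_infinity (Vertex v)); last by exists v.
by exists (src e); exact: src_finite.
Qed.

Lemma len_fin e : len e <> +oo -> len e = (fine (len e))%:E.
Proof.
by move=> le; rewrite fineK// fin_numElt (lt_trans _ (len_gt0 e))//= ltey; exact/eqP.
Qed.

(* (e, t, b) stands for the direction along e at edge_pt e t, towards the target
   of e if b, and towards its source otherwise. *)
Definition germ : Type := (edge G * R * bool)%type.
Implicit Type g : germ.

(** A loop contributes two germs at its vertex. For an edge of infinite length [fine (len e)] is 0,
    a meaningless base; this affects only the leaf end, which is at infinity. *)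
Definition germs x : seq germ :=
  match x with
  | Vertex v => [seq (e, 0%R, true) | e <- enum [pred e | src e == v]] ++
                [seq (e, fine (len e), false) | e <- enum [pred e | tgt e == v]]
  | Interior p => [:: (val p, true); (val p, false)]
  end.

Definition gpos g (d : R) : R := (g.1.2 + (if g.2 then d else - d))%R.
Definition gpt g (d : R) : points G := edge_pt g.1.1 (gpos g d)%:E.

Definition valid_germ g : Prop :=
  if g.2 then (0 <= g.1.2)%R /\ g.1.2%:E < len g.1.1
  else (0 < g.1.2)%R /\ g.1.2%:E <= len g.1.1.

Lemma gpos0 g : gpos g 0 = g.1.2.
Proof. by rewrite /gpos; case: ifP; rewrite ?oppr0 addr0. Qed.

Lemma germsP x g : ~ at_infinity x ->
  g \in germs x <-> gpt g 0 = x /\ valid_germ g.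
Proof.
case: (pointP x) => [v vfin|e t t0 tl _].
  rewrite /germs mem_cat; split.
    move=> /orP[/mapP[e]|/mapP[e]]; rewrite mem_enum inE => /eqP ev ->.
      by rewrite /gpt gpos0 edge_pt0 ev /valid_germ/=; do 2!split => //; exact: len_gt0.
    have le := finite_tgt_len vfin ev.
    rewrite /gpt gpos0/= -len_fin// edge_pt_ge// ev /valid_germ/= -len_fin//.
    by have := len_gt0 e; rewrite {1}len_fin// lte_fin => ?; split.
  move=> [gx gv]; case: g gx gv => -[e s] [] /=; rewrite /gpt gpos0/= /valid_germ/=.
    move=> /edge_pt_vertex[[s0 ->]|[ls _]] [s0' sl]; last by move: ls; rewrite leNgt sl.
    apply/orP; left; apply/mapP; exists e; first by rewrite mem_enum inE.
    suff -> : s = 0%R by [].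
    by apply/le_anti; rewrite s0' -lee_fin s0.
  move=> /edge_pt_vertex[[s0 _]|[ls ->]] [s0' sl]; first by move: s0; rewrite lee_fin leNgt s0'.
  apply/orP; right; apply/mapP; exists e; first by rewrite mem_enum inE.
  suff -> : len e = s%:E by [].
  by apply/le_anti; rewrite ls sl.
have t_in : in_interior (e, t) by rewrite /in_interior/= t0.
rewrite edge_ptE /= !inE; split.
  by move=> /orP[]/eqP ->; rewrite /gpt gpos0/= edge_ptE /valid_germ/= ltW// ltW.
case: g => -[e' s] b [+ _]; rewrite /gpt gpos0/= -edge_ptE => /esym/(edge_pt_inj t0 tl)[-> [->]].
by case: b; rewrite eqxx ?orbT.
Qed.

Lemma valid_germ_finite g : valid_germ g -> ~ at_infinity (gpt g 0).
Proof.
rewrite /valid_germ /gpt gpos0 => gv; apply: edge_pt_finite.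
by move: gv; case: ifP => _ [_ // /ltW].
Qed.

Lemma mem_germs g : valid_germ g -> g \in germs (gpt g 0).
Proof. by move=> gv; apply/germsP => //; exact: valid_germ_finite. Qed.

Lemma germ_room g : valid_germ g -> exists2 d : R, (0 < d)%R &
  forall s, (0 < s < d)%R -> (0 < gpos g s)%R /\ (gpos g s)%:E < len g.1.1.
Proof.
case: g => -[e t] [] /=; rewrite /valid_germ/= => -[t0 tl].
  have [r /andP[tr rl]] := ereal_between tl.
  rewrite lte_fin in tr.
  exists (r - t)%R; rewrite ?subr_gt0// => s /andP[s0 sd]; rewrite /gpos/=; split; first lra.
  by apply: lt_trans rl; rewrite lte_fin; lra.
exists t => // s /andP[s0 st]; rewrite /gpos/=; split; first lra.
by apply: lt_le_trans tl; rewrite lte_fin; lra.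
Qed.

Lemma uniq_germs x : uniq (germs x).
Proof.
case: x => [v|p] /=; last by rewrite inE; case: (val p) => e t /=; rewrite eqE/= eqE/= andbF.
rewrite cat_uniq !map_inj_uniq ?enum_uniq//=; last 2 first.
- by move=> e e' [].
- by move=> e e' [].
rewrite andbT; apply/hasPn => g /mapP[e _ ->]; apply/negP => /mapP[e' _ []//].
Qed.

End EdgePoints.

(** * Limits and continuity of affine pieces *)

Section Continuity.
Context {R : realType}.

Lemma EFin_continuous : continuous (EFin : R -> \bar R).
Proof.
move=> t; apply: cvg_EFin; [near=> x => //|exact: cvg_id].
Unshelve. all: by end_near. Qed.

Lemma cvg_EFin_pinfty : EFin @ pinfty_nbhs R --> nbhs (+oo : \bar R).
Proof.
move=> A [M [Mr MA]]; exists M; split=> // x Mx; apply: MA.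
by rewrite lte_fin.
Qed.

Lemma affine_right_limit (phi : \bar R -> \bar R) (c m t d : R) : (0 < d)%R ->
  {for t%:E, continuous phi} ->
  (forall u, (t < u < t + d)%R -> phi u%:E = (c + m * u)%:E) ->
  phi t%:E = (c + m * t)%:E.
Proof.
move=> d0 phit phiE.
have h1 : (phi \o EFin) u @[u --> t^'+] --> phi t%:E.
  apply: cvg_at_right_filter; apply: (@continuous_comp _ _ _ EFin phi);
  [exact: EFin_continuous|exact: phit].
have h2 : (c + m * u)%:E @[u --> t^'+] --> (c + m * t)%:E.
  apply: (@cvg_at_right_filter _ _ (fun u => (c + m * u)%:E)).
  apply: (@continuous_comp _ _ _ (fun u : R => (c + m * u)%R) EFin); last exact: EFin_continuous.
  by apply: cvgD; [exact: cvg_cst|apply: cvgM; [exact: cvg_cst|exact: cvg_id]].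
apply: (cvg_unique (@ereal_hausdorff R)) h1 _.
apply: cvg_trans h2; apply: near_eq_cvg; near=> u.
rewrite /= phiE//; apply/andP; split; near: u; first exact: nbhs_right_gt.
by apply: nbhs_right_lt; rewrite ltrDl.
Unshelve. all: by end_near. Qed.

Lemma affine_left_limit (phi : \bar R -> \bar R) (c m t d : R) : (0 < d)%R ->
  {for t%:E, continuous phi} ->
  (forall u, (t - d < u < t)%R -> phi u%:E = (c + m * u)%:E) ->
  phi t%:E = (c + m * t)%:E.
Proof.
move=> d0 phit phiE.
have h1 : (phi \o EFin) u @[u --> t^'-] --> phi t%:E.
  apply: cvg_at_left_filter; apply: (@continuous_comp _ _ _ EFin phi);
  [exact: EFin_continuous|exact: phit].
have h2 : (c + m * u)%:E @[u --> t^'-] --> (c + m * t)%:E.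
  apply: (@cvg_at_left_filter _ _ (fun u => (c + m * u)%:E)).
  apply: (@continuous_comp _ _ _ (fun u : R => (c + m * u)%R) EFin); last exact: EFin_continuous.
  by apply: cvgD; [exact: cvg_cst|apply: cvgM; [exact: cvg_cst|exact: cvg_id]].
apply: (cvg_unique (@ereal_hausdorff R)) h1 _.
apply: cvg_trans h2; apply: near_eq_cvg; near=> u.
rewrite /= phiE//; apply/andP; split; near: u; last exact: nbhs_left_lt.
by apply: nbhs_left_gt; rewrite gtrBl.
Unshelve. all: by end_near. Qed.

Lemma continuous_affine_germs (phi : \bar R -> \bar R) (t m n d : R) : (0 < d)%R ->
  (forall s, (0 <= s < d)%R -> phi (t + s)%:E = (fine (phi t%:E) + m * s)%:E) ->
  (forall s, (0 <= s < d)%R -> phi (t - s)%:E = (fine (phi t%:E) + n * s)%:E) ->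
  {for t%:E, continuous phi}.
Proof.
move=> d0 phir phil.
have phit : phi t%:E = (fine (phi t%:E))%:E.
  by rewrite -[in LHS](addr0 t) phir ?mulr0 ?addr0// lexx.
have near_t (u : R) : (`|t - u| < d)%R ->
    phi u%:E = (fine (phi t%:E) + (if (t <= u)%R then m else n) * `|t - u|)%:E.
  have [tu|ut] := @leP _ R t u.
    rewrite ler0_norm ?subr_le0// => tud.
    rewrite {1}(_ : u = t + (u - t))%R; last by rewrite addrC subrK.
    by rewrite phir ?opprB//; apply/andP; split; lra.
  rewrite gtr0_norm ?subr_gt0// => tud.
  rewrite {1}(_ : u = t - (t - u))%R; last by rewrite opprB addrC subrK.
  by rewrite phil//; apply/andP; split; lra.
have phi_cvg : phi u%:E @[u --> t] --> phi t%:E.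
  rewrite phit; apply: cvg_EFin.
    near=> u; rewrite near_t//; near: u; exact: cvgr_dist_lt.
  apply/cvgrPdist_lt => e e0.
  have M0 : (0 < 1 + `|m| + `|n|)%R.
    by have := normr_ge0 m; have := normr_ge0 n; lra.
  near=> u.
  have tud : (`|t - u| < d)%R by near: u; apply: cvgr_dist_lt.
  have tue : (`|t - u| < e / (1 + `|m| + `|n|))%R.
    by near: u; apply: cvgr_dist_lt => //; exact: divr_gt0.
  rewrite /= (near_t u tud)/= opprD addNKr normrN normrM normr_id.
  move: tue; rewrite ltr_pdivlMr// mulrC; apply: le_lt_trans.
  by apply: ler_wpM2r => //; case: ifP => _; have := normr_ge0 m; have := normr_ge0 n; lra.
by move=> A /phi_cvg.
Unshelve. all: by end_near. Qed.

Lemma affine_limit_pinfty (m c : R) : (m <= 0)%R ->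
  (c + m * u)%:E @[u --> +oo%R] --> (if m == 0%R then c%:E else -oo : \bar R).
Proof.
move=> m0; case: eqP => [->|/eqP mn0].
  by apply: cvg_near_cst; near=> u; rewrite mul0r addr0.
apply/cvgeNyPle => A; near=> u.
have mlt0 : (m < 0)%R by rewrite lt_neqAle mn0.
by rewrite lee_fin -lerBrDl -ler_ndivrMl.
Unshelve. all: by end_near. Qed.

Lemma tail_limit (phi : \bar R -> \bar R) (m c a : R) : (m <= 0)%R ->
  (forall t, (a < t)%R -> phi t%:E = (c + m * t)%:E) ->
  {for +oo, continuous phi} <-> phi +oo = if m == 0%R then c%:E else -oo.
Proof.
move=> m0 phiE.
set l : \bar R := if m == 0%R then c%:E else -oo.
have h : phi u%:E @[u --> +oo%R] --> l.
  have h0 : (c + m * u)%:E @[u --> +oo%R] --> l := affine_limit_pinfty m0.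
  apply: cvg_trans h0; apply: near_eq_cvg.
  near=> u; rewrite phiE//; near: u.
  by have := nbhs_pinfty_gt (num_real a).
split=> [phic|phiy].
  apply: (cvg_unique (@ereal_hausdorff R)) _ h.
  by move=> A /phic; exact: cvg_EFin_pinfty.
suff : phi x @[x --> +oo] --> l by rewrite -phiy.
move=> A Al; have [M [Mr MA]] := h _ Al.
exists M; split=> //; case=> [r| |]//.
  by rewrite lte_fin; exact: MA.
by move=> _; rewrite /= phiy; exact: nbhs_singleton.
Unshelve. all: by end_near. Qed.

End Continuity.

Section EdgeTopology.
Context {R : realType} {G : weighted_graph R}.

Lemma edge_pt_continuous (e : edge G) : continuous (edge_pt e).
Proof. by apply/continuousP => A Ao; exact: (Ao e). Qed.

Lemma continuous_points (T : topologicalType) (f : points G -> T) :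
  (forall e, continuous (f \o edge_pt e)) -> continuous f.
Proof.
move=> fe; apply/continuousP => A Ao.
change (points_open (f @^-1` A)) => e; have /continuousP := fe e.
by move=> /(_ A Ao).
Qed.

Lemma continuous_edge (T : topologicalType) (f : points G -> T) (e : edge G) :
  continuous f -> continuous (f \o edge_pt e).
Proof.
by move=> fc x; apply: continuous_comp; [exact: edge_pt_continuous|exact: fc].
Qed.

End EdgeTopology.

(** * Slopes of rational functions *)

Lemma min_half (R : realType) (d d' : R) : (0 < d)%R -> (0 < d')%R ->
  exists s, [/\ 0 < s, s < d & s < d']%R.
Proof.
move=> d0 d'0; exists (Num.min d d' / 2)%R.
have md : (0 < Num.min d d')%R by rewrite lt_min d0.
have : (Num.min d d' / 2 < Num.min d d')%R by lra.
by rewrite lt_min divr_gt0// => /andP[].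
Qed.

Section Slopes.
Context {R : realType} {G : weighted_graph R}.
Implicit Types (e : edge G) (x y : points G) (f : points G -> \bar R) (g : @germ R G).

(** At s = 0 the equation also says that the value at the base of the germ is finite. *)
Definition gslope f g (m : int) : Prop :=
  exists2 d : R, (0 < d)%R & forall s : R, (0 <= s < d)%R ->
    f (gpt g s) = (fine (f (gpt g 0)) + m%:~R * s)%:E.

(** The last clause spells out continuity at the leaf end for m <= 0: the limit of the affine tail
    is its constant term if m is 0, and -oo if m is negative. *)
Definition tail_slope f e (m : int) : Prop :=
  exists c a : R, (forall t : R, (a < t)%R -> f (edge_pt e t%:E) = (c + m%:~R * t)%:E) /\
    f (Vertex (tgt e)) = if m == 0%R then c%:E else -oo.

Lemma gslope_uniq f g m n : gslope f g m -> gslope f g n -> m = n.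
Proof.
move=> [d d0 dm] [d' d'0 dn].
have [s [s0 sd sd']] := min_half d0 d'0.
have sd1 : (0 <= s < d)%R by apply/andP; split; lra.
have sd2 : (0 <= s < d')%R by apply/andP; split; lra.
have := dm s sd1; rewrite (dn s sd2) => -[] /addrI/(mulIf (lt0r_neq0 s0))/eqP.
by rewrite eqr_int => /eqP ->.
Qed.

Lemma affine_on_uniq f e (a b a' b' : \bar R) m n : maxe a a' < mine b b' ->
  affine_on f e a b m -> affine_on f e a' b' n -> m = n.
Proof.
move=> ab [c cm] [c' cn].
have [r /andP[ar rb]] := ereal_between ab.
have [s /andP[rs sb]] := ereal_between rb.
move: ar rb sb; rewrite !lt_min !gt_max => /andP[ar a'r] /andP[rb rb'] /andP[sb sb'].
have ars := lt_trans ar rs; have a'rs := lt_trans a'r rs.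
have := cm r; rewrite ar rb cn ?a'r ?rb'// => /(_ isT) [e1].
have := cm s; rewrite ars sb cn ?a'rs ?sb'// => /(_ isT) [e2].
rewrite lte_fin in rs.
have /(mulIf _)/eqP : (n%:~R * (s - r) = m%:~R * (s - r) :> R)%R.
  by rewrite !mulrBr; lra.
by rewrite eqr_int subr_eq0 gt_eqF// => /(_ isT)/eqP.
Qed.

Lemma slope_afterE f e (t b : \bar R) m : t < b <= len e -> affine_on f e t b m ->
  slope_after f e t = m.
Proof.
move=> tb fm; apply: xget_unique; first by exists b.
move=> n [b' /andP[tb' _]] fn; apply: (affine_on_uniq _ fn fm).
by rewrite maxxx lt_min tb'; case/andP: tb.
Qed.

Lemma slope_beforeE f e (a t : \bar R) m : 0 <= a < t -> affine_on f e a t m ->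
  slope_before f e t = m.
Proof.
move=> at_ fm; apply: xget_unique; first by exists a.
move=> n [a' /andP[_ at']] fn; apply: (affine_on_uniq _ fn fm).
by rewrite minxx gt_max at'; case/andP: at_.
Qed.

Definition oslope f g : int :=
  if g.2 then slope_after f g.1.1 g.1.2%:E else (- slope_before f g.1.1 g.1.2%:E)%R.

Lemma ord_germs f x : ~ at_infinity x -> ord f x = (\sum_(g <- germs x) oslope f g)%R.
Proof.
case: x => [v vfin|[[e t] t_in] _] /=; last first.
  by rewrite !big_cons big_nil /oslope/= addr0.
rewrite big_cat !big_map /= !big_enum /oslope/=; congr (_ + _)%R.
rewrite -sumrN; apply: eq_big => e //= /eqP ev.
rewrite -len_fin// => le; apply: vfin; apply/at_infinityP.
by exists e => //; rewrite ev.
Qed.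

Lemma gslope_affine f g m : valid_germ g -> gslope f g m ->
  if g.2 then exists2 b, g.1.2%:E < b <= len g.1.1 & affine_on f g.1.1 g.1.2%:E b m
  else exists2 a, 0 <= a < g.1.2%:E & affine_on f g.1.1 a g.1.2%:E (- m)%R.
Proof.
move=> gv [d d0 dm]; have [d' d'0 room] := germ_room gv.
have [r [r0 rd rd']] := min_half d0 d'0.
have [room1 room2] := room r ltac:(apply/andP; split; lra).
case: g gv dm room room1 room2 => -[e t] b; rewrite /gpt /gpos/=.
case: b => gv dm room room1 room2.
  exists (t + r)%:E; first by rewrite lte_fin ltrDl r0 ltW.
  exists (fine (f (edge_pt e (t + 0)%:E)) - m%:~R * t)%R => u /andP[].
  rewrite !lte_fin => tu ur.
  have -> : (u = t + (u - t))%R by lra.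
  rewrite dm; last by apply/andP; split; lra.
  by congr EFin; rewrite mulrDr mulrN; lra.
exists (t - r)%:E; first by rewrite lte_fin lee_fin gtrBl r0 ltW.
exists (fine (f (edge_pt e (t - 0)%:E)) + m%:~R * t)%R => u /andP[].
rewrite !lte_fin => tu ur.
have -> : (u = t - (t - u))%R by lra.
rewrite dm; last by apply/andP; split; lra.
by congr EFin; rewrite rmorphN/=; lra.
Qed.

Lemma gslope_oslope f g m : valid_germ g -> gslope f g m -> oslope f g = m.
Proof.
move=> gv /(gslope_affine gv); rewrite /oslope; case: ifP => _ [b gb].
  exact: slope_afterE.
by move=> /(slope_beforeE gb) ->; rewrite opprK.
Qed.

Lemma affine_gslope f g m : continuous f -> valid_germ g ->
  (if g.2 then exists2 b, g.1.2%:E < b <= len g.1.1 & affine_on f g.1.1 g.1.2%:E b m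
  else exists2 a, 0 <= a < g.1.2%:E & affine_on f g.1.1 a g.1.2%:E (- m)%R) ->
  gslope f g m.
Proof.
move=> fc; case: g => -[e t] [] /= gv [b /andP[h1 h2] [c cE]].
  have [r /andP[tr rb]] := ereal_between h1.
  rewrite lte_fin in tr.
  have ft : f (edge_pt e t%:E) = (c + m%:~R * t)%:E.
    apply: (@affine_right_limit _ (f \o edge_pt e) _ _ _ (r - t)%R).
    - by rewrite subr_gt0.
    - exact: continuous_edge.
    - move=> u /andP[tu ur]; apply: cE; rewrite lte_fin tu/=.
      by apply: lt_trans rb; rewrite lte_fin; lra.
  exists (r - t)%R; first by rewrite subr_gt0.
  move=> s /andP[]; rewrite /gpt gpos0/= ft /gpos/=.
  rewrite le_eqVlt => /predU1P[<- _|s0 sr]; first by rewrite addr0 ft mulr0 addr0.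
  rewrite cE ?lte_fin ?ltrDl ?s0//=; first by congr EFin; lra.
  by apply: lt_trans rb; rewrite lte_fin; lra.
have [r /andP[br rt]] := ereal_between h2.
rewrite lte_fin in rt.
have ft : f (edge_pt e t%:E) = (c + (- m)%:~R * t)%:E.
  apply: (@affine_left_limit _ (f \o edge_pt e) _ _ _ (t - r)%R).
  - by rewrite subr_gt0.
  - exact: continuous_edge.
  - move=> u /andP[tu ut]; apply: cE; rewrite lte_fin ut andbT.
    by apply: (lt_trans br); rewrite lte_fin; lra.
exists (t - r)%R; first by rewrite subr_gt0.
move=> s /andP[]; rewrite /gpt gpos0/= ft /gpos/=.
rewrite le_eqVlt => /predU1P[<- _|s0 sr]; first by rewrite subr0 ft mulr0 addr0.
rewrite cE ?lte_fin ?gtrBl ?s0 ?andbT//=; first by congr EFin; rewrite rmorphN/=; lra.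
by apply: (lt_trans br); rewrite lte_fin; lra.
Qed.

Lemma gap_right (s : seq R) (t l : \bar R) : t < l ->
  exists2 b, t < b <= l & forall u, u \in s -> ~ t < u%:E < b.
Proof.
move=> tl; elim: s => [|u s [b /andP[tb bl] bs]]; first by exists l; rewrite ?tl ?lexx.
have [ub|ub] := boolP (t < u%:E < b).
  have [tu {}ub] := andP ub.
  exists u%:E; first by rewrite tu (le_trans (ltW ub)).
  move=> w; rewrite inE => /predU1P[->|/bs wb /andP[tw wu]]; first by rewrite ltxx andbF.
  by apply: wb; rewrite tw (lt_trans wu).
exists b; first by rewrite tb.
by move=> w; rewrite inE => /predU1P[->|/bs//]; exact/negP.
Qed.

Lemma gap_left (s : seq R) (t l : \bar R) : l < t ->
  exists2 a, l <= a < t & forall u, u \in s -> ~ a < u%:E < t.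
Proof.
move=> lt; elim: s => [|u s [b /andP[lb bt] bs]]; first by exists l; rewrite ?lt ?lexx.
have [ub|ub] := boolP (b < u%:E < t).
  have [bu {}ut] := andP ub.
  exists u%:E; first by rewrite ut andbT (le_trans lb)// ltW.
  move=> w; rewrite inE => /predU1P[->|/bs wb /andP[uw wt]]; first by rewrite ltxx.
  by apply: wb; rewrite wt (lt_trans bu).
exists b; first by rewrite lb.
by move=> w; rewrite inE => /predU1P[->|/bs//]; exact/negP.
Qed.

Lemma piecewise_linear_right f e (t : \bar R) : piecewise_linear_on f e ->
  0 <= t < len e -> exists m, exists2 b, t < b <= len e & affine_on f e t b m.
Proof.
move=> [s sP] /andP[t0 tl]; have [b /andP[tb bl] bs] := gap_right s tl.
by have [m fm] := sP t b t0 tb bl bs; exists m, b; rewrite ?tb.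
Qed.

Lemma piecewise_linear_left f e (t : \bar R) : piecewise_linear_on f e ->
  0 < t <= len e -> exists m, exists2 a, 0 <= a < t & affine_on f e a t m.
Proof.
move=> [s sP] /andP[t0 tl]; have [a /andP[a0 at_] bs] := gap_left s t0.
by have [m fm] := sP a t a0 at_ tl bs; exists m, a; rewrite ?a0.
Qed.

Lemma piecewise_linear_gslope f g : continuous f ->
  (forall e, piecewise_linear_on f e) -> valid_germ g -> gslope f g (oslope f g).
Proof.
move=> fc fpl gv.
suff [m gm] : exists m, gslope f g m by rewrite (gslope_oslope gv gm).
case: g gv => -[e t] [] gv; move: (gv); rewrite /valid_germ/= => -[t0 tl].
  have [|m mP] := @piecewise_linear_right f e t%:E (fpl e); first by rewrite lee_fin t0.
  by exists m; apply: affine_gslope.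
have [|m mP] := @piecewise_linear_left f e t%:E (fpl e); first by rewrite lte_fin t0.
by exists (- m)%R; apply: affine_gslope => //=; rewrite opprK.
Qed.

(** [ereal_induction] along the edge: the property is that finitely many break points suffice up to
    t. Going past t, or reaching t from the left, costs one more break point. The end +oo of an
    infinite edge is reached by a left neighbourhood like any other end. *)
Lemma locally_affine_piecewise_linear f e :
  (forall t, 0 <= t < len e ->
    exists m, exists2 b, t < b <= len e & affine_on f e t b m) ->
  (forall t, 0 < t <= len e ->
    exists m, exists2 a, 0 <= a < t & affine_on f e a t m) ->
  piecewise_linear_on f e.
Proof.
move=> fright fleft.
pose PL l := exists s : seq R, forall a b : \bar R, 0 <= a -> a < b -> b <= l ->
  (forall t : R, t \in s -> ~ a < t%:E < b) -> exists m : int, affine_on f e a b m.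
have affS a b a' b' m : a' <= a -> b <= b' -> affine_on f e a' b' m ->
    affine_on f e a b m.
  move=> aa bb [c cE]; exists c => t /andP[at_ tb]; apply: cE.
  by rewrite (le_lt_trans aa)// (lt_le_trans tb).
have extend (l m r : \bar R) (u : R) k : PL l -> l = u%:E -> l <= r ->
    affine_on f e l r k -> PL r.
  move=> [s sP] lu lr fk; exists (u :: s) => a b a0 ab br sab.
  have [bl|lb] := leP b l; first by apply: (sP a b) => // t ts; apply: sab; rewrite inE ts orbT.
  have [la|al] := leP l a; first by exists k; exact: affS fk.
  by exfalso; apply: (sab u); rewrite ?inE ?eqxx// -lu al.
have PLS (l l' : \bar R) : l' <= l -> PL l -> PL l'.
  move=> ll [s sP]; exists s => a b a0 ab bl; apply: sP => //.
  exact: le_trans ll.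
apply: (@ereal_induction _ PL 0 (len e)).
- exact: ltW (len_gt0 e).
- by exists [::] => a b a0 ab b0; have := lt_le_trans ab b0; rewrite ltNge a0.
- move=> t tl PLt; have [k [b /andP[tb bl] fk]] := fright t tl.
  exists b => // s /andP[ts sb] sl.
  have t_fin : t \is a fin_num.
    move: tl => /andP[t0 tl]; rewrite fin_numElt (lt_le_trans _ t0)//=.
    by apply: (lt_le_trans tl); rewrite leey.
  apply: (extend t t s (fine t) k) => //; [by rewrite fineK|exact: ltW|].
  by apply: affS fk => //; exact: ltW.
- move=> t tl PLt; have [k [a /andP[a0 at_] fk]] := fleft t tl.
  have [r /andP[ar rt]] := ereal_between at_.
  apply: (extend r%:E r%:E t r k) => //; [|exact: ltW|].
    by apply: PLt; rewrite rt (le_trans a0)// ltW.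
  by apply: affS fk => //; exact: ltW.
Qed.

End Slopes.

(** * R(D) described germ by germ *)

Section GermCharacterization.
Context {R : realType} {G : weighted_graph R}.
Implicit Types (e : edge G) (x y : points G) (f : points G -> \bar R) (g : @germ R G).

(** The members of R(D) other than the constant -oo, for D vanishing at infinity, in terms of
    one-sided slopes only. Neither continuity nor finiteness of the set of break points is required,
    as both follow; this makes membership easy to establish for functions built by hand and for
    translates under the action. *)
Definition germ_system (D : points G -> int) : set (points G -> \bar R) :=
  [set f | [/\ forall x, ~ at_infinity x -> f x \is a fin_num,
    forall x, ~ at_infinity x -> exists sigma : @germ R G -> int,
      (forall g, g \in germs x -> gslope f g (sigma g)) /\
      (0 <= D x + \sum_(g <- germs x) sigma g)%R &
    forall e, len e = +oo -> exists m : int, (m <= 0)%R /\ tail_slope f e m]].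

Lemma germ_system_gslope D f g : germ_system D f -> valid_germ g ->
  exists m, gslope f g m.
Proof.
move=> [_ fg _] gv; have [s [/(_ g) sg _]] := fg _ (valid_germ_finite gv).
by exists (s g); apply: sg; exact: mem_germs.
Qed.

(** The parameter may move to both sides even at an end of the edge: beyond the end [edge_pt] is
    constant, which gives slope 0. *)
Lemma gslope_local f e (t : R) : 0 <= t%:E <= len e ->
  (forall g, valid_germ g -> exists m, gslope f g m) ->
  f (edge_pt e t%:E) \is a fin_num ->
  (exists (m d : R), (0 < d)%R /\ forall s : R, (0 <= s < d)%R ->
     f (edge_pt e (t + s)%:E) = (fine (f (edge_pt e t%:E)) + m * s)%:E) /\
  (exists (m d : R), (0 < d)%R /\ forall s : R, (0 <= s < d)%R ->
     f (edge_pt e (t - s)%:E) = (fine (f (edge_pt e t%:E)) + m * s)%:E).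
Proof.
move=> /andP[t0 tl] fg f_fin; split.
  have [lt|tl'] := leP (len e) t%:E.
    exists 0%R, 1%R; split=> // s /andP[s0 _]; rewrite mul0r addr0 fineK//.
    by rewrite !edge_pt_ge// (le_trans lt)// lee_fin lerDl.
  have [|m [d d0 dm]] := fg (e, t, true); first by rewrite /valid_germ/= -lee_fin.
  by exists m%:~R, d; split=> // s /dm; rewrite /gpt /gpos/= addr0.
have [t0'|t0'] := leP t%:E 0.
  exists 0%R, 1%R; split=> // s /andP[s0 _]; rewrite mul0r addr0 fineK//.
  rewrite !edge_pt_le0// lee_fin; move: t0'; rewrite lee_fin => ?; lra.
have [|m [d d0 dm]] := fg (e, t, false); first by rewrite /valid_germ/= -lte_fin.
by exists m%:~R, d; split=> // s /dm; rewrite /gpt /gpos/= subr0.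
Qed.

(** By the quotient topology it suffices that f is continuous along each [edge_pt e], defined on the
    whole extended line. It has affine germs on both sides of a parameter in the edge, is constant
    near a parameter outside, and at the leaf end of an infinite edge the tail condition applies. *)
Lemma germ_system_continuous D f : germ_system D f -> continuous f.
Proof.
move=> fD; have [f_fin fg f_tail] := fD.
apply: continuous_points => e.
have near_cst (t : \bar R) (U : set \bar R) : open U -> U t ->
    (forall u, U u -> edge_pt e u = edge_pt e t) ->
    {for t, continuous (f \o edge_pt e)}.
  move=> Uo Ut UE; apply: cvg_near_cst.
  by apply: filterS (open_nbhs_nbhs (conj Uo Ut)) => u /UE ue; rewrite /= ue.
case=> [t| |].
- have [tl|lt] := boolP (0 <= t%:E <= len e).
    have /andP[_ tl'] := tl.
    have [|[m [d [d0 dm]]] [n [d' [d'0 dn]]]] :=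
        gslope_local tl (fun g => germ_system_gslope fD).
      by apply: f_fin; exact: edge_pt_finite.
    have md : (0 < Num.min d d')%R by rewrite lt_min d0.
    apply: (@continuous_affine_germs _ (f \o edge_pt e) t m n _ md) => s.
      by rewrite lt_min => /and3P[s0 sd _]; apply: dm; rewrite s0.
    by rewrite lt_min => /and3P[s0 _ sd]; apply: dn; rewrite s0.
  have [t0|t0] := ltP t%:E 0.
    apply: (near_cst _ [set u | u < 0]) => //; first exact: open_ereal_lt_ereal.
    by move=> u /= u0; rewrite !edge_pt_le0// ltW.
  have {}lt : len e < t%:E by move: lt; rewrite t0/= ltNge.
  apply: (near_cst _ [set u | len e < u]) => //; first exact: open_ereal_gt_ereal.
  by move=> u /= u0; rewrite !edge_pt_ge// ltW.
- have [le|le] := eqVneq (len e) +oo.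
    have [m [m0 [c [a [fE fy]]]]] := f_tail e le.
    have mR0 : (m%:~R <= 0 :> R)%R by rewrite -[0%R]/(0%:~R) ler_int.
    apply: (proj2 (@tail_limit _ (f \o edge_pt e) m%:~R c a mR0 fE)).
    by rewrite /= edge_pt_ge ?leey// fy intr_eq0.
  apply: (near_cst _ [set u | len e < u]); first exact: open_ereal_gt_ereal.
    by rewrite /= ltey.
  by move=> u /= u0; rewrite !edge_pt_ge ?leey// ltW.
- apply: (near_cst _ [set u | u < 0]); first exact: open_ereal_lt_ereal.
    exact: ltNy0.
  by move=> u /= u0; rewrite !edge_pt_le0// ltW.
Qed.

Lemma tail_slope_affine f e m : len e = +oo -> tail_slope f e m ->
  exists2 a, 0 <= a < +oo & affine_on f e a +oo m.
Proof.
move=> le [c [a [fE _]]]; exists (Num.max 0 a)%:E.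
  by rewrite ltry lee_fin le_max lexx.
exists c => t /andP[at_ _]; apply: fE.
by move: at_; rewrite lte_fin gt_max => /andP[].
Qed.

Lemma ord_infinity f e : len e = +oo -> ord f (Vertex (tgt e)) = (- slope_before f e +oo)%R.
Proof.
move=> le; rewrite /ord big_pred0 ?sub0r; last first.
  by move=> e'; apply/negbTE/eqP; exact: src_not_leaf.
rewrite (big_pred1 e) ?le// => e'.
by rewrite /=; apply/idP/idP => [/eqP/(infinite_leaf le)/eqP//|/eqP ->].
Qed.

Lemma germ_system_ltey D f : germ_system D f -> forall x, f x < +oo.
Proof.
move=> [f_fin _ f_tail] x.
have [/at_infinityP[e le ->]|xfin] := pselect (at_infinity x).
  by have [m [_ [c [a [_ ->]]]]] := f_tail e le; case: ifP => // _; rewrite ltry.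
by have := f_fin x xfin; rewrite fin_numElt => /andP[].
Qed.

Lemma germ_systemP (D : divisor G) f : effective D ->
  (forall x, at_infinity x -> D x = 0%R) ->
  linear_system_functions D f /\ f <> cst -oo <-> germ_system D f.
Proof.
move=> D0 Dinf; split.
  move=> [[[[//|[fc f_fin fpl]] _ fD]|//] fNy]; split=> // [x xfin|e le].
    exists (oslope f); rewrite -ord_germs//; split=> // g.
    by move=> /(germsP _ xfin)[_]; exact: piecewise_linear_gslope.
  have [|m [a /andP[a0 ay] fm]] := @piecewise_linear_left _ _ f e +oo (fpl e).
    by rewrite le lexx lt0y.
  have bE : slope_before f e +oo = m by apply: slope_beforeE fm; rewrite a0.
  have m0 : (m <= 0)%R.
    have := fD (Vertex (tgt e)).
    rewrite ord_infinity// bE Dinf ?add0r ?oppr_ge0//.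
    by apply/at_infinityP; exists e.
  exists m; split=> //.
  have [c cE] := fm; case: a a0 ay fm cE => [a| |]//; rewrite lee_fin => a0 _ _ cE.
  have cE' t : (a < t)%R -> f (edge_pt e t%:E) = (c + m%:~R * t)%:E.
    by move=> at_; apply: cE; rewrite lte_fin at_ ltry.
  exists c, a; split=> //.
  have mR0 : (m%:~R <= 0 :> R)%R by rewrite -[0%R]/(0%:~R) ler_int.
  have := proj1 (@tail_limit _ (f \o edge_pt e) _ _ _ mR0 cE')
    (@continuous_edge _ _ _ _ e fc +oo).
  by rewrite /= edge_pt_ge ?leey// intr_eq0.
move=> fD; have fc := germ_system_continuous fD; have [f_fin fg f_tail] := fD.
have fNy : f <> cst -oo.
  by move=> fE; have [v /f_fin] := @finite_vertex R G; rewrite fE.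
have fpl e : piecewise_linear_on f e.
  apply: locally_affine_piecewise_linear => t /andP[].
    case: t => [t| |]; [|by move=> _; rewrite ltNge leey|by rewrite leeNy_eq].
    rewrite lee_fin => t0 tl.
    have gv : valid_germ (e, t, true) by [].
    by have [m /(gslope_affine gv)/= mP] := germ_system_gslope fD gv; exists m.
  case: t => [t| |]; [|move=> _|by rewrite ltNge leNye]; last first.
    rewrite leye_eq => /eqP le.
    have [m [_ /(tail_slope_affine le) mP]] := f_tail e le.
    by exists m.
  rewrite lte_fin => t0 tl.
  have gv : valid_germ (e, t, false) by [].
  by have [m /(gslope_affine gv)/= mP] := germ_system_gslope fD gv; exists (- m)%R.
split=> //; left; split=> //; first by right.
move=> x; have [/[dup] /Dinf -> /at_infinityP[e le ->]|xfin] := pselect (at_infinity x).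
  have [m [m0 mt]] := f_tail e le.
  have [a aP fa] := tail_slope_affine le mt.
  by rewrite ord_infinity// (slope_beforeE aP fa) add0r oppr_ge0.
have [s [sg]] := fg x xfin; rewrite ord_germs//; congr (0 <= _ + _)%R.
apply: eq_big_seq => g gx; apply/esym/gslope_oslope; last exact: sg.
by have /(germsP _ xfin)[] := gx.
Qed.

End GermCharacterization.

(** * Small spheres and invariance under isometries *)

Section Distance.
Context {R : realType} {G : weighted_graph R}.
Implicit Types (e : edge G) (x y z : points G) (g : @germ R G).

Lemma chain_ge0 x y (L : \bar R) : chain x y L -> 0 <= L.
Proof. by elim=> // {}x e s t {}y {}L *; apply: adde_ge0. Qed.

Lemma dist_edge_le e (s t : \bar R) : 0 <= s <= len e -> 0 <= t <= len e ->
  dist (edge_pt e s) (edge_pt e t) <= `|t - s|.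
Proof.
move=> se te; apply: ereal_inf_lbound => /=.
by have := chain_cons se te (chain_nil _); rewrite adde0.
Qed.

Lemma dist_xx x : dist x x <= 0.
Proof. by apply: ereal_inf_lbound; exact: chain_nil. Qed.

(** Lower bounds for the distance come from test functions: since chains consist of edge segments,
    being 1-Lipschitz along each edge is enough. *)
Lemma lipschitz_dist (F : points G -> \bar R) x y :
  (forall e (s t : \bar R), 0 <= s <= len e -> 0 <= t <= len e ->
     F (edge_pt e t) <= F (edge_pt e s) + `|t - s|) ->
  F x \is a fin_num -> F y <= F x + dist x y.
Proof.
move=> Flip Fx.
suff FL L : chain x y L -> F y <= F x + L.
  by rewrite -leeBlDl//; apply: le_ereal_inf_tmp => L /FL; rewrite leeBlDl.
move=> xyL; elim: xyL {Fx} => [z|e s t z {}L es et _ IH]; first by rewrite adde0.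
by apply: (le_trans IH); rewrite addeA leeD2r//; exact: Flip.
Qed.

Lemma dist_infinity x y : at_infinity x -> y <> x -> dist x y = +oo.
Proof.
move=> /at_infinityP[e0 le0 xE] yx.
(* This test function is 1-Lipschitz because every nontrivial segment starting at a point at
   infinity has infinite length. *)
pose F z : \bar R := if z == x then 0 else +oo.
have : F y <= F x + dist x y.
  apply: lipschitz_dist; last by rewrite /F eqxx.
  move=> e s t /andP[s0 sl] /andP[t0 tl]; rewrite /F.
  have [sx|_] := eqVneq (edge_pt e s) x; last first.
    by rewrite addye ?leey// gt_eqF// (lt_le_trans _ (abse_ge0 _))// ltNy0.
  case: ifP => [_|_]; first by rewrite add0e abse_ge0.
  have ls : s = +oo.
    move: sx; rewrite xE => /edge_pt_vertex[[_ /esym/(src_not_leaf le0)//]|[ls te]].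
    by apply/eqP; rewrite -leye_eq -le0 -(infinite_leaf le0 (esym te)).
  by rewrite add0e ls; case: t {t0 tl}.
by rewrite /F eqxx add0e; case: eqP => // _; rewrite leye_eq => /eqP.
Qed.

(** The test function is the coordinate along e, extended by 0 to the rest of the graph. It makes
    isometries act as translations on the tails of infinite edges. *)
Lemma dist_tail e (s t : R) : len e = +oo -> (0 < s)%R -> (s < t)%R ->
  dist (edge_pt e s%:E) (edge_pt e t%:E) = (t - s)%:E.
Proof.
move=> le s0 st; have t0 := lt_trans s0 st.
apply/le_anti/andP; split.
  have := @dist_edge_le e s%:E t%:E; rewrite le !leey !lee_fin ltW// ltW//.
  by rewrite -EFinB abse_EFin gtr0_norm ?subr_gt0//; exact.
pose F z : \bar R := match z with
  | Vertex v => if v == tgt e then +oo else 0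
  | Interior p => if (val p).1 == e then (val p).2%:E else 0
  end.
have Fe (u : \bar R) : 0 <= u -> F (edge_pt e u) = u.
  rewrite le_eqVlt => /predU1P[<-|u0].
    by rewrite edge_pt0/=; case: eqP => // /(src_not_leaf le).
  case: u u0 => [u| |]// u0; last by rewrite edge_pt_ge ?leey//= eqxx.
  have u_in : in_interior (e, u) by rewrite /in_interior/= -lte_fin u0 le ltry.
  by rewrite edge_ptE/= eqxx.
have Fne e' (u : \bar R) : e' != e -> F (edge_pt e' u) = 0.
  move=> ee'; have [z zE] : exists z, z = edge_pt e' u by exists (edge_pt e' u).
  rewrite -zE; case: (pointP z) zE.
    move=> v /esym/edge_pt_vertex[[_ ->]|[_ ->]]/=; case: eqP => //.
      by move=> /(src_not_leaf le).
    by move=> /(infinite_leaf le)/eqP; rewrite (negbTE ee').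
  move=> e1 r r0 rl /(edge_pt_inj r0 rl)[ee _].
  have r_in : in_interior (e1, r) by rewrite /in_interior/= r0.
  by rewrite edge_ptE/= -ee (negbTE ee').
have : F (edge_pt e t%:E) <= F (edge_pt e s%:E) + dist (edge_pt e s%:E) (edge_pt e t%:E).
  apply: lipschitz_dist; last by rewrite Fe// lee_fin ltW.
  move=> e' u v /andP[u0 _] /andP[v0 _].
  have [->|ee'] := eqVneq e' e; last by rewrite !Fne// add0e abse_ge0.
  rewrite !Fe//; case: u u0 => [u| |]// u0; last first.
    by rewrite addye ?leey// gt_eqF// (lt_le_trans ltNy0 (abse_ge0 _)).
  case: v v0 => [v| |]// v0.
  by rewrite lee_fin -lerBlDl ler_norm.
have s0' : 0 <= s%:E by rewrite lee_fin ltW.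
have t0' : 0 <= t%:E by rewrite lee_fin ltW.
by rewrite EFinB leeBlDl// (Fe _ s0') (Fe _ t0').
Qed.

(** The gap at a vertex is the least edge length, infinite edges counting as 1 and the minimum being
    capped at 1; at an interior point it is at most the distance to either end of the edge. A path
    shorter than d starting at x therefore meets no vertex other than possibly x. *)
Lemma base_gap x : ~ at_infinity x -> exists2 d : R, (0 < d)%R &
  forall e (s : R), (0 <= s)%R -> s%:E <= len e -> edge_pt e s%:E = x ->
    (s = 0 \/ d <= s)%R /\ (s%:E = len e \/ (s + d)%:E <= len e).
Proof.
case: (pointP x) => [v vfin|e t t0 tl _].
  pose l (e : edge G) : R := if len e == +oo then 1%R else fine (len e).
  have l_len e : (l e)%:E <= len e.
    by rewrite /l; case: eqP => [->|/len_fin <-//]; exact: leey.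
  have l0 e : (0 < l e)%R.
    rewrite /l; case: eqP => // /len_fin le.
    by rewrite -lte_fin -le len_gt0.
  pose d := \big[Num.min/1%R]_e l e.
  have dl e : (d%:E <= len e).
    by apply: le_trans (l_len e); rewrite lee_fin; exact: bigmin_le.
  exists d; first by rewrite lt_bigmin.
  move=> e s s0 sl /edge_pt_vertex[[s0' _]|[ls _]].
    have -> : s = 0%R by apply/le_anti; rewrite s0 -lee_fin s0'.
    by split; [left|right; rewrite add0r].
  have sE : s%:E = len e by apply/le_anti; rewrite sl ls.
  by split; [right; rewrite -lee_fin sE|left].
have [r /andP[tr rl]] := ereal_between tl; rewrite lte_fin in tr.
exists (Num.min t (r - t))%R; first by rewrite lt_min t0 subr_gt0.
move=> e' s s0 sl /esym/(edge_pt_inj t0 tl)[-> [->]].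
split; right; first by rewrite ge_min lexx.
apply: le_trans (ltW rl); rewrite lee_fin.
have : (Num.min t (r - t) <= r - t)%R by rewrite ge_min lexx orbT.
lra.
Qed.

Section Sphere.
Variables (x : points G) (d : R).
Hypotheses (xfin : ~ at_infinity x) (d0 : (0 < d)%R)
  (gap : forall e (s : R), (0 <= s)%R -> s%:E <= len e -> edge_pt e s%:E = x ->
    (s = 0 \/ d <= s)%R /\ (s%:E = len e \/ (s + d)%:E <= len e)).

Definition edge_near (r : R) y : Prop := exists e (s t : R),
  [/\ (0 <= s)%R /\ s%:E <= len e, (0 <= t)%R /\ t%:E <= len e,
      edge_pt e s%:E = x, edge_pt e t%:E = y & (`|t - s| <= r)%R].

(** A short chain collapses to one segment issuing from x: an end of an edge reached before the
    length d is used up can only be x itself, so the chain changes edges only at x. Here r is the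
    length already spent and l bounds what remains. *)
Lemma chain_edge_near z y L (r l : R) : chain z y L -> (0 <= r)%R ->
  z = x \/ edge_near r z -> L <= l%:E -> (r + l < d)%R ->
  y = x \/ edge_near (r + l) y.
Proof.
move=> zyL; elim: zyL r l => {z y L}.
  move=> z r l r0 zx l0 _; case: zx => [->|[e [s [t [se te sx tz st]]]]]; first by left.
  right; exists e, s, t; split=> //; apply: (le_trans st).
  by rewrite lerDl -lee_fin.
move=> e s t y L /andP[s0 sl] /andP[t0 tl] ch IH r l r0 zx Ll rl.
have L0 := chain_ge0 ch.
have st_fin : `|t - s| \is a fin_num.
  rewrite ge0_fin_numE ?abse_ge0//; apply: le_lt_trans (ltry l).
  by apply: le_trans Ll; rewrite leeDl.
case: s s0 sl zx Ll st_fin => [s| |]//; last by case: t {t0 tl ch IH}.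
case: t t0 tl ch IH => [t| |]//.
rewrite !lee_fin => t0 tl ch IH s0 sl zx Ll _.
have {}Ll : L <= (l - `|t - s|)%:E.
  by rewrite EFinB leeBrDl// -abse_EFin EFinB.
suff : edge_near (r + `|t - s|)%R (edge_pt e t%:E).
  move=> near_t.
  have := IH (r + `|t - s|)%R (l - `|t - s|)%R.
  rewrite (_ : r + `|t - s| + (l - `|t - s|) = r + l)%R; last by lra.
  by apply=> //; [apply: addr_ge0|right].
have [sx|sx] := pselect (edge_pt e s%:E = x).
  by exists e, s, t; split=> //; rewrite lerDr.
case: zx => [//|[e1 [s1 [t1 [[s10 s1l] [t10 t1l] s1x t1z st1]]]]].
have rd : (r < d)%R.
  have : (0 <= l - `|t - s|)%R by rewrite -lee_fin (le_trans L0).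
  have := normr_ge0 (t - s)%R; lra.
have no_vertex : t1 <> 0%R /\ t1%:E <> len e1.
  have [g0 g1] := gap s10 s1l s1x.
  split=> [t1E|t1E].
    case: g0 => [s1E|ds1]; first by apply: sx; rewrite -t1z t1E -s1E.
    by move: st1; rewrite t1E sub0r normrN ger0_norm//; lra.
  case: g1 => [s1E|ds1]; first by apply: sx; rewrite -t1z t1E -s1E.
  move: ds1; rewrite -t1E lee_fin => ds1.
  by have := ler_norm (t1 - s1)%R; lra.
case: no_vertex => t1n0 t1nl.
have {}t10 : (0 < t1)%R by rewrite lt_neqAle t10 eq_sym andbT; exact/eqP.
have {}t1l : t1%:E < len e1 by rewrite lt_neqAle t1l andbT; exact/eqP.
have [ee [sE]] := edge_pt_inj t10 t1l t1z.
subst e1 s; exists e, s1, t; split=> //.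
have -> : (t - s1 = (t1 - s1) + (t - t1))%R by lra.
by apply: (le_trans (ler_normD _ _)); rewrite lerD2r.
Qed.

Lemma dist_edge_near y (l : R) : dist x y < l%:E -> (l < d)%R ->
  y = x \/ edge_near l y.
Proof.
move=> /ereal_inf_lt[L /= xyL Ll] ld.
have := @chain_edge_near x y L 0 l xyL; rewrite add0r; apply=> //.
- by left.
- exact: ltW.
Qed.

(** Half of the gap is needed because of loops: both ends of an edge may be x, and a point at
    distance between d/2 and d from one end can be as close to the other. *)
Lemma edge_near_uniq e e' (s t s' t' : R) :
  (0 <= s)%R -> s%:E <= len e -> (0 <= t)%R -> t%:E <= len e ->
  (0 <= s')%R -> s'%:E <= len e' ->
  edge_pt e s%:E = x -> edge_pt e' s'%:E = x ->
  edge_pt e t%:E = edge_pt e' t'%:E -> t != s ->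
  (`|t - s| < d / 2)%R -> (`|t' - s'| < d / 2)%R -> [/\ e = e', s = s' & t = t'].
Proof.
move=> s0 sl t0 tl s'0 s'l sx s'x tt' ts ts1 ts2.
have [g0 g1] := gap s0 sl sx.
have t0' : (0 < t)%R.
  rewrite lt_neqAle t0 andbT; apply/eqP => tE.
  case: g0 => [sE|ds]; first by move: ts; rewrite sE -tE eqxx.
  by move: ts1; rewrite -tE sub0r normrN ger0_norm//; lra.
have tl' : t%:E < len e.
  rewrite lt_neqAle tl andbT; apply/eqP => tE.
  case: g1 => [sE|ds]; first by move: ts; rewrite -(@eqe R) tE sE eqxx.
  move: ds; rewrite -tE lee_fin => ds.
  by have := ler_norm (t - s)%R; have := d0; lra.
have [ee [tE]] := edge_pt_inj t0' tl' tt'; subst e' t'.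
split=> //.
have base_le (a b : R) : (0 <= a)%R -> b%:E <= len e -> edge_pt e a%:E = x ->
    edge_pt e b%:E = x -> (`|t - a| < d / 2)%R -> (`|t - b| < d / 2)%R -> (b <= a)%R.
  move=> a0 bl ax bx ta tb; rewrite leNgt; apply/negP => ab.
  have al : a%:E < len e by apply: lt_le_trans bl; rewrite lte_fin.
  have b0 : (0 <= b)%R by lra.
  have a0' : a = 0%R.
    apply/eqP; rewrite eq_le a0 andbT leNgt; apply/negP => a_gt0.
    have [_ [ba]] := edge_pt_inj a_gt0 al (etrans ax (esym bx)); lra.
  have [[b_0|db] _] := gap b0 bl bx; first lra.
  have := ler_norm (t - a)%R; have := ler_norm (b - t)%R; rewrite distrC; lra.
by apply/le_anti/andP; split; apply: base_le.
Qed.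

Lemma germ_base g : g \in germs x ->
  [/\ edge_pt g.1.1 g.1.2%:E = x, (0 <= g.1.2)%R & g.1.2%:E <= len g.1.1].
Proof.
move=> /(germsP _ xfin)[]; rewrite /gpt gpos0 /valid_germ => gx gv; split=> //.
  by move: gv; case: ifP => _ [+ _]// => /ltW.
by move: gv; case: ifP => _ [_ +]// => /ltW.
Qed.

Lemma germ_pos g (r : R) : g \in germs x -> (0 < r < d)%R ->
  (0 <= gpos g r)%R /\ (gpos g r)%:E <= len g.1.1.
Proof.
move=> gx /andP[r0 rd]; have [bx b0 bl] := germ_base gx.
have [g0 g1] := gap b0 bl bx.
have /(germsP _ xfin)[_] := gx; rewrite /valid_germ /gpos; case: ifP => _ [v0 vl].
  split; first lra.
  case: g1 => [E|g1]; first by move: vl; rewrite E ltxx.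
  by apply: le_trans g1; rewrite lee_fin; lra.
split; first lra.
by apply: le_trans vl; rewrite lee_fin; lra.
Qed.

Lemma gpos_dist g (r : R) : (0 < r)%R -> (`|gpos g r - g.1.2| = r)%R /\ gpos g r != g.1.2.
Proof.
move=> r0; rewrite /gpos; case: ifP => _; rewrite [X in (`|X|)%R]addrC addKr
  ?normrN gtr0_norm//; split=> //.
  by rewrite gt_eqF// ltrDl.
by rewrite lt_eqF// gtrBl.
Qed.

Lemma dist_gpt g (r : R) : g \in germs x -> (0 < r < d / 2)%R ->
  dist x (gpt g r) = r%:E.
Proof.
move=> gx /andP[r0 rd]; have [bx b0 bl] := germ_base gx.
have rd' : (0 < r < d)%R by rewrite r0/=; lra.
have [p0 pl] := germ_pos gx rd'.
have [pr pn] := gpos_dist g r0.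
apply/le_anti/andP; split.
  rewrite -bx; have := @dist_edge_le g.1.1 g.1.2%:E (gpos g r)%:E.
  by rewrite !lee_fin b0 bl p0 pl -EFinB abse_EFin pr; exact.
rewrite leNgt; apply/negP => /ereal_between[l /andP[dl lr]].
rewrite lte_fin in lr.
have [] := dist_edge_near dl; first lra.
  rewrite -bx => E.
  have [||_ _ E'] := edge_near_uniq b0 bl p0 pl b0 bl bx bx E pn.
  - by rewrite pr.
  - by rewrite subrr normr0; lra.
  by move: pn; rewrite E' eqxx.
move=> [e [s [t [[s0 sl] [t0 tl] sx tE ts]]]].
have [||ee sE tE'] := edge_near_uniq b0 bl p0 pl s0 sl bx sx (esym tE) pn.
- by rewrite pr.
- lra.
by move: ts; rewrite -sE -tE' pr; lra.
Qed.

(** As the distance is an infimum, it only yields segments of length at most l for each l > r. By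
    uniqueness, however, these are all the same segment, whose length is therefore exactly r. *)
Lemma sphere_gpt y (r : R) : (0 < r < d / 2)%R -> dist x y = r%:E ->
  exists2 g, g \in germs x & y = gpt g r.
Proof.
move=> /andP[r0 rd] xyr.
have yx : y <> x.
  by move=> yx; have := dist_xx x; rewrite -{2}yx xyr lee_fin; lra.
have near_y (l : R) : (r < l)%R -> (l < d / 2)%R -> edge_near l y.
  move=> rl ld; have ld' : (l < d)%R by have := d0; lra.
  have xyl : dist x y < l%:E by rewrite xyr lte_fin.
  by case: (dist_edge_near xyl ld').
have [||e [s [t [[s0 sl] [t0 tl] sx ty ts]]]] := near_y ((r + d / 2) / 2)%R.
- lra.
- lra.
have tns : t != s.
  by apply/eqP => E; apply: yx; rewrite -ty E.
have rts : (r <= `|t - s|)%R.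
  have := @dist_edge_le e s%:E t%:E.
  by rewrite !lee_fin s0 sl t0 tl sx ty xyr -EFinB abse_EFin lee_fin; exact.
have {}ts : (`|t - s| < d / 2)%R by lra.
have tsE : (`|t - s| = r)%R.
  apply/eqP; rewrite eq_le rts andbT leNgt; apply/negP => rts'.
  have [||e' [s' [t' [[s'0 s'l] [t'0 t'l] s'x t'y ts']]]] := near_y ((r + `|t - s|) / 2)%R.
  - lra.
  - lra.
  have [|ee sE tE] := edge_near_uniq s0 sl t0 tl s'0 s'l sx s'x (etrans ty (esym t'y)) tns ts.
    lra.
  by move: ts'; rewrite -sE -tE; lra.
exists (e, s, (s < t)%R); last first.
  rewrite -ty /gpt /gpos/= -tsE; congr (edge_pt e _%:E).
  have [st|ts'] := @ltP _ R s t; first by rewrite gtr0_norm ?subr_gt0//; lra.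
  by rewrite ler0_norm ?subr_le0//; lra.
apply/germsP => //; rewrite /gpt gpos0; split=> //.
rewrite /valid_germ/=; have [st|ts'] := @ltP _ R s t; split=> //.
  by apply: lt_le_trans tl; rewrite lte_fin.
by move/eqP: tns => ?; lra.
Qed.

Lemma uniq_sphere (r : R) : (0 < r < d / 2)%R -> uniq [seq gpt g r | g <- germs x].
Proof.
move=> /andP[r0 rd]; rewrite map_inj_in_uniq ?uniq_germs// => g g' gx g'x E.
have rd' : (0 < r < d)%R by rewrite r0/=; lra.
have [bx b0 bl] := germ_base gx; have [bx' b0' bl'] := germ_base g'x.
have [p0 pl] := germ_pos gx rd'.
have [pr pn] := gpos_dist g r0; have [pr' _] := gpos_dist g' r0.
have [||ee sE] := edge_near_uniq b0 bl p0 pl b0' bl' bx bx' E pn; rewrite ?pr ?pr'//.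
case: g g' ee sE {gx g'x E bx b0 bl bx' b0' bl' p0 pl pr pn pr'}.
move=> [e s] b [[e' s'] b'] /= -> ->; rewrite /gpos/=.
by case: b; case: b' => // E; exfalso; lra.
Qed.

End Sphere.

(** Expresses the germs at x through the distance alone, each exactly once, so that an isometry
    carries the points of one family of germs to those of another. *)
Lemma sphere x : ~ at_infinity x -> exists2 d : R, (0 < d)%R &
  forall r : R, (0 < r < d)%R -> uniq [seq gpt g r | g <- germs x] /\
    forall y, dist x y = r%:E <-> y \in [seq gpt g r | g <- germs x].
Proof.
move=> xfin; have [d d0 gap] := base_gap xfin.
exists (d / 2)%R; first by rewrite divr_gt0.
move=> r rd; split; first exact: (uniq_sphere xfin d0 gap).
move=> y; split=> [/(sphere_gpt xfin d0 gap rd)[g gx ->]|/mapP[g gx ->]].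
  exact: map_f.
exact: (dist_gpt xfin d0 gap).
Qed.

End Distance.

Section IntegerSlope.
Context {R : realType}.

(* By the intermediate value theorem, the slope (phi r - c) / r, which is
   continuous and takes integer values, is constant. *)
Lemma integer_slope (phi : R -> R) (c d : R) : (0 < d)%R ->
  {in `]0, d[%R, continuous phi} ->
  (forall r, (0 < r < d)%R -> exists m : int, phi r = (c + m%:~R * r)%R) ->
  exists m : int, forall r, (0 < r < d)%R -> phi r = (c + m%:~R * r)%R.
Proof.
move=> d0 phic phiE.
pose q r := ((phi r - c) / r)%R.
have qE r : (0 < r < d)%R -> exists m : int, q r = m%:~R /\ phi r = (c + m%:~R * r)%R.
  move=> rd; have [m pm] := phiE r rd; exists m; split=> //.
  have r0 : r != 0%R by rewrite gt_eqF//; case/andP: rd.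
  by rewrite /q pm addrAC subrr add0r mulfK.
have q_cst a b : (0 < a)%R -> (a <= b)%R -> (b < d)%R -> q a = q b.
  move=> a0 ab bd.
  have qc : {within `[a, b], continuous q}.
    apply: continuous_in_subspaceT => r; rewrite inE/= in_itv/= => /andP[ar rb].
    have r0 : (0 < r)%R by lra.
    apply: cvgM; last by apply: cvgV; [rewrite gt_eqF|exact: cvg_id].
    apply: cvgB; last exact: cvg_cst.
    by apply: phic; rewrite in_itv/=; apply/andP; split; lra.
  have [|m [am _]] := qE a; first by apply/andP; split; lra.
  have [|n [bn _]] := qE b; first by apply/andP; split; lra.
  rewrite am bn; congr (_%:~R).
  (* Between two distinct integers q would take the value k + 1/2, but twice this value is odd while
     all values of q are integers. *)
  have half (k : int) : (m <= k < n)%R \/ (n <= k < m)%R -> False.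
    move=> mkn; have [|r rab qr] := @IVT R q a b (k%:~R + 2^-1)%R ab qc.
      have lek (i j : int) : (i <= j)%R -> (i%:~R <= j%:~R :> R)%R by rewrite ler_int.
      rewrite am bn ge_min le_max; case: mkn => /andP[/lek h1 h2].
        have {h2} : (k + 1 <= n)%R by lia.
        move=> /lek; rewrite rmorphD/= => h2.
        apply/andP; split; apply/orP; [left|right]; lra.
      have {h2} : (k + 1 <= m)%R by lia.
      move=> /lek; rewrite rmorphD/= => h2.
      apply/andP; split; apply/orP; [right|left]; lra.
    move: rab; rewrite in_itv/= => /andP[ar rb].
    have [|j [jk _]] := qE r; first by apply/andP; split; lra.
    rewrite jk in qr; have /eqP : ((2 * j)%:~R = (2 * k + 1)%:~R :> R)%R.
      by rewrite !(rmorphD, rmorphM)/= qr; field.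
    by rewrite eqr_int => /eqP; lia.
  have [mn|nm|//] := ltgtP m n; exfalso.
    by apply: (half m); left; rewrite lexx mn.
  by apply: (half n); right; rewrite lexx nm.
have d2 : (0 < d / 2 < d)%R by apply/andP; split; lra.
have [m [qm _]] := qE _ d2.
exists m => r rd; have [k [qk ->]] := qE r rd.
have -> : k = m; last by [].
apply/eqP; rewrite -(eqr_int R) -qk -qm; apply/eqP.
case/andP: rd => r0 rd.
have [rle|ltr] := @leP _ R r (d / 2)%R; first by apply: q_cst => //; lra.
by apply/esym/q_cst => //; lra.
Qed.

End IntegerSlope.

Section IsometryInvariance.
Context {R : realType} {G : weighted_graph R} {K : finGroupType}.
Variable to : {action K &-> points G}.
Hypothesis hto : isometric_action to.
Implicit Types (e : edge G) (x y : points G) (k : K) (f : points G -> \bar R) (g : @germ R G).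

Lemma act_pt_inj k x y : to x k = to y k -> x = y.
Proof. by case: to => act [inj_act _] /=; exact: inj_act. Qed.

Lemma act_ptM x k k' : to x (k * k')%g = to (to x k) k'.
Proof. by case: to => act [_ actM] /=; apply: actM; rewrite inE. Qed.

Lemma act_pt1 x : to x 1%g = x.
Proof. by apply: (@act_pt_inj 1%g); rewrite -act_ptM mulg1. Qed.

Lemma act_ptK k x : to (to x k) k^-1%g = x.
Proof. by rewrite -act_ptM mulgV act_pt1. Qed.

Lemma act_ptKV k x : to (to x k^-1%g) k = x.
Proof. by rewrite -act_ptM mulVg act_pt1. Qed.

(** Distinguishes finite points from points at infinity metrically, as the latter are at distance
    +oo from all others. The second hypothesis excludes the graph reduced to one point, where x has
    no neighbour. *)
Lemma finite_neighbour x : ~ at_infinity x -> (exists y, at_infinity y) ->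
  exists y, y <> x /\ dist x y < (+oo : \bar R).
Proof.
move=> xfin [y /at_infinityP[e0 le0 _]].
have [g gx] : exists g, g \in germs x.
  move: xfin; case: (pointP x) => [v vfin|e t t0 tl _]; last first.
    have t_in : in_interior (e, t) by rewrite /in_interior/= t0.
    by exists (e, t, true); rewrite edge_ptE/= inE eqxx.
  suff [e [se|te]] : exists e, src e = v \/ tgt e = v.
  - exists (e, 0%R, true); apply/germsP => //; rewrite /gpt gpos0 edge_pt0 se.
    by split=> //; rewrite /valid_germ/=; split=> //; exact: len_gt0.
  - exists (e, fine (len e), false); apply/germsP => //.
    have le := finite_tgt_len vfin te.
    rewrite /gpt gpos0/= -len_fin// edge_pt_ge// te; split=> //.
    by rewrite /valid_germ/= -lte_fin -len_fin//; split => //; exact: len_gt0.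
  have /connectP[[|u p]/=] := graph_connected v (src e0).
    by move=> _ <-; exists e0; left.
  move=> /andP[/existsP[e /orP[]/andP[/eqP ev /eqP ev']] _] _; exists e; [by left|by right].
have [d d0 dP] := sphere xfin.
have d2 : (0 < d / 2 < d)%R by apply/andP; split; lra.
have [_ /(_ (gpt g (d / 2)))[_ dg]] := dP _ d2.
have {}dg : dist x (gpt g (d / 2)) = (d / 2)%:E by apply: dg; exact: map_f.
exists (gpt g (d / 2)); split; last by rewrite dg ltry.
move=> E; rewrite E in dg; have := dist_xx x.
by rewrite dg lee_fin; lra.
Qed.

Lemma act_finite k x : ~ at_infinity x -> ~ at_infinity (to x k).
Proof.
move=> xfin kinf; have [|y [yx]] := finite_neighbour xfin; first by exists (to x k).
rewrite -(proj2 (hto k)) dist_infinity//.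
by move=> /act_pt_inj.
Qed.

Lemma act_infinity k x : at_infinity x -> at_infinity (to x k).
Proof.
move=> xinf; have [//|kfin] := pselect (at_infinity (to x k)).
have := @act_finite (k^-1)%g _ kfin.
by rewrite act_ptK.
Qed.

Lemma common_radius (A : eqType) (s : seq A) (P : A -> R -> Prop) :
  (forall a, a \in s -> exists2 d : R, (0 < d)%R & forall r, (0 <= r < d)%R -> P a r) ->
  exists2 d : R, (0 < d)%R & forall a r, a \in s -> (0 <= r < d)%R -> P a r.
Proof.
elim: s => [_|a s IH sP]; first by exists 1%R.
have [|d d0 dP] := IH; first by move=> b bs; apply: sP; rewrite inE bs orbT.
have [|d' d'0 d'P] := sP a; first by rewrite inE eqxx.
exists (Num.min d d'); first by rewrite lt_min d0.
move=> b r; rewrite inE lt_min => /predU1P[->|bs] /and3P[r0 rd rd'].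
  by apply: d'P; rewrite r0.
by apply: dP; rewrite ?r0.
Qed.

(** The matching of germs may a priori depend on r; later arguments use only the equality of the two
    families of points. *)
Lemma sphere_act k x : ~ at_infinity x -> exists2 d : R, (0 < d)%R &
  forall r : R, (0 < r < d)%R ->
    perm_eq [seq to (gpt g r) k | g <- germs x] [seq gpt g r | g <- germs (to x k)].
Proof.
move=> xfin; have kfin := @act_finite k _ xfin.
have [d d0 dP] := sphere xfin; have [d' d'0 d'P] := sphere kfin.
exists (Num.min d d'); first by rewrite lt_min d0.
move=> r; rewrite lt_min => /and3P[r0 rd rd'].
have [|u1 m1] := dP r; first by rewrite r0.
have [|u2 m2] := d'P r; first by rewrite r0.
rewrite (map_comp (fun y => to y k) (fun g => gpt g r)).
apply: uniq_perm => //; first by rewrite map_inj_uniq// => y z /act_pt_inj.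
move=> y; apply/mapP/idP => [[z /m1 xz ->]|/m2 yr].
  by apply/m2; rewrite (proj2 (hto k)).
exists (to y k^-1%g); last by rewrite act_ptKV.
by apply/m1; rewrite -(proj2 (hto k)) act_ptKV.
Qed.

(** The distance does not tell to which leaf end a tail runs, so continuity is used first: far out
    on e, the translate lies far out on the edge e' ending at the image of the leaf end. There the
    isometry is a translation of the coordinate, which changes only the constant term. *)
Lemma tail_slope_act k f e : len e = +oo ->
  (forall e', len e' = +oo -> exists m : int, (m <= 0)%R /\ tail_slope f e' m) ->
  exists m : int, (m <= 0)%R /\ tail_slope (fun x => f (to x k)) e m.
Proof.
move=> le f_tail.
have [kc kd] := hto k.
have /(@act_infinity k)/at_infinityP[e' le' kE] : at_infinity (Vertex (tgt e)).
  by apply/at_infinityP; exists e.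
have [m [m0 [c [a [fE fy]]]]] := f_tail e' le'.
have tailE (b : R) : exists a' : R, forall t : R, (a' < t)%R ->
    exists2 u : R, (b < u)%R & to (edge_pt e t%:E) k = edge_pt e' u%:E.
  (* The tail of e' beyond both b and 0, as a neighbourhood of its leaf end. *)
  pose U := [set z | exists2 u : \bar R, (Num.max b 0)%:E < u & z = edge_pt e' u].
  have Uo : points_open U.
    move=> e1; have [->|ee] := eqVneq e1 e'.
      rewrite (_ : _ @^-1` _ = [set u | (Num.max b 0)%:E < u]); first exact: open_ereal_gt_ereal.
      apply/seteqP; split=> [u /= [w bw uw]|u bu]; last by exists u.
      have b0 : (0 <= Num.max b 0)%R by rewrite le_max lexx orbT.
      case: w bw uw => [w| |]// bw uw.
        have w0 : (0 < w)%R by rewrite -lte_fin; apply: le_lt_trans bw; rewrite lee_fin.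
        have [|_ ->//] := edge_pt_inj w0 _ (esym uw).
        by rewrite le' ltry.
      move: uw; rewrite [RHS]edge_pt_ge ?leey// => /edge_pt_vertex[[_ /esym]|[]].
        by move=> /(src_not_leaf le').
      by rewrite le' leye_eq => /eqP ->; rewrite ltry.
    rewrite (_ : _ @^-1` _ = set0); first exact: open0.
    apply/seteqP; split=> // u [w bw uw].
    have b0 : (0 <= Num.max b 0)%R by rewrite le_max lexx orbT.
    case: w bw uw => [w| |]// bw uw.
      have w0 : (0 < w)%R by rewrite -lte_fin; apply: le_lt_trans bw; rewrite lee_fin.
      have [|E _] := edge_pt_inj w0 _ (esym uw); first by rewrite le' ltry.
      by move: ee; rewrite E eqxx.
    move: uw; rewrite [RHS]edge_pt_ge ?leey// => /edge_pt_vertex[[_ /esym]|[_ /esym]].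
      by move=> /(src_not_leaf le').
    by move=> /(infinite_leaf le')/eqP; rewrite (negbTE ee).
  have kU : U (to (edge_pt e +oo) k).
    by exists +oo; rewrite ?ltry// !edge_pt_ge ?leey// kE.
  have := continuous_edge (e := e) kc; move=> /(_ +oo U).
  have /[swap]/[apply] : nbhs (to (edge_pt e +oo) k) U.
    by apply: open_nbhs_nbhs; split.
  move=> [a' [_ a'P]]; exists a' => t a't.
  have [] := a'P t%:E; first by rewrite lte_fin.
  case=> [u| |]//=; last first.
    move=> _ E; exfalso.
    have : ~ at_infinity (to (edge_pt e t%:E) k).
      by apply: act_finite; apply: edge_pt_finite; rewrite le leey.
    by apply; apply/at_infinityP; exists e' => //; rewrite E edge_pt_ge ?leey.
  rewrite lte_fin gt_max => /andP[bu _] E; by exists u.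
have [a1 a1P] := tailE (Num.max a 0%R).
pose t1 := (Num.max a1 0 + 1)%R.
have t1a : (a1 < t1)%R.
  by have : (a1 <= Num.max a1 0)%R; [rewrite le_max lexx|rewrite /t1; lra].
have t10 : (0 < t1)%R.
  by have : (0 <= Num.max a1 0)%R; [rewrite le_max lexx orbT|rewrite /t1; lra].
have [u1 u1a k1] := a1P t1 t1a.
move: u1a; rewrite gt_max => /andP[u1a u10].
(* Requiring images beyond u1 fixes the sign of u - u1, so that equality of distances becomes
   equality of coordinates. *)
have [a2 a2P] := tailE u1.
exists m; split=> //.
exists (c + m%:~R * (u1 - t1))%R, (Num.max a2 t1); split; last first.
  rewrite /= kE fy; case: eqP => // ->; by rewrite mul0r addr0.
move=> t; rewrite gt_max => /andP[a2t t1t].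
have [u u1u kt] := a2P t a2t.
have : (t - t1)%:E = (u - u1)%:E :> \bar R.
  by rewrite -(dist_tail le t10 t1t) -(dist_tail le' u10 u1u) -k1 -kt kd.
move=> [tu]; rewrite /= kt fE; last by apply: lt_trans u1u.
congr EFin; have -> : (u = u1 + (t - t1))%R by lra.
by ring.
Qed.

(** Along a germ at x the translate takes at each small r one of the values c + m r, where m ranges
    over the slopes at the image of x; [integer_slope] makes m independent of r. The sums of slopes
    at x and at its image agree because both are determined by the values on corresponding
    spheres. *)
Lemma germ_system_act (D : points G -> int) k f : (forall x, D (to x k) = D x) ->
  germ_system D f -> germ_system D (fun x => f (to x k)).
Proof.
move=> Dk fD; have fc := germ_system_continuous fD; have [f_fin fg f_tail] := fD.
have [kc kd] := hto k.
split.
- by move=> x xfin; apply: f_fin; exact: act_finite.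
- move=> x xfin; have kfin := @act_finite k _ xfin.
  have [s [sg sD]] := fg _ kfin.
  set c := fine (f (to x k)).
  have [d1 d10 d1P] := @sphere_act k _ xfin.
  have [d2 d20 d2P] : exists2 d : R, (0 < d)%R & forall g r,
      g \in germs (to x k) -> (0 <= r < d)%R -> f (gpt g r) = (c + (s g)%:~R * r)%:E.
    apply: common_radius => g gx; have [d d0 dP] := sg g gx.
    by exists d => // r rd; rewrite dP// ((germsP g kfin).1 gx).1.
  have sg' g : exists m : int, g \in germs x -> gslope (fun x => f (to x k)) g m /\
      forall r, (0 < r < Num.min d1 d2)%R -> f (to (gpt g r) k) = (c + m%:~R * r)%:E.
    have [gx|] := boolP (g \in germs x); last by exists 0%R.
    have d0 : (0 < Num.min d1 d2)%R by rewrite lt_min d10.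
    have fk r : (0 < r < Num.min d1 d2)%R ->
        exists m : int, f (to (gpt g r) k) = (c + m%:~R * r)%:E.
      rewrite lt_min => /and3P[r0 rd1 rd2].
      have /perm_mem/(_ (to (gpt g r) k)) : perm_eq _ _ := d1P r (introT andP (conj r0 rd1)).
      rewrite (map_f (fun g => to (gpt g r) k) gx) => /esym/mapP[g' g'x ->].
      by exists (s g'); rewrite d2P// ltW.
    have [||m mP] := @integer_slope R (fun r => fine (f (to (gpt g r) k))) c _ d0.
    - move=> r; rewrite in_itv/= => rd.
      have [m fm] := fk r rd.
      apply: fine_cvg; rewrite fm/= -fm.
      have : {for (gpos g r)%:E, continuous ((fun x => f (to x k)) \o edge_pt g.1.1)}.
        apply: continuous_edge => z.
        by apply: (@continuous_comp _ _ _ (fun x => to x k) f); [exact: kc|exact: fc].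
      move=> fkc; apply: (@continuous_comp _ _ _ (fun r => (gpos g r)%:E)
          ((fun x => f (to x k)) \o edge_pt g.1.1)) => //.
      apply: (@continuous_comp _ _ _ (gpos g) EFin); last exact: EFin_continuous.
      rewrite /gpos; case: g.2; apply: cvgD; try exact: cvg_cst; first exact: cvg_id.
      by apply: cvgN; exact: cvg_id.
    - by move=> r rd; have [m fm] := fk r rd; exists m; rewrite fm.
    have mP' r : (0 < r < Num.min d1 d2)%R -> f (to (gpt g r) k) = (c + m%:~R * r)%:E.
      by move=> rd; rewrite -mP//; have [m' ->] := fk r rd.
    exists m => _; split=> //; exists (Num.min d1 d2) => // r /andP[].
    have -> : gpt g 0 = x by have /(germsP _ xfin)[] := gx.
    rewrite le_eqVlt => /predU1P[<- _|r0 rd]; last by rewrite mP' ?r0.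
    have -> : gpt g 0 = x by have /(germsP _ xfin)[] := gx.
    by rewrite mulr0 addr0 fineK//; exact: f_fin.
  have /choice[s' s'P] := sg'.
  exists s'; split=> [g /s'P[]//|].
  rewrite -Dk; suff -> : (\sum_(g <- germs x) s' g = \sum_(g <- germs (to x k)) s g)%R by [].
  (* One radius suffices: r times a sum of slopes is the sum over the sphere of the increments of f,
     and the two spheres are permutations of each other. *)
  pose r := (Num.min d1 d2 / 2)%R.
  have d0 : (0 < Num.min d1 d2)%R by rewrite lt_min d10.
  have rd : (0 < r < Num.min d1 d2)%R by rewrite /r; apply/andP; split; lra.
  have /and3P[r0 rd1 rd2] : [&& 0 < r, r < d1 & r < d2]%R by move: rd; rewrite lt_min.
  have e1 : (\sum_(g <- germs x) (s' g)%:~R * r =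
      \sum_(y <- [seq to (gpt g r) k | g <- germs x]) (fine (f y) - c))%R.
    rewrite big_map; apply: eq_big_seq => g gx.
    have [_ /(_ r rd) ->] := s'P g gx.
    by rewrite /= addrAC subrr add0r.
  have e2 : (\sum_(g <- germs (to x k)) (s g)%:~R * r =
      \sum_(y <- [seq gpt g r | g <- germs (to x k)]) (fine (f y) - c))%R.
    rewrite big_map; apply: eq_big_seq => g gx.
    by rewrite d2P ?ltW// /= addrAC subrr add0r.
  apply/eqP; rewrite -(eqr_int R) !rmorph_sum/=; apply/eqP.
  apply: (mulIf (lt0r_neq0 r0)); rewrite !mulr_suml e1 e2.
  by apply: perm_big; apply: d1P; rewrite r0.
- by move=> e le; exact: tail_slope_act.
Qed.

End IsometryInvariance.

(** * Convexity along the edges *)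

Section ConvexFunctions.
Context {R : realType}.
Implicit Types (F : R -> R) (s t u v m n : R).
Local Open Scope ring_scope.

Definition rslope F t m : Prop :=
  exists2 d : R, 0 < d & forall s, 0 <= s < d -> F (t + s) = F t + m * s.

Definition lslope F t m : Prop :=
  exists2 d : R, 0 < d & forall s, 0 <= s < d -> F (t - s) = F t - m * s.

Lemma rslope_uniq F t m n : rslope F t m -> rslope F t n -> m = n.
Proof.
move=> [d d0 dm] [d' d'0 dn]; have [s [s0 sd sd']] := min_half d0 d'0.
have := dm s; rewrite dn ?(ltW s0)// sd => /(_ isT) H.
by apply: (mulIf (lt0r_neq0 s0)); lra.
Qed.

Lemma rslopeN F t m : rslope (fun s => F (- s)) t m <-> lslope F (- t) (- m).
Proof.
by split=> -[d d0 dm]; exists d => // s sd; move: (dm s sd);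
  rewrite opprD ?mulNr ?opprK.
Qed.

Lemma lslopeN F t m : lslope (fun s => F (- s)) t m <-> rslope F (- t) (- m).
Proof.
by split=> -[d d0 dm]; exists d => // s sd; move: (dm s sd);
  rewrite opprB addrC ?mulNr ?opprK// addrC.
Qed.

Lemma lslope_uniq F t m n : lslope F t m -> lslope F t n -> m = n.
Proof.
move=> Fm Fn; apply: oppr_inj; apply: (@rslope_uniq (fun s => F (- s)) (- t));
  by apply/rslopeN; rewrite !opprK.
Qed.

Lemma lslope_after F t m (d : R) : 0 < d ->
  (forall s, 0 <= s < d -> F (t + s) = F t + m * s) ->
  forall s, 0 < s < d -> lslope F (t + s) m.
Proof.
move=> d0 dm s /andP[s0 sd]; exists s => // r /andP[r0 rs].
rewrite -addrA !dm; try (apply/andP; split; lra).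
by ring.
Qed.

Lemma lslope_before F t m (d : R) : 0 < d ->
  (forall s, 0 <= s < d -> F (t - s) = F t - m * s) ->
  forall s, 0 < s < d -> lslope F (t - s) m.
Proof.
move=> d0 dm s /andP[s0 sd]; exists (d - s); first lra.
move=> r /andP[r0 rs].
rewrite -addrA -opprD !dm; try (apply/andP; split; lra).
by ring.
Qed.

(** Local convexity implies global convexity, by induction along the interval. The comparison of
    left slopes is part of the induction hypothesis: it carries the bound n over each corner. *)
Lemma right_tangent F u v n : u < v ->
  (forall t, u <= t < v -> exists r, rslope F t r) ->
  (forall t, u < t <= v -> exists l, lslope F t l) ->
  (forall t l r, u < t < v -> lslope F t l -> rslope F t r -> l <= r) ->
  rslope F u n ->
  F u + n * (v - u) <= F v /\ forall l, lslope F v l -> n <= l.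
Proof.
move=> uv Fr Fl Flr Fn.
pose P t := t = u \/ u < t /\
  (F u + n * (t - u) <= F t /\ forall l, lslope F t l -> n <= l).
suff : P v by case=> [vu|[]//]; lra.
apply: (@real_induction R P u v); first exact: ltW.
- by left.
- move=> t /andP[ut tv] Pt.
  have [r [d d0 dr]] : exists r, rslope F t r by apply: Fr; rewrite ut.
  have nr : n <= r.
    case: Pt => [tu|[ut' [_ Pt]]].
      by rewrite (@rslope_uniq F u n r)//; exists d => //; rewrite -tu.
    have [|l lP] := Fl t; first by rewrite ut' ltW.
    apply: (le_trans (Pt _ lP)); apply: (Flr t) => //; last by exists d.
    by rewrite ut'.
  have Ft : F u + n * (t - u) <= F t.
    by case: Pt => [->|[_ []]//]; lra.
  exists d => // s /andP[ts sd] _; right; split; first lra.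
  have sE : s = t + (s - t) by lra.
  have st : 0 <= s - t < d by apply/andP; split; lra.
  split.
    rewrite sE dr//.
    have : n * (s - t) <= r * (s - t) by apply: ler_wpM2r => //; lra.
    have -> : n * (t + (s - t) - u) = n * (t - u) + n * (s - t) by ring.
    lra.
  have ls : lslope F s r.
    by rewrite sE; apply: (lslope_after d0 dr); apply/andP; split; lra.
  by move=> l /(lslope_uniq ls) <-.
- move=> t /andP[ut tv] Pt; right; split=> //.
  have [l [d d0 dl]] : exists l, lslope F t l by apply: Fl; rewrite ut.
  have tu0 : 0 < t - u by lra.
  have [s [s0 sd stu]] := min_half d0 tu0.
  have ls : lslope F (t - s) l by apply: (lslope_before d0 dl); rewrite s0.
  have ts : u <= t - s < t by apply/andP; split; lra.
  case: (Pt _ ts) => [|[_ [Fs /(_ _ ls) nl]]]; first lra.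
  split.
    move: Fs; rewrite dl; last by rewrite ltW.
    have : n * s <= l * s by apply: ler_wpM2r => //; exact: ltW.
    have -> : n * (t - s - u) = n * (t - u) - n * s by ring.
    lra.
  by move=> l' [d' d'0 dl']; rewrite (@lslope_uniq F t l' l)//; [exists d'|exists d].
Qed.

Lemma left_tangent F u v n : u < v ->
  (forall t, u <= t < v -> exists r, rslope F t r) ->
  (forall t, u < t <= v -> exists l, lslope F t l) ->
  (forall t l r, u < t < v -> lslope F t l -> rslope F t r -> l <= r) ->
  lslope F v n ->
  F v + n * (u - v) <= F u.
Proof.
move=> uv Fr Fl Flr Fn.
have [|||||Fle _] := @right_tangent (fun s => F (- s)) (- v) (- u) (- n).
- by lra.
- move=> t /andP[vt tu]; have [|l Fl'] := Fl (- t); first by apply/andP; split; lra.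
  by exists (- l); apply/rslopeN; rewrite opprK.
- move=> t /andP[vt tu]; have [|l Fr'] := Fr (- t); first by apply/andP; split; lra.
  by exists (- l); apply/lslopeN; rewrite opprK.
- move=> t l r /andP[vt tu] /lslopeN h1 /rslopeN h2; rewrite -lerN2; apply: (Flr (- t)) => //.
  by apply/andP; split; lra.
- by apply/rslopeN; rewrite !opprK.
by move: Fle; rewrite !opprK mulNr; lra.
Qed.

End ConvexFunctions.

(** * Germs of maxima of affine functions *)

Section MaxOfAffine.
Context {R : realType} {J : finType}.
Local Open Scope ring_scope.

Lemma finite_radius (P : J -> R -> Prop) :
  (forall j, exists2 d : R, 0 < d & forall s, 0 <= s < d -> P j s) ->
  exists2 d : R, 0 < d & forall j s, 0 <= s < d -> P j s.
Proof.
move=> /(fun h => common_radius (s := enum J) (fun j _ => h j))[d d0 dP].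
by exists d => // j s sd; apply: dP => //; rewrite mem_enum.
Qed.

(** Among the terms attaining the value at 0, one of greatest slope wins; the other terms start
    strictly below and stay below for a short while. A term that is constantly -oo represents a line
    that is switched off. *)
Lemma max_affine_germ (phi : R -> \bar R) (psi : J -> R -> \bar R) (n : J -> R) (d0 : R) :
  0 < d0 -> phi 0 \is a fin_num ->
  (forall s, 0 <= s < d0 -> phi s = \big[maxe/-oo%E]_j psi j s) ->
  (forall j, (forall s, 0 <= s < d0 -> psi j s = -oo%E) \/
    exists A, forall s, 0 <= s < d0 -> psi j s = (A + n j * s)%:E) ->
  exists j, [/\ psi j 0 = phi 0,
    exists2 d, 0 < d & forall s, 0 <= s < d -> phi s = (fine (phi 0) + n j * s)%:E &
    forall k, psi k 0 = phi 0 -> n k <= n j].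
Proof.
move=> d00 phi0 phiE psiE.
have zd : (0 : R) <= (0 : R) < d0 by rewrite lexx.
have [j0 j0P] : exists j, psi j 0 = phi 0.
  rewrite phiE//; have [|j ->] := @bigmaxe_attained R J (fun j => psi j 0); last by exists j.
  by rewrite -phiE//; move: phi0; rewrite fin_numE => /andP[].
have j0P' : psi j0 0 == phi 0 by apply/eqP.
have [j /eqP jP jmax] := @arg_maxP _ _ J j0 (fun j => psi j 0 == phi 0) n j0P'.
have jmax' k : psi k 0 = phi 0 -> n k <= n j by move=> /eqP/jmax.
exists j; split=> //.
have affE k : psi k 0 != -oo%E ->
    forall s, 0 <= s < d0 -> psi k s = (fine (psi k 0) + n k * s)%:E.
  case: (psiE k) => [->//|[A AE] _ s sd].
  by rewrite !AE//= mulr0 addr0.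
have phiNy : phi 0 != -oo%E by move: phi0; rewrite fin_numE => /andP[].
have [d d_gt0 dP] : exists2 d : R, 0 < d & forall k s, 0 <= s < d ->
    s < d0 -> (psi k s <= (fine (phi 0) + n j * s)%:E)%E.
  apply: finite_radius => k.
  have [kNy|kNy] := eqVneq (psi k 0) -oo%E.
    exists 1 => // s /andP[s0 _] sd; case: (psiE k) => [E|[A AE]].
      by rewrite E ?leNye// s0.
    by move: kNy; rewrite AE.
  have [kE|kE] := eqVneq (psi k 0) (phi 0).
    exists 1 => // s /andP[s0 _] sd; rewrite affE// ?s0// kE lee_fin lerD2l.
    by apply: ler_wpM2r => //; exact: jmax'.
  have k_fin : psi k 0 = (fine (psi k 0))%:E.
    by case: (psiE k) => [E|[A AE]]; [move: kNy; rewrite E// eqxx|rewrite AE].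
  have lt_k : fine (psi k 0) < fine (phi 0).
    rewrite -lte_fin -k_fin fineK// lt_neqAle kE/= phiE//.
    exact: (le_bigmax _ (fun j => psi j 0)).
  (* The initial gap divided by a bound on the difference of slopes, with 1 added to keep the
     denominator positive. *)
  pose q := (fine (phi 0) - fine (psi k 0)) / (1 + `|n k - n j|).
  have den0 : 0 < 1 + `|n k - n j| by have := normr_ge0 (n k - n j); lra.
  exists q; first by rewrite divr_gt0// subr_gt0.
  move=> s /andP[s0 sq] sd; rewrite affE// ?s0// lee_fin.
  move: sq; rewrite /q ltr_pdivlMr// => sq.
  have : (n k - n j) * s <= s * (1 + `|n k - n j|).
    rewrite mulrC; apply: ler_wpM2l => //.
    by have := ler_norm (n k - n j); lra.
  by rewrite mulrBl; lra.
exists (Num.min d d0); first by rewrite lt_min d_gt0.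
move=> s; rewrite lt_min => /and3P[s0 sd sd0].
have sd0' : 0 <= s < d0 by rewrite s0.
apply/le_anti/andP; split.
  rewrite (phiE s)//; apply: bigmax_le => [|k _]; first exact: leNye.
  by apply: dP; rewrite ?s0.
rewrite (phiE s)//; apply: le_trans (le_bigmax _ (fun j => psi j s) j).
by rewrite affE ?jP.
Qed.

End MaxOfAffine.

(** * Convexification of members of R(D) on an edge *)

Section Convexification.
Context {R : realType} {G : weighted_graph R}.
Variable D : divisor G.
Hypothesis D0 : effective D.
Implicit Types (e : edge G) (x y : points G) (s t u : R).

Definition supp e : seq R := pmap (fun x =>
  if x is Interior p then (if (val p).1 == e then Some (val p).2 else None) else None)
  (finsupp D).

Definition mass e s : int := D (edge_pt e s%:E).

(* The second derivative of [hinge e] is the restriction of the divisor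
   to the interior of [e]; adding [hinge e] to a member of R(D) therefore makes
   it convex on [e]. *)
Definition hinge e t : R := (\sum_(s <- supp e) (mass e s)%:~R * Num.max 0 (t - s))%R.
(** Far along the edge the hinge function is the line of slope [mass_total e] and intercept minus
    [moment e]; [mass_upto e t] and [mass_before e t] are its right and left derivatives at t. *)
Definition mass_total e : int := (\sum_(s <- supp e) mass e s)%R.
Definition mass_upto e t : int := (\sum_(s <- supp e | (s <= t)%R) mass e s)%R.
Definition mass_before e t : int := (\sum_(s <- supp e | (s < t)%R) mass e s)%R.
Definition moment e : R := (\sum_(s <- supp e) (mass e s)%:~R * s)%R.

Lemma suppP e s : s \in supp e <-> [/\ (0 < s)%R, s%:E < len e & mass e s != 0%R].
Proof.
rewrite /supp mem_pmap; split.
  move=> /mapP[[v|[[e' t] t_in]] //=]; rewrite mem_finsupp => Dx; case: eqP => // <- [->].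
  by have /andP[] := t_in; rewrite /mass edge_ptE.
move=> [s0 sl sm]; have s_in : in_interior (e, s) by rewrite /in_interior/= s0.
apply/mapP; exists (Interior (exist _ (e, s) s_in)); last by rewrite /= eqxx.
by rewrite mem_finsupp -edge_ptE.
Qed.

Lemma supp_gt0 e s : s \in supp e -> (0 < s)%R.
Proof. by move=> /suppP[]. Qed.

Lemma supp_uniq e : uniq (supp e).
Proof.
rewrite /supp; set F := (fun x => _); have := fset_uniq (finsupp D).
have FI x y : F x = F y -> F x != None -> x = y.
  case: x => [v|[[e1 s1] i1]] //=; case: y => [v'|[[e2 s2] i2]] //=; case: eqP => //= E1;
    case: eqP => //= E2 [E] _.
  by rewrite -!edge_ptE E1 E2 E.
elim: (enum_fset (finsupp D)) => //= x s IH /andP[xs /IH us].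
case Fx: (F x) => [a|]//=; rewrite us andbT; apply/negP.
rewrite mem_pmap => /mapP[y ys]; rewrite -Fx => /FI; rewrite Fx => /(_ isT) xy.
by move: xs; rewrite xy ys.
Qed.

Lemma mass_ge0 e s : (0 <= mass e s)%R. Proof. exact: D0. Qed.

Lemma massR_ge0 e s : (0 <= (mass e s)%:~R :> R)%R.
Proof. by rewrite -[0%R]/(0%:~R) ler_int mass_ge0. Qed.

Lemma mass_total_ge0 e : (0 <= mass_total e)%R.
Proof. by apply: sumr_ge0 => s _; exact: mass_ge0. Qed.

Lemma mass_jump e t : (0 < t)%R -> t%:E < len e ->
  mass_upto e t = (mass_before e t + mass e t)%R.
Proof.
move=> t0 tl; rewrite /mass_upto (bigID (fun s => (s < t)%R))/=; congr (_ + _)%R.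
  by apply: eq_bigl => s; case: ltgtP.
rewrite (eq_bigl (pred1 t)); last by move=> s /=; case: ltgtP.
have [ts|ts] := boolP (t \in supp e).
  by rewrite -big_filter filter_pred1_uniq ?supp_uniq// big_seq1.
rewrite big1_seq; first by apply/esym/eqP; apply: contraNT ts => ?; apply/suppP.
by move=> s /andP[/eqP ->]; rewrite (negbTE ts).
Qed.

Lemma mass_upto0 e : mass_upto e 0 = 0%R.
Proof.
rewrite /mass_upto big1_seq// => s /andP[s0 /supp_gt0]; by rewrite ltNge s0.
Qed.

Lemma mass_before_len e t : len e = t%:E -> mass_before e t = mass_total e.
Proof.
move=> le; rewrite /mass_before /mass_total big_seq_cond [RHS]big_seq_cond.
apply: eq_bigl => s; rewrite andbT; apply: andb_idr => /suppP[_].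
by rewrite le lte_fin.
Qed.

Lemma hinge0 e : hinge e 0 = 0%R.
Proof.
rewrite /hinge big1_seq// => s /andP[_ /supp_gt0 s0].
by rewrite max_l ?mulr0//; lra.
Qed.

Lemma hinge_ge0 e t : (0 <= hinge e t)%R.
Proof.
apply: sumr_ge0 => s _; apply: mulr_ge0; first exact: massR_ge0.
by rewrite le_max lexx.
Qed.

Lemma hinge_le e t : (0 <= t)%R -> (hinge e t <= (mass_total e)%:~R * t)%R.
Proof.
move=> t0; rewrite /hinge /mass_total rmorph_sum/= mulr_suml.
rewrite big_seq [leRHS]big_seq; apply: ler_sum => s /supp_gt0 s0.
apply: ler_wpM2l; first exact: massR_ge0.
by rewrite ge_max t0/=; lra.
Qed.

Lemma hinge_tail e : exists2 a : R, (0 <= a)%R & forall t, (a <= t)%R ->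
  hinge e t = ((mass_total e)%:~R * t - moment e)%R.
Proof.
exists (\big[Num.max/0%R]_(s <- supp e) s).
  exact: bigmax_ge_id.
move=> t at_; rewrite /hinge /mass_total rmorph_sum/= mulr_suml /moment -sumrB.
apply: eq_big_seq => s se; rewrite -mulrBr max_r// subr_ge0; apply: le_trans at_.
exact: (le_bigmax_seq (0%R : R) s xpredT id).
Qed.

Lemma hinge_rslope e t : rslope (hinge e) t (mass_upto e t)%:~R.
Proof.
have [d d0 dP] : exists2 d : R, (0 < d)%R & forall s r, s \in supp e -> (0 <= r < d)%R ->
    Num.max 0%R (t + r - s)%R = (Num.max 0 (t - s) + (if (s <= t)%R then 1 else 0) * r)%R.
  apply: common_radius => s _; have [st|ts] := @leP _ R s t.
    by exists 1%R => // r /andP[r0 _]; rewrite !max_r; lra.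
  exists (s - t)%R; first lra.
  by move=> r /andP[r0 rd]; rewrite !max_l; lra.
exists d => // r rd; rewrite /hinge /mass_upto rmorph_sum/= mulr_suml.
rewrite [X in _ = (_ + X)%R]big_mkcond -big_split/=; apply: eq_big_seq => s se.
by rewrite dP// mulrDr; case: ifP => _; rewrite ?mul1r ?mul0r ?mulr0.
Qed.

Lemma hinge_lslope e t : lslope (hinge e) t (mass_before e t)%:~R.
Proof.
have [d d0 dP] : exists2 d : R, (0 < d)%R & forall s r, s \in supp e -> (0 <= r < d)%R ->
    Num.max 0%R (t - r - s)%R = (Num.max 0 (t - s) - (if (s < t)%R then 1 else 0) * r)%R.
  apply: common_radius => s _; have [st|ts] := @ltP _ R s t.
    exists (t - s)%R; first lra.
    by move=> r /andP[r0 rd]; rewrite !max_r; lra.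
  by exists 1%R => // r /andP[r0 _]; rewrite !max_l; lra.
exists d => // r rd; rewrite /hinge /mass_before rmorph_sum/= mulr_suml.
rewrite [X in _ = (_ - X)%R]big_mkcond -sumrB; apply: eq_big_seq => s se.
by rewrite dP// mulrBr; case: ifP => _; rewrite ?mul1r ?mul0r ?mulr0.
Qed.

Section System.
Variable f : points G -> \bar R.
Hypothesis fD : germ_system D f.

Definition convexified e t : R := (fine (f (edge_pt e t%:E)) + hinge e t)%R.
Local Notation F := convexified.

Lemma convexified_rslope e t m : gslope f (e, t, true) m ->
  rslope (F e) t (m + mass_upto e t)%:~R.
Proof.
move=> [d d0 dm]; have [d' d'0 d'm] := hinge_rslope e t.
exists (Num.min d d'); first by rewrite lt_min d0.
move=> s; rewrite lt_min => /and3P[s0 sd sd'].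
have := dm s; rewrite s0 sd => /(_ isT); rewrite /gpt /gpos/= addr0 => E.
rewrite /F E/= d'm ?s0// rmorphD/= mulrDl; ring.
Qed.

Lemma convexified_lslope e t m : gslope f (e, t, false) m ->
  lslope (F e) t (mass_before e t - m)%:~R.
Proof.
move=> [d d0 dm]; have [d' d'0 d'm] := hinge_lslope e t.
exists (Num.min d d'); first by rewrite lt_min d0.
move=> s; rewrite lt_min => /and3P[s0 sd sd'].
have := dm s; rewrite s0 sd => /(_ isT); rewrite /gpt /gpos/= subr0 => E.
rewrite /F E/= d'm ?s0// rmorphB/= mulrBl; ring.
Qed.

Lemma ex_gslope g : valid_germ g -> exists m, gslope f g m.
Proof. exact: (germ_system_gslope fD). Qed.

Lemma ex_rslope e t : (0 <= t)%R -> t%:E < len e -> exists r, rslope (F e) t r.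
Proof.
move=> t0 tl; have [|m /convexified_rslope] := @ex_gslope (e, t, true); first by split.
by move=> ?; eexists; eassumption.
Qed.

Lemma ex_lslope e t : (0 < t)%R -> t%:E <= len e -> exists r, lslope (F e) t r.
Proof.
move=> t0 tl; have [|m /convexified_lslope] := @ex_gslope (e, t, false); first by split.
by move=> ?; eexists; eassumption.
Qed.

(** The jump r - l of the slope equals D plus the sum of the two outgoing slopes of f at this point,
    which is nonnegative. *)
Lemma convexified_corner e t l r : (0 < t)%R -> t%:E < len e ->
  lslope (F e) t l -> rslope (F e) t r -> (l <= r)%R.
Proof.
move=> t0 tl Fl Fr; have [f_fin fg _] := fD.
have [|s []] := fg (edge_pt e t%:E); first exact/edge_pt_finite/ltW.
have t_in : in_interior (e, t) by rewrite /in_interior/= t0.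
rewrite edge_ptE/= !big_cons big_nil addr0 => sg sD.
have /convexified_rslope/(rslope_uniq Fr) -> : gslope f (e, t, true) (s (e, t, true)).
  by apply: sg; rewrite inE eqxx.
have /convexified_lslope/(lslope_uniq Fl) -> : gslope f (e, t, false) (s (e, t, false)).
  by apply: sg; rewrite !inE eqxx orbT.
rewrite ler_int mass_jump// /mass edge_ptE; lia.
Qed.

Lemma segment_slopes e (u v : R) : (0 <= u)%R -> v%:E <= len e ->
  [/\ forall t, (u <= t < v)%R -> exists r, rslope (F e) t r,
      forall t, (u < t <= v)%R -> exists l, lslope (F e) t l &
      forall t l r, (u < t < v)%R -> lslope (F e) t l -> rslope (F e) t r -> (l <= r)%R].
Proof.
move=> u0 vl; split=> [t|t|t l r] /andP[ut tv].
- apply: ex_rslope; first exact: le_trans ut.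
  by apply: lt_le_trans vl; rewrite lte_fin.
- apply: ex_lslope; first exact: le_lt_trans ut.
  by apply: le_trans vl; rewrite lee_fin.
- apply: convexified_corner; first exact: le_lt_trans ut.
  by apply: lt_le_trans vl; rewrite lte_fin.
Qed.

Lemma rtangent e t u r : (0 <= t)%R -> t%:E < len e -> (0 <= u)%R -> u%:E <= len e ->
  rslope (F e) t r -> (F e t + r * (u - t) <= F e u)%R.
Proof.
move=> t0 tl u0 ul Fr; have [tu|ut|<-] := ltgtP t u.
- have [h1 h2 h3] := segment_slopes t0 ul.
  by have [] := right_tangent tu h1 h2 h3 Fr.
- have [h1 h2 h3] := segment_slopes u0 (ltW tl).
  have t0' : (0 < t)%R by exact: le_lt_trans ut.
  have [l Fl] := ex_lslope t0' (ltW tl).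
  have lr := convexified_corner t0' tl Fl Fr.
  apply: le_trans (left_tangent ut h1 h2 h3 Fl).
  by rewrite lerD2l; apply: ler_wnM2r => //; lra.
- by rewrite subrr mulr0 addr0.
Qed.

Lemma ltangent e t u l : (0 < t)%R -> t%:E <= len e -> (0 <= u)%R -> u%:E <= len e ->
  lslope (F e) t l -> (F e t + l * (u - t) <= F e u)%R.
Proof.
move=> t0 tl u0 ul Fl; have [tu|ut|<-] := ltgtP t u.
- have tl' : t%:E < len e by apply: lt_le_trans ul; rewrite lte_fin.
  have [h1 h2 h3] := segment_slopes (ltW t0) ul.
  have [r Fr] := ex_rslope (ltW t0) tl'.
  have lr := convexified_corner t0 tl' Fl Fr.
  apply: le_trans (right_tangent tu h1 h2 h3 Fr).1.
  by rewrite lerD2l; apply: ler_wpM2r => //; lra.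
- have [h1 h2 h3] := segment_slopes u0 tl.
  exact: left_tangent h1 h2 h3 Fl.
- by rewrite subrr mulr0 addr0.
Qed.

Lemma slope_mono e t u r l : (0 <= t)%R -> (t < u)%R -> u%:E <= len e ->
  rslope (F e) t r -> lslope (F e) u l -> (r <= l)%R.
Proof.
move=> t0 tu ul Fr Fl; have [h1 h2 h3] := segment_slopes t0 ul.
by have [_ ->] := right_tangent tu h1 h2 h3 Fr.
Qed.

Lemma slope_mono_r e t u r r' : (0 <= t)%R -> (t < u)%R -> u%:E < len e ->
  rslope (F e) t r -> rslope (F e) u r' -> (r <= r')%R.
Proof.
move=> t0 tu ul Fr Fr'; have u0 := le_lt_trans t0 tu.
have [l Fl] := ex_lslope u0 (ltW ul).
exact: le_trans (slope_mono t0 tu (ltW ul) Fr Fl) (convexified_corner u0 ul Fl Fr').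
Qed.

Lemma tail_slope_bound e t r m : len e = +oo -> (0 <= t)%R -> rslope (F e) t r ->
  tail_slope f e m -> (r <= (m + mass_total e)%:~R)%R.
Proof.
move=> le t0 Fr [c [a [fE _]]]; have [b b0 bE] := hinge_tail e.
pose u := (Num.max t (Num.max a b) + 1)%R.
have [ut ua ub] : [/\ t < u, a < u & b < u]%R.
  have : (Num.max t (Num.max a b) < u)%R by rewrite /u; lra.
  by rewrite !gt_max => /and3P[].
have Fu : rslope (F e) u (m + mass_total e)%:~R.
  exists 1%R => // s /andP[s0 _].
  rewrite /F !fE ?(bE u) ?(bE (u + s)%R)/=; try lra.
by apply: (slope_mono_r t0 ut _ Fr Fu); rewrite le ltry.
Qed.

End System.

End Convexification.

(** * Lower bound for the outgoing slopes at vertices *)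

Section SlopeBound.
Context {R : realType} {G : weighted_graph R}.
Variable D : divisor G.
Hypothesis D0 : effective D.
Implicit Types (e : edge G) (v : vertex G).

Definition mass_sum : int := (\sum_e mass_total D e)%R.
(** One [mass_sum] bounds what the other edges contribute to a superlevel set; the second bounds the
    outgoing slope at the other, higher end of the edge considered. *)
Definition slope_bound : int := (\sum_v D (Vertex v) + mass_sum + mass_sum)%R.

Lemma mass_sum_ge e : (mass_total D e <= mass_sum)%R.
Proof.
by rewrite /mass_sum (bigD1 e)//= lerDl sumr_ge0// => e' _; exact: mass_total_ge0.
Qed.

Section System.
Variable f : points G -> \bar R.
Hypothesis fD : germ_system D f.

Let p v : R := fine (f (Vertex v)).

Let F0 e : convexified D f e 0 = p (src e).
Proof. by rewrite /convexified hinge0// edge_pt0 addr0. Qed.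

Let FL e (L : R) : len e = L%:E -> convexified D f e L = (p (tgt e) + hinge D e L)%R.
Proof. by move=> le; rewrite /convexified edge_pt_ge// le. Qed.

Let L0 e (L : R) : len e = L%:E -> (0 < L)%R.
Proof. by have := len_gt0 e => /[swap] ->; rewrite lte_fin. Qed.

(** The tangent at the source, evaluated at the target, lies below p(tgt e) plus the hinge function,
    and the latter is at most L times the mass on e. *)
Lemma src_slope_le e (L : R) a : len e = L%:E -> gslope f (e, 0%R, true) a ->
  (p (tgt e) <= p (src e))%R -> (a <= mass_total D e)%R.
Proof.
move=> le /(convexified_rslope D) Fa pp.
have L_gt0 := L0 le.
have := rtangent fD (lexx _) (len_gt0 e) (ltW L_gt0) _ Fa.
rewrite le lexx => /(_ isT); rewrite F0 (FL le) mass_upto0// addr0 subr0 => H.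
have := hinge_le D0 e (ltW L_gt0) => HL.
rewrite -(ler_int R) -(ler_pM2r L_gt0); lra.
Qed.

Lemma tgt_slope_le e (L : R) a : len e = L%:E -> gslope f (e, L, false) a ->
  (p (src e) <= p (tgt e))%R -> (a <= mass_total D e)%R.
Proof.
move=> le /(convexified_lslope D) Fa pp.
have L_gt0 := L0 le.
have := ltangent fD L_gt0 _ (lexx _) (ltW (len_gt0 e)) Fa.
rewrite le lexx => /(_ isT); rewrite F0 (FL le) (mass_before_len D le) sub0r => H.
have := hinge_ge0 D0 e L => HL.
rewrite -(ler_int R) -(ler_pM2r L_gt0).
by move: H; rewrite rmorphB/= mulrN mulrBl; lra.
Qed.

Lemma edge_slopes_le e (L : R) a b : len e = L%:E -> gslope f (e, 0%R, true) a ->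
  gslope f (e, L, false) b -> (a + b <= mass_total D e)%R.
Proof.
move=> le /(convexified_rslope D) Fa /(convexified_lslope D) Fb.
have := slope_mono fD (lexx _) (L0 le) _ Fa Fb.
rewrite le lexx => /(_ isT); rewrite ler_int (mass_before_len D le) mass_upto0; lia.
Qed.

Lemma infinite_slope_le e a : len e = +oo -> gslope f (e, 0%R, true) a ->
  (a <= mass_total D e)%R.
Proof.
move=> le /(convexified_rslope D) Fa.
have [_ _ /(_ e le)[m [m0 mt]]] := fD.
have := tail_slope_bound fD le (lexx _) Fa mt.
rewrite ler_int mass_upto0; lia.
Qed.

(** Let [A c] be the set of finite vertices where f >= c, and [T] the sum of the outgoing slopes of
    an edge at its ends in that set. The total of [T] over the edges is bounded below by effectivity
    at the vertices and each term is bounded above by convexity, so each term is bounded below. *)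
Lemma vertex_slopes_ge :
  (forall e a, gslope f (e, 0%R, true) a -> (- slope_bound <= a)%R) /\
  (forall e L a, len e = L%:E -> gslope f (e, L, false) a -> (- slope_bound <= a)%R).
Proof.
have [s sP] : exists s : @germ R G -> int, forall g, valid_germ g -> gslope f g (s g).
  have /choice[s sP] : forall g : @germ R G, exists m, valid_germ g -> gslope f g m.
    move=> g; have [gv|] := pselect (valid_germ g); last by exists 0%R.
    by have [m gm] := ex_gslope fD gv; exists m.
  by exists s.
pose a e := s (e, 0%R, true); pose b e := s (e, fine (len e), false).
have aP e : gslope f (e, 0%R, true) (a e).
  by apply: sP; split=> //; exact: len_gt0.
have bP e : len e <> +oo -> gslope f (e, fine (len e), false) (b e).
  move=> le; apply: sP; rewrite /valid_germ/= -len_fin// lexx; split=> //.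
  by rewrite -lte_fin -len_fin// len_gt0.
have vsum v : ~ at_infinity (Vertex v) ->
    (0 <= D (Vertex v) + \sum_(e | src e == v) a e + \sum_(e | tgt e == v) b e)%R.
  move=> vfin; have [_ /(_ _ vfin)[s' [s'P +]] _] := fD.
  rewrite (eq_big_seq s); last first.
    move=> g gv; apply: (gslope_uniq (s'P g gv)); apply: sP.
    by have /(germsP _ vfin)[] := gv.
  by rewrite /= big_cat !big_map !big_enum/= addrA.
pose T (A : pred (vertex G)) e : int :=
  ((if A (src e) then a e else 0) + (if A (tgt e) then b e else 0))%R.
pose A (c : R) : pred (vertex G) :=
  fun v => `[< ~ at_infinity (Vertex v) /\ (c <= p v)%R >].
have A_src c e : (c <= p (src e))%R -> A c (src e).
  by move=> cp; apply/asboolP; split=> //; exact: src_finite.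
have A_tgt c e : len e <> +oo -> (c <= p (tgt e))%R -> A c (tgt e).
  by move=> le cp; apply/asboolP; split=> //; exact: tgt_finite.
have A_inf c e : len e = +oo -> A c (tgt e) = false.
  move=> le; apply/asboolP => -[+ _]; apply; apply/at_infinityP; by exists e.
have A_lt c v : (p v < c)%R -> A c v = false.
  by move=> pc; apply/asboolP => -[_]; rewrite leNgt pc.
have AP c v : A c v -> (c <= p v)%R by move=> /asboolP[].
(* If just one end belongs to the superlevel set, it is the higher one or the other end is at
   infinity; if both do, their outgoing slopes are compared by convexity. *)
have T_le c e : (T (A c) e <= mass_total D e)%R.
  have H0 := mass_total_ge0 D0 e; have src0 := @infinite_slope_le e (a e).
  rewrite /T; have [le|le] := pselect (len e = +oo).
    by rewrite (A_inf c e le) addr0; case: ifP => // _; exact: src0.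
  have le' := len_fin le; have bPe := bP e le.
  have ab := edge_slopes_le le' (aP e) bPe.
  have [pp|pp] := leP (p (tgt e)) (p (src e)).
    have ale := src_slope_le le' (aP e) pp.
    case: ifP => As; case: ifP => At; rewrite ?addr0 ?add0r//.
    have /A_src : (c <= p (src e))%R by apply: le_trans pp; exact: AP.
    by rewrite As.
  have ble := tgt_slope_le le' bPe (ltW pp).
  case: ifP => As; case: ifP => At; rewrite ?addr0 ?add0r//.
  have /(A_tgt _ _ le) : (c <= p (tgt e))%R by apply: le_trans (ltW pp); exact: AP.
  by rewrite At.
(* The sum over edges is regrouped by the vertices of the superlevel set, and the values of D at the
   remaining vertices are dropped. *)
have T_sum c : (- (\sum_v D (Vertex v)) <= \sum_e T (A c) e)%R.
  rewrite /T big_split/= -!big_mkcond/=.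
  rewrite (partition_big (@src R G) (A c))//= [X in (_ + X)%R](partition_big (@tgt R G) (A c))//=.
  rewrite -big_split/= lerNl -subr_ge0 opprK.
  rewrite [X in (X + _)%R](bigID (A c))/= addrAC -big_split/= addr_ge0 ?sumr_ge0//.
  move=> v /asboolP[vfin cv].
  have := vsum v vfin; rewrite -addrA; congr (0 <= _ + (_ + _))%R; apply: eq_bigl => e.
    by case: eqP => [->|]; rewrite ?andbF// andbT; apply/esym/asboolP.
  by case: eqP => [->|]; rewrite ?andbF// andbT; apply/esym/asboolP.
pose M0 : int := (\sum_v D (Vertex v) + mass_sum)%R.
have T_ge c e : (- M0 <= T (A c) e)%R.
  have := T_sum c; rewrite (bigD1 e)//= /M0.
  have -> : mass_sum = (mass_total D e + \sum_(i | i != e) mass_total D i)%R.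
    by rewrite /mass_sum (bigD1 e).
  have := mass_total_ge0 D0 e.
  have : (\sum_(i | i != e) T (A c) i <= \sum_(i | i != e) mass_total D i)%R.
    by apply: ler_sum => i _; exact: T_le.
  by move=> *; lra.
(* With c the value at the higher end, only the slope there is counted. With c the value at the
   lower end both slopes are counted, and the one at the higher end is at most the mass on e. *)
have bound e : (- slope_bound <= a e)%R /\ (len e <> +oo -> (- slope_bound <= b e)%R).
  have T1 := T_ge (p (src e)) e; have T2 := T_ge (p (tgt e)) e.
  have H1 := mass_sum_ge e; have H0 := mass_total_ge0 D0 e.
  have sb : slope_bound = (M0 + mass_sum)%R by [].
  have [le|le] := pselect (len e = +oo).
    split=> //; move: T1; rewrite /T A_src// A_inf// addr0; lia.
  have le' := len_fin le; have bPe := bP e le.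
  move: T1 T2; rewrite /T (A_src (p (src e)))// (A_tgt (p (tgt e)))//.
  have := src_slope_le le' (aP e); have := tgt_slope_le le' bPe.
  case: (ltgtP (p (src e)) (p (tgt e))) => pp.
  - move=> /(_ isT) b1 _; rewrite (A_lt _ _ pp) (A_tgt _ _ le (ltW pp)); lia.
  - move=> _ /(_ isT) a1; rewrite (A_lt _ _ pp) (A_src _ _ (ltW pp)); lia.
  - move=> /(_ isT) b1 /(_ isT) a1.
    rewrite (A_src (p (tgt e))) ?pp// (A_tgt (p (tgt e)))//; lia.
split=> [e m /gslope_uniq/(_ (aP e)) ->|e L m le]; first exact: (bound e).1.
have le' : len e <> +oo by rewrite le.
have -> : L = fine (len e) by rewrite le.
by move=> /gslope_uniq/(_ (bP e le')) ->; exact: (bound e).2.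
Qed.

End System.
End SlopeBound.

Lemma tropical_cone_indexed (R : realType) (I J : finType) (alpha beta : J -> I -> \bar R) :
  (forall j i, alpha j i < +oo) -> (forall j i, beta j i < +oo) ->
  exists S, [/\ finite_set S, forall g, S g -> forall i, g i < +oo &
    tropical_span S = [set v | (forall i, v i < +oo) /\
      forall j, tdot (alpha j) v <= tdot (beta j) v]].
Proof.
move=> alt blt.
have In_map p : List.In p (map (fun j => (alpha j, beta j)) (enum J)) <->
    exists j, p = (alpha j, beta j).
  split=> [|[j ->]].
    by elim: (enum J) => //= j s IH [<-|/IH//]; exists j.
  have : j \in enum J by rewrite mem_enum.
  by elim: (enum J) => //= k s IH; rewrite inE => /predU1P[->|/IH]; [left|right].
have [|S [finS Slt SE]] := @tropical_cone_finitely_generated R I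
    (map (fun j => (alpha j, beta j)) (enum J)).
  by move=> p /In_map[j ->]; split=> i /=.
exists S; split=> //; rewrite SE; apply/seteqP; split=> v [vlt vP]; split=> //.
  by move=> j; apply: (vP (alpha j, beta j)); apply/In_map; exists j.
by move=> p /In_map[j ->]; exact: vP.
Qed.

(** * Finite generation of R(D) *)

Section Coordinates.
Context {R : realType} {G : weighted_graph R}.
Variable D : divisor G.
Hypothesis D0 : effective D.
Implicit Types (e : edge G) (v : vertex G) (x : points G).

(** Slopes of a convexified function on an edge lie between its slope at the source, at least
    [- slope_bound D], and its slope at the target, which is the mass on the edge minus an outgoing
    slope of f; on an infinite edge the mass itself is an upper bound. *)
Definition slope_range : nat := absz (slope_bound D + mass_sum D)%R.
Local Notation N := (slope_range.*2.+1).
Definition slope_at (j : 'I_N) : int := (j%:Z - slope_range%:Z)%R.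

Lemma slope_atP (n : int) : (- (slope_range%:Z) <= n <= slope_range%:Z)%R ->
  exists j : 'I_N, slope_at j = n.
Proof.
move=> nB; have nN : (absz (n + slope_range%:Z)%R < N)%N by lia.
by exists (Ordinal nN); rewrite /slope_at/=; lia.
Qed.

Lemma slope_at_inj : injective slope_at.
Proof. by move=> i j; rewrite /slope_at => E; apply: val_inj => /=; lia. Qed.

Lemma slope_range_ge : (slope_bound D + mass_sum D <= slope_range%:Z)%R.
Proof. by rewrite /slope_range; lia. Qed.

(* A member f of R(D) is given by its values at the vertices and, for each
   slope n, by the largest constant c such that the line c + n t minus the
   hinge function of e lies below f on e. *)
Definition coord : finType := (vertex G + edge G * 'I_N)%type.

(** At +oo this is the limit when n <= [mass_total D e]. For larger n the limit would be +oo; the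
    value -oo is a default, and [coord_cone] switches these lines off. *)
Definition line e (n : int) (t : \bar R) : \bar R :=
  match t with
  | r%:E => (n%:~R * r - hinge D e r)%:E
  | +oo => if n == mass_total D e then (moment D e)%:E else -oo
  | -oo => -oo
  end.

Definition at_edge e (t : \bar R) : coord -> \bar R := fun i =>
  if i is inr (e', j) then if e' == e then line e (slope_at j) t else -oo else -oo.

Definition at_vertex v : coord -> \bar R := fun i =>
  if i is inl v' then if v' == v then 0 else -oo else -oo.

Definition weight x : coord -> \bar R :=
  match x with
  | Vertex v => at_vertex v
  | Interior p => at_edge (val p).1 (val p).2%:E
  end.

(** The outgoing slope, at an end of e, of a line minus the hinge function; the derivative of the
    latter is 0 at the source and [mass_total D e] at the target. *)
Definition out_slope e (b : bool) (j : 'I_N) : int :=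
  if b then slope_at j else (mass_total D e - slope_at j)%R.

(** At a target the outgoing slope decreases with j, hence the reversed comparison. Indexing [jj] by
    edges and booleans keeps the two germs of a loop apart. *)
Definition steeper v (jj : {ffun edge G * bool -> 'I_N}) : coord -> \bar R := fun i =>
  if i is inr (e, j) then
    maxe (if (src e == v) && (jj (e, true) < j)%N then line e (slope_at j) 0 else -oo)
         (if (tgt e == v) && (j < jj (e, false))%N then line e (slope_at j) (len e) else -oo)
  else -oo.

(* The condition at v that D + div f >= 0 reads: if the outgoing slopes jj are
   too small, then on some germ at v a steeper line attains the value at v. *)
Definition too_steep v (jj : {ffun edge G * bool -> 'I_N}) : Prop :=
  ~ at_infinity (Vertex v) /\
  (D (Vertex v) + \sum_(g <- germs (Vertex v)) out_slope g.1.1 g.2 (jj (g.1.1, g.2)) < 0)%R.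

(** The clauses say that the lines on the edges agree with the values at the vertices, that f does
    not increase towards infinity, and that D + div f >= 0 at the finite vertices. In the interior
    of an edge effectivity is automatic, a maximum of lines being convex. *)
Definition coord_cone : set (coord -> \bar R) := [set c |
  [/\ forall i, c i < +oo,
    forall e, tdot (at_edge e 0) c = tdot (at_vertex (src e)) c,
    forall e, tdot (at_edge e (len e)) c = tdot (at_vertex (tgt e)) c,
    forall e j, len e = +oo -> (mass_total D e < slope_at j)%R -> c (inr (e, j)) = -oo &
    forall v jj, too_steep v jj -> tdot (at_vertex v) c <= tdot (steeper v jj) c]].

Lemma line_ltey e n t : line e n t < +oo.
Proof. by case: t => [r| |] //=; rewrite ?ltry//; case: ifP => _; rewrite ?ltry. Qed.

Lemma at_edge_ltey e t i : at_edge e t i < +oo.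
Proof. by case: i => [v|[e' j]] //=; case: ifP => // _; exact: line_ltey. Qed.

Lemma at_vertex_ltey v i : at_vertex v i < +oo.
Proof. by case: i => [v'|[e' j]] //=; case: ifP => // _; rewrite ltry. Qed.

Lemma weight_ltey x i : weight x i < +oo.
Proof. by case: x => [v|p]; [exact: at_vertex_ltey|exact: at_edge_ltey]. Qed.

Lemma steeper_ltey v jj i : steeper v jj i < +oo.
Proof.
by case: i => [v'|[e' j]] //=; rewrite gt_max; apply/andP; split; case: ifP => // _;
  rewrite ?ltry ?line_ltey.
Qed.

Lemma tdot_at_vertex v c : tdot (at_vertex v) c = c (inl v).
Proof.
apply/le_anti/andP; split.
  apply: bigmax_le => [|[v'|[e j]] _]; rewrite /= ?leNye//.
  by case: eqP => [->|_]; rewrite ?add0e ?leNye.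
apply: le_trans (le_bigmax _ (fun i => at_vertex v i + c i) (inl v)).
by rewrite /= eqxx add0e.
Qed.

Lemma tdot_at_edge e t c :
  tdot (at_edge e t) c = \big[maxe/-oo]_(j < N) (line e (slope_at j) t + c (inr (e, j))).
Proof.
apply/le_anti/andP; split.
  apply: bigmax_le => [|[v'|[e' j]] _]; rewrite /= ?leNye//.
  case: eqP => [->|_]; last by rewrite leNye.
  exact: (le_bigmax _ (fun j => line e (slope_at j) t + c (inr (e, j)))).
apply: bigmax_le => [|j _]; rewrite ?leNye//.
apply: le_trans (le_bigmax _ (fun i => at_edge e t i + c i) (inr (e, j))).
by rewrite /= eqxx.
Qed.

Lemma coord_cone_finitely_generated : exists S, [/\ finite_set S,
  forall g, S g -> forall i, g i < +oo & tropical_span S = coord_cone].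
Proof.
(* One index per inequality: an equality is split in two by the first boolean, the second boolean
   choosing the end of the edge. A clause whose side condition fails becomes -oo <= -oo. *)
pose J : finType := (edge G * (bool * bool) + edge G * 'I_N +
  vertex G * {ffun edge G * bool -> 'I_N})%type.
pose swap (b : bool) (p : (coord -> \bar R) * (coord -> \bar R)) :=
  if b then p else (p.2, p.1).
pose F (j : J) : (coord -> \bar R) * (coord -> \bar R) := match j with
  | inl (inl (e, (b, b'))) => swap b
      (if b' then (at_edge e 0, at_vertex (src e)) else (at_edge e (len e), at_vertex (tgt e)))
  | inl (inr (e, j)) =>
      (if `[< len e = +oo /\ (mass_total D e < slope_at j)%R >] then
         fun i => if i == inr (e, j) then 0 else -oo else cst -oo, cst -oo)
  | inr (v, jj) => if `[< too_steep v jj >] then (at_vertex v, steeper v jj)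
                   else (cst -oo, cst -oo)
  end.
have Flt j i : (F j).1 i < +oo /\ (F j).2 i < +oo.
  case: j => [[[e [b b']]|[e j]]|[v jj]] /=.
  - by case: b; case: b' => /=; split; rewrite ?at_edge_ltey ?at_vertex_ltey.
  - by split=> //; case: ifP => //= _; case: ifP => //; rewrite ltry.
  - by case: ifP => //= _; rewrite at_vertex_ltey steeper_ltey.
have [||S [finS Slt SE]] := @tropical_cone_indexed R coord J (fun j => (F j).1) (fun j => (F j).2).
- by move=> j i; exact: (Flt j i).1.
- by move=> j i; exact: (Flt j i).2.
exists S; split=> //; rewrite SE; apply/seteqP; split=> c.
  move=> [clt cP]; split=> // [e|e|e j le nj|v jj vjj].
  - apply/le_anti/andP; split.
      exact: (cP (inl (inl (e, (true, true))))).
    exact: (cP (inl (inl (e, (false, true))))).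
  - apply/le_anti/andP; split.
      exact: (cP (inl (inl (e, (true, false))))).
    exact: (cP (inl (inl (e, (false, false))))).
  - have := cP (inl (inr (e, j))); rewrite /= asboolT// => H.
    apply/eqP; rewrite -leeNy_eq.
    have := le_trans (le_bigmax _ (fun i => (if i == inr (e, j) then 0 else -oo) + c i)
      (inr (e, j) : coord)) H.
    rewrite eqxx add0e => /le_trans; apply.
    by apply: bigmax_le => // i _; rewrite addNye.
  - by have := cP (inr (v, jj)); rewrite /= asboolT.
move=> [clt c1 c2 c3 c4]; split=> //.
case=> [[[e [b b']]|[e j]]|[v jj]] /=.
- by case: b; case: b' => /=; rewrite ?c1 ?c2.
- case: asboolP => [[le nj]|_//]; apply: bigmax_le => [|i _]; first exact: leNye.
  by case: eqP => [->|_]; rewrite ?addNye ?leNye// c3// addeNy leNye.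
- by case: asboolP => // ?; exact: c4.
Qed.

End Coordinates.

(** * From coordinates to members of R(D) *)

Section FromCoordinates.
Context {R : realType} {G : weighted_graph R}.
Variable D : divisor G.
Hypothesis D0 : effective D.
Implicit Types (e : edge G) (v : vertex G) (x : points G).
Local Notation N := ((slope_range D).*2.+1).

Lemma out_slopeE e b t (j : 'I_N) : valid_germ (e, t, b) -> edge_pt e t%:E =
    Vertex (if b then src e else tgt e) ->
  out_slope e b j = if b then (slope_at j - mass_upto D e t)%R
  else (mass_before D e t - slope_at j)%R.
Proof.
rewrite /valid_germ/=; case: b => -[t0 tl] /edge_pt_vertex[[t0' _]|[lt _]].
- have -> : t = 0%R by apply/le_anti; rewrite t0 andbT -lee_fin.
  by rewrite mass_upto0 subr0.
- by move: lt; rewrite leNgt tl.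
- by move: t0'; rewrite lee_fin leNgt t0.
- by rewrite (@mass_before_len _ _ _ e t)//; apply/le_anti; rewrite lt.
Qed.

Variable c : coord D -> \bar R.
Hypothesis cP : coord_cone c.

Let f x := tdot (weight x) c.

Definition germ_slope (g : @germ R G) (j : 'I_N) : int :=
  if g.2 then (slope_at j - mass_upto D g.1.1 g.1.2)%R
  else (mass_before D g.1.1 g.1.2 - slope_at j)%R.

Let c_ltey i : c i < +oo. Proof. by have [] := cP. Qed.

Let f_ltey x : f x < +oo.
Proof. by apply: tdot_ltey => // i; exact: weight_ltey. Qed.

Let f_vertex v : f (Vertex v) = c (inl v).
Proof. exact: tdot_at_vertex. Qed.

Let f_edge e (t : \bar R) : 0 <= t <= len e ->
  f (edge_pt e t) = \big[maxe/-oo]_(j < N) (line D e (slope_at j) t + c (inr (e, j))).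
Proof.
have [_ c1 c2 _ _] := cP; move=> /andP[t0 tl]; rewrite -tdot_at_edge.
have [->|t0'] := eqVneq t 0; first by rewrite edge_pt0 c1.
have [->|tl'] := eqVneq t (len e); first by rewrite edge_pt_ge// c2.
have {}tl : t < len e by rewrite lt_neqAle tl' tl.
have {}t0 : 0 < t by rewrite lt_neqAle eq_sym t0' t0.
case: t t0 tl {t0' tl'} => [t| |]// t0 tl; last by move: tl; rewrite ltNge leey.
have t_in : in_interior (e, t) by rewrite /in_interior/= -lte_fin t0.
by rewrite edge_ptE.
Qed.

Let f_att e (t : \bar R) : 0 <= t <= len e -> f (edge_pt e t) != -oo ->
  exists j, f (edge_pt e t) = line D e (slope_at j) t + c (inr (e, j)).
Proof.
by move=> tl; rewrite f_edge// => /bigmaxe_attained.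
Qed.

Let f_ge e (t : \bar R) j : 0 <= t <= len e ->
  line D e (slope_at j) t + c (inr (e, j)) <= f (edge_pt e t).
Proof.
move=> tl; rewrite f_edge//.
exact: (le_bigmax _ (fun j => line D e (slope_at j) t + c (inr (e, j)))).
Qed.

Let edge_dead e (t : R) : 0 <= t%:E <= len e -> f (edge_pt e t%:E) = -oo ->
  forall u, 0 <= u <= len e -> f (edge_pt e u) = -oo.
Proof.
move=> tl ft u ul; apply/eqP/negPn/negP => fNy; have [j fu] := f_att ul fNy.
have := f_ge j tl; rewrite ft leeNy_eq adde_eq_ninfty/= => /eqP cNy.
by move: fNy; rewrite fu cNy addeNy.
Qed.

Let src_range e : 0 <= (0 : \bar R) <= len e.
Proof. by rewrite lexx ltW// len_gt0. Qed.

Let tgt_range e : 0 <= len e <= len e.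
Proof. by rewrite lexx ltW// len_gt0. Qed.

Let vertex_dead v : ~ at_infinity (Vertex v) -> f (Vertex v) = -oo ->
  forall e, src e = v \/ tgt e = v -> forall u, 0 <= u <= len e -> f (edge_pt e u) = -oo.
Proof.
move=> vfin fv e [ev|ev].
  by apply: (@edge_dead e 0%R); rewrite ?src_range// edge_pt0 ev.
have le := finite_tgt_len vfin ev.
by apply: (@edge_dead e (fine (len e))); rewrite -len_fin// ?tgt_range// edge_pt_ge// ev.
Qed.

(** The value -oo spreads: lines are finite at real parameters, so one such value on an edge
    switches off all its lines; it then passes through the vertices, and everywhere by
    connectedness. A vertex at infinity has only one edge, which is already reached. *)
Let all_dead x : ~ at_infinity x -> f x = -oo -> f = cst -oo.
Proof.
move=> xfin fx.
have [v vfin fv] : exists2 v, ~ at_infinity (Vertex v) & f (Vertex v) = -oo.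
  move: xfin fx; case: (pointP x) => [v vfin fv|e t t0 tl _ fe]; first by exists v.
  exists (src e); first exact: src_finite.
  by rewrite -edge_pt0; apply: (edge_dead _ fe); rewrite ?src_range// lee_fin !ltW.
pose P u := f (Vertex u) = -oo /\ forall e, src e = u \/ tgt e = u ->
  forall t, 0 <= t <= len e -> f (edge_pt e t) = -oo.
have Pstep u w : P u -> Defs.adjacent (@src R G) (@tgt R G) u w -> P w.
  move=> [fu Pu] /existsP[e euw].
  have [eu ew] : (src e = u \/ tgt e = u) /\ (src e = w \/ tgt e = w).
    by case/orP: euw => /andP[/eqP -> /eqP ->]; split; [left|right|right|left].
  have fw : f (Vertex w) = -oo.
    case: ew => <-; first by rewrite -edge_pt0; apply: Pu.
    by rewrite -(@edge_pt_ge _ _ e (len e))//; apply: Pu.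
  split=> //; have [winf|wfin] := pselect (at_infinity (Vertex w)); last exact: vertex_dead.
  have /at_infinityP[e0 le0 [we0]] := winf.
  have eE e' : src e' = w \/ tgt e' = w -> e' = e0.
    case=> E; last by apply: (infinite_leaf le0); rewrite E.
    by have := @src_not_leaf _ _ e0 e' le0; rewrite E we0.
  by move=> e' /eE ->; rewrite -(eE e ew); exact: Pu.
have Pv : P v by split=> //; exact: vertex_dead.
have Pall u : P u.
  have /connectP[p vp ->] := graph_connected v u.
  elim: p v Pv vp {vfin fv} => //= w p IH v Pv /andP[vw wp].
  by apply: IH => //; exact: Pstep vw.
apply/funext => y; case: (pointP y) => [u|e t t0 tl]; first by have [] := Pall u.
have [_ Pe] := Pall (src e); apply: Pe; first by left.
by rewrite lee_fin !ltW.
Qed.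

Hypothesis fNy : f <> cst -oo.

Let f_fin x : ~ at_infinity x -> f x \is a fin_num.
Proof.
move=> xfin; rewrite fin_numElt f_ltey andbT ltNye.
by apply/eqP => fx; apply: fNy; exact: all_dead fx.
Qed.

Lemma line_affine g j : exists2 d : R, (0 < d)%R & forall s, (0 <= s < d)%R ->
  line D g.1.1 (slope_at j) (gpos g s)%:E =
  ((slope_at j)%:~R * g.1.2 - hinge D g.1.1 g.1.2 + (germ_slope g j)%:~R * s)%:E.
Proof.
case: g => -[e t] [] /=; rewrite /germ_slope /gpos/=; move: (slope_at j) => n.
  have [d d0 dP] := hinge_rslope D e t; exists d => // s sd.
  by congr EFin; rewrite dP// rmorphB/=; ring.
have [d d0 dP] := hinge_lslope D e t; exists d => // s sd.
by congr EFin; rewrite dP// rmorphB/=; ring.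
Qed.

(** The index j is that of a line through the value at the base with the greatest slope in the
    direction of the germ; [max_affine_germ] applies. *)
Lemma coord_germ g : valid_germ g -> exists j,
  [/\ line D g.1.1 (slope_at j) g.1.2%:E + c (inr (g.1.1, j)) = f (gpt g 0),
    gslope f g (germ_slope g j) &
    forall k, line D g.1.1 (slope_at k) g.1.2%:E + c (inr (g.1.1, k)) = f (gpt g 0) ->
      (germ_slope g k <= germ_slope g j)%R].
Proof.
move=> gv; have f0 := f_fin (valid_germ_finite gv).
have [d1 d10 d1P] := germ_room gv.
have [d2 d20 d2P] := finite_radius (line_affine g).
pose d0 := Num.min d1 d2.
have d00 : (0 < d0)%R by rewrite lt_min d10.
have posP s : (0 <= s < d0)%R -> 0 <= (gpos g s)%:E <= len g.1.1.
  rewrite lt_min => /and3P[s0 sd _]; move: s0; rewrite le_eqVlt => /predU1P[<-|s0].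
    by move: gv; rewrite gpos0 /valid_germ lee_fin; case: ifP => _ [a b]; rewrite ?a ?b ltW.
  by have [|a b] := d1P s; rewrite ?s0// lee_fin !ltW.
have [||j [jE [d d_gt0 dP] jmax]] := @max_affine_germ R _ (fun s => f (gpt g s))
    (fun j s => line D g.1.1 (slope_at j) (gpos g s)%:E + c (inr (g.1.1, j)))
    (fun j => (germ_slope g j)%:~R) d0 d00 f0.
- by move=> s sd; rewrite /gpt f_edge// posP.
- move=> j; case cj: (c (inr (g.1.1, j))) => [a| |].
  + right; exists ((slope_at j)%:~R * g.1.2 - hinge D g.1.1 g.1.2 + a)%R => s.
    rewrite lt_min => /and3P[s0 _ sd]; rewrite d2P ?s0// -EFinD.
    by congr EFin; ring.
  + by have := c_ltey (inr (g.1.1, j)); rewrite cj.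
  + by left=> s _; rewrite addeNy.
exists j; split.
- by rewrite -jE gpos0.
- by exists d.
- by move=> k kE; rewrite -(ler_int R); apply: jmax; rewrite gpos0.
Qed.

Let interior_germs e (t : R) : (0 < t)%R -> t%:E < len e ->
  exists sigma : @germ R G -> int,
    (forall g, g \in germs (edge_pt e t%:E) -> gslope f g (sigma g)) /\
    (0 <= D (edge_pt e t%:E) + \sum_(g <- germs (edge_pt e t%:E)) sigma g)%R.
Proof.
move=> t0 tl; have t_in : in_interior (e, t) by rewrite /in_interior/= t0.
have [|j [jE jsl jmax]] := @coord_germ (e, t, true); first by split=> //; exact: ltW.
have [|k [kE ksl kmax]] := @coord_germ (e, t, false); first by split=> //; exact: ltW.
exists (fun g => germ_slope g (if g.2 then j else k)).
rewrite edge_ptE/= !big_cons big_nil addr0; split.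
  by move=> g; rewrite !inE => /orP[]/eqP ->.
rewrite -edge_ptE -/(mass D e t) /germ_slope/= mass_jump//.
(* The line k, chosen on the left, also attains the value at the point and so competes on the right.
   The difference of the two slopes is exactly D plus the sum of the outgoing slopes. *)
have : (germ_slope (e, t, true) k <= germ_slope (e, t, true) j)%R.
  by apply: jmax; rewrite /gpt gpos0/= kE /gpt gpos0.
by rewrite /germ_slope/=; lia.
Qed.

(** Otherwise the indices of the lines carrying f along the germs at v satisfy [too_steep]. The
    corresponding clause of the cone then provides a strictly steeper line attaining the value at v,
    against the choice of these indices. *)
Let vertex_germs v : ~ at_infinity (Vertex v) ->
  exists sigma : @germ R G -> int,
    (forall g, g \in germs (Vertex v) -> gslope f g (sigma g)) /\
    (0 <= D (Vertex v) + \sum_(g <- germs (Vertex v)) sigma g)%R.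
Proof.
move=> vfin.
have /choice[J JP] : forall g : @germ R G, exists j, g \in germs (Vertex v) ->
  [/\ line D g.1.1 (slope_at j) g.1.2%:E + c (inr (g.1.1, j)) = f (gpt g 0),
    gslope f g (germ_slope g j) &
    forall k, line D g.1.1 (slope_at k) g.1.2%:E + c (inr (g.1.1, k)) = f (gpt g 0) ->
      (germ_slope g k <= germ_slope g j)%R].
  move=> g; have [gv|_] := boolP (g \in germs (Vertex v)); last by exists ord0.
  by have [j jP] := coord_germ ((germsP g vfin).1 gv).2; exists j.
exists (fun g => germ_slope g (J g)); split=> [g /JP[]//|].
pose base (eb : edge G * bool) : @germ R G :=
  (eb.1, if eb.2 then 0%R else fine (len eb.1), eb.2).
pose jj : {ffun edge G * bool -> 'I_N} := [ffun eb => J (base eb)].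
have germE g : g \in germs (Vertex v) -> g = base (g.1.1, g.2).
  by rewrite mem_cat => /orP[/mapP[e _ ->]|/mapP[e _ ->]].
have slopeE g j : g \in germs (Vertex v) -> germ_slope g j = out_slope g.1.1 g.2 j.
  move=> gv; have [gv1 gv2] := (germsP g vfin).1 gv.
  move: gv gv1 gv2; case: g => -[e t] b; rewrite mem_cat => gv gv1 gv2.
  rewrite (out_slopeE _ gv2)//; move: gv1; rewrite /gpt gpos0/= => ->; congr Vertex.
  by case/orP: gv => /mapP[e']; rewrite mem_enum inE => /eqP <- [-> _ ->].
rewrite leNgt; apply/negP => neg.
have vjj : too_steep v jj.
  split=> //; apply: le_lt_trans neg; rewrite le_eqVlt; apply/orP; left; apply/eqP.
  congr (_ + _)%R; apply: eq_big_seq => g gv.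
  by rewrite slopeE// ffunE -germE.
have [_ _ _ _ /(_ v jj vjj)] := cP.
rewrite tdot_at_vertex -f_vertex => le_f.
have fvNy : f (Vertex v) != -oo by have := f_fin vfin; rewrite fin_numE => /andP[].
have [[v'|[e j]] att] : exists i, tdot (steeper v jj) c = steeper v jj i + c i.
- apply: bigmaxe_attained; apply: contra_neq fvNy => E.
  by apply/eqP; rewrite -leeNy_eq -E.
- by move: le_f; rewrite att/= leeNy_eq (negbTE fvNy).
move: le_f; rewrite att/= => {att}.
rewrite addeC adde_maxr le_max => /orP[].
  case: andP => [[/eqP ev jlt]|_]; last by rewrite addeNy leeNy_eq (negbTE fvNy).
  have gv : (e, 0%R, true) \in germs (Vertex v).
    by rewrite mem_cat; apply/orP; left; apply/mapP; exists e; rewrite ?mem_enum ?inE ?ev.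
  have [_ _ /(_ j)] := JP _ gv; rewrite /gpt gpos0/= edge_pt0 ev => H le_f.
  have : (germ_slope (e, 0%R, true) j <= germ_slope (e, 0%R, true) (J (e, 0%R, true)))%R.
    apply: H; apply/le_anti/andP; split; last by rewrite addeC.
    have := f_ge j (src_range e); rewrite edge_pt0 ev; exact.
  rewrite /germ_slope/= /slope_at !lerD2r lez_nat leqNgt.
  by move: jlt; rewrite ffunE /base/= => ->.
case: andP => [[/eqP ev jlt]|_]; last by rewrite addeNy leeNy_eq (negbTE fvNy).
have le := finite_tgt_len vfin ev.
have gv : (e, fine (len e), false) \in germs (Vertex v).
  by rewrite mem_cat; apply/orP; right; apply/mapP; exists e; rewrite ?mem_enum ?inE ?ev.
have [_ _ /(_ j)] := JP _ gv; rewrite /gpt gpos0/= -len_fin// edge_pt_ge// ev => H le_f.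
have : (germ_slope (e, fine (len e), false) j <=
    germ_slope (e, fine (len e), false) (J (e, fine (len e), false)))%R.
  apply: H; apply/le_anti/andP; split; last first.
    by move: le_f; rewrite addeC [X in line _ _ _ X](len_fin le).
  have := f_ge j (tgt_range e).
  by rewrite edge_pt_ge// ev [X in line _ _ _ X](len_fin le).
rewrite /germ_slope/= /slope_at lerD2l lerN2 lerD2r lez_nat leqNgt.
by move: jlt; rewrite ffunE /base/= => ->.
Qed.

(** Among the lines not switched off, the one of greatest slope dominates eventually; after
    subtracting the hinge function its slope is at most 0 by the clause of the cone on infinite
    edges. *)
Let tail e : len e = +oo -> exists m : int, (m <= 0)%R /\ tail_slope f e m.
Proof.
move=> le; have [_ _ _ /(_ e) cNy _] := cP.
have [a a0 aE] := hinge_tail D e.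
have lineE (j : 'I_N) (t : R) : (a <= t)%R -> line D e (slope_at j) t%:E =
    (moment D e + (slope_at j - mass_total D e)%:~R * t)%:E.
  by move=> at_; move: (slope_at j) => n; rewrite /= aE// rmorphB/=; congr EFin; ring.
have [j0 j0P] : exists j, c (inr (e, j)) != -oo.
  have [||j jE] := @f_att e 0; first exact: src_range.
    by have := f_fin (@src_finite _ _ e); rewrite edge_pt0 fin_numE => /andP[].
  exists j; apply: contraTneq isT => cj; have := f_fin (@src_finite _ _ e).
  by rewrite -edge_pt0 jE cj addeNy.
have [j jP jmax] := @arg_maxP _ _ _ j0 (fun j => c (inr (e, j)) != -oo)
  (fun j => slope_at j) j0P.
have cE k : c (inr (e, k)) != -oo -> c (inr (e, k)) = (fine (c (inr (e, k))))%:E.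
  by move=> ck; rewrite fineK// fin_numElt c_ltey andbT ltNye.
have slope_le k : c (inr (e, k)) != -oo -> (slope_at k <= mass_total D e)%R.
  by move=> ck; rewrite leNgt; apply/negP => /(cNy _ le)/eqP; rewrite (negbTE ck).
pose m : int := (slope_at j - mass_total D e)%R.
have m0 : (m <= 0)%R by have := slope_le j jP; rewrite /m; lia.
pose C : R := (moment D e + fine (c (inr (e, j))))%R.
have [b bP] : exists b : R, forall k (t : R), (b < t)%R -> (a < t)%R ->
    line D e (slope_at k) t%:E + c (inr (e, k)) <= (C + m%:~R * t)%:E.
  suff /choice[b bP] : forall k : 'I_N, exists b : R, forall t : R, (b < t)%R -> (a < t)%R ->
      line D e (slope_at k) t%:E + c (inr (e, k)) <= (C + m%:~R * t)%:E.
    exists (\big[Num.max/0%R]_k b k) => k t bt; apply: bP; apply: le_lt_trans bt.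
    exact: le_bigmax.
  move=> k; have [ck|ck] := eqVneq (c (inr (e, k))) -oo.
    by exists 0%R => t _ _; rewrite ck addeNy leNye.
  have [->|kj] := eqVneq k j.
    exists 0%R => t _ at_; rewrite (lineE _ _ (ltW at_)) (cE j jP) -EFinD lee_fin /C /m; lra.
  (* The difference of intercepts is enough as a threshold because distinct slopes differ by at
     least 1. *)
  exists (fine (c (inr (e, k))) - fine (c (inr (e, j))))%R => t bt at_.
  rewrite (lineE _ _ (ltW at_)) (cE k ck) -EFinD lee_fin /C /m.
  have kj' : (slope_at k + 1 <= slope_at j)%R.
    have : slope_at k != slope_at j by apply: contra_neq kj => /slope_at_inj.
    by have := jmax k ck => /=; lia.
  have : ((slope_at k + 1 - mass_total D e)%:~R * t <= (slope_at j - mass_total D e)%:~R * t)%R.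
    by apply: ler_wpM2r; [lra|rewrite ler_int; lia].
  rewrite !rmorphB !rmorphD/= !(mulrBl, mulrDl); lra.
exists m; split=> //; exists C, (Num.max a b); split.
  move=> t; rewrite gt_max => /andP[at_ bt].
  have t0 : 0 <= t%:E <= len e by rewrite le leey lee_fin; lra.
  apply/le_anti/andP; split.
    rewrite f_edge//; apply: bigmax_le => [|k _]; first exact: leNye.
    exact: bP.
  apply: le_trans (f_ge j t0); rewrite (lineE _ _ (ltW at_)) (cE j jP) -EFinD lee_fin /C /m; lra.
rewrite -(@edge_pt_ge _ _ e (len e))// f_edge ?tgt_range// le.
apply/le_anti/andP; split.
  apply: bigmax_le => [|k _]; first exact: leNye.
  rewrite /=; case: (eqVneq (slope_at k) (mass_total D e)) => [kE|_]; last by rewrite addNye leNye.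
  have [->|ck] := eqVneq (c (inr (e, k))) -oo; first by rewrite addeNy leNye.
  have jE : j = k.
    apply: slope_at_inj; apply/le_anti; rewrite kE slope_le//=.
    by have := jmax k ck; rewrite /= kE.
  by rewrite /m jE kE subrr eqxx /C jE EFinD -(cE k ck).
case: (eqVneq m 0%R) => [mE|_]; last exact: leNye.
apply: le_trans (le_bigmax _ (fun j => line D e (slope_at j) +oo + c (inr (e, j))) j).
by rewrite /= ifT; [rewrite /C EFinD -(cE j jP)|apply/eqP; move: mE; rewrite /m; lia].
Qed.

Lemma coord_germ_system : germ_system D (fun x => tdot (weight x) c).
Proof.
split=> // x xfin; move: (xfin); case: (pointP x) => [v|e t t0 tl _]; first exact: vertex_germs.
exact: interior_germs.
Qed.

End FromCoordinates.

(** * From members of R(D) to coordinates *)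

Section ToCoordinates.
Context {R : realType} {G : weighted_graph R}.
Variable D : divisor G.
Hypothesis D0 : effective D.
Implicit Types (e : edge G) (v : vertex G) (x : points G).
Local Notation N := ((slope_range D).*2.+1).
Variable f : points G -> \bar R.
Hypothesis fD : germ_system D f.

Let F e t : R := convexified D f e t.

(** Minus the Legendre transform of the convexified function, at an integer slope; the value is set
    to -oo on an infinite edge when the line is steeper than the function can be far out. *)
Definition edge_coord e (j : 'I_N) : \bar R :=
  if `[< len e = +oo /\ (mass_total D e < slope_at j)%R >] then -oo
  else ereal_inf [set (F e u - (slope_at j)%:~R * u)%:E | u in
    [set u : R | (0 <= u)%R /\ u%:E <= len e]].

Definition coords : coord D -> \bar R := fun i =>
  match i with inl v => f (Vertex v) | inr (e, j) => edge_coord e j end.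

Let mass_sum_ge0 : (0 <= mass_sum D)%R.
Proof. by apply: sumr_ge0 => e _; exact: mass_total_ge0. Qed.

Let f_edgeE e (t : R) : t%:E <= len e -> f (edge_pt e t%:E) = (F e t - hinge D e t)%:E.
Proof.
move=> tl; have [f_fin _ _] := fD.
by rewrite /F /convexified addrK fineK//; apply: f_fin; exact: edge_pt_finite.
Qed.

Let ex_start e : exists a : int, [/\ gslope f (e, 0%R, true) a, (- slope_bound D <= a)%R &
  rslope (F e) 0 a%:~R].
Proof.
have [|a ga] := ex_gslope fD (g := (e, 0%R, true)); first by split=> //; exact: len_gt0.
exists a; split=> //; first exact: (vertex_slopes_ge D0 fD).1 ga.
by have := convexified_rslope D ga; rewrite mass_upto0 addr0.
Qed.

Let ex_end e (L : R) : len e = L%:E -> exists b : int,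
  [/\ gslope f (e, L, false) b, (- slope_bound D <= b)%R &
  lslope (F e) L (mass_total D e - b)%:~R].
Proof.
move=> le; have [|b gb] := ex_gslope fD (g := (e, L, false)).
  by rewrite /valid_germ/= -lte_fin -le lexx; split=> //; exact: len_gt0.
exists b; split=> //; first exact: (vertex_slopes_ge D0 fD).2 le gb.
by have := convexified_lslope D gb; rewrite (mass_before_len D le).
Qed.

Let slope_index (n : int) : (- slope_bound D <= n)%R ->
  (n <= slope_bound D + mass_sum D)%R -> exists j : 'I_N, slope_at j = n.
Proof.
move=> n1 n2; apply: slope_atP; have := slope_range_ge D; have := mass_sum_ge0.
by move=> ? ?; apply/andP; split; lia.
Qed.

(** By monotonicity the slope lies between those at the two ends, which the bound on the outgoing
    slopes at vertices controls; on an infinite edge the slope of the tail replaces the second. *)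
Let rslope_index e (t : R) (n : int) : (0 <= t)%R -> t%:E < len e ->
  rslope (F e) t n%:~R ->
  (exists j : 'I_N, slope_at j = n) /\ (len e = +oo -> (n <= mass_total D e)%R).
Proof.
move=> t0 tl Fn; have [a [ga a0 Fa]] := ex_start e.
have an : (a <= n)%R.
  rewrite -(ler_int R); move: t0; rewrite le_eqVlt => /predU1P[t0|t0].
    by rewrite t0 in Fa; rewrite (rslope_uniq Fa Fn).
  exact: (slope_mono_r fD (lexx _) t0 tl Fa Fn).
have n_inf : len e = +oo -> (n <= mass_total D e)%R.
  move=> le; have [_ _ /(_ e le)[m [m0 mt]]] := fD.
  have := tail_slope_bound fD le t0 Fn mt; rewrite ler_int; lia.
have me := mass_sum_ge D0 e.
split=> //; apply: slope_index; first exact: le_trans an.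
have [le|le] := pselect (len e = +oo).
  apply: le_trans (n_inf le) _; apply: (le_trans me); rewrite lerDr.
  rewrite /slope_bound !addr_ge0// sumr_ge0// => v _; exact: D0.
have le' := len_fin le; have [b [gb b0 Fb]] := ex_end le'.
have tL : (t < fine (len e))%R by rewrite -lte_fin -le'.
have := slope_mono fD t0 tL _ Fn Fb; rewrite -le' lexx => /(_ isT).
rewrite ler_int; lia.
Qed.

Let lslope_index e (L : R) (n : int) : len e = L%:E -> lslope (F e) L n%:~R ->
  exists j : 'I_N, slope_at j = n.
Proof.
move=> le Fn; have [b [gb b0 Fb]] := ex_end le.
have nE : n = (mass_total D e - b)%R.
  by apply/eqP; rewrite -(eqr_int R); apply/eqP; exact: lslope_uniq Fn Fb.
have [a [ga a0 Fa]] := ex_start e.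
have L0 : (0 < L)%R by rewrite -lte_fin -le len_gt0.
have := slope_mono fD (lexx _) L0 _ Fa Fn; rewrite le lexx => /(_ isT).
have me := mass_sum_ge D0 e.
by rewrite ler_int => an; apply: slope_index; [exact: le_trans an|lia].
Qed.

Let edge_coord_le e (j : 'I_N) (u : R) : (0 <= u)%R -> u%:E <= len e ->
  edge_coord e j <= (F e u - (slope_at j)%:~R * u)%:E.
Proof.
move=> u0 ul; rewrite /edge_coord; case: ifP => _; first exact: leNye.
by apply: ereal_inf_lbound; exists u.
Qed.

(** A supporting line attains the infimum at its point of contact, so f is recovered there by that
    line. *)
Let tangent_coord e (j : 'I_N) (t : R) : (0 <= t)%R -> t%:E <= len e ->
  (forall u, (0 <= u)%R -> u%:E <= len e -> (F e t + (slope_at j)%:~R * (u - t) <= F e u)%R) ->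
  (len e = +oo -> (slope_at j <= mass_total D e)%R) ->
  edge_coord e j = (F e t - (slope_at j)%:~R * t)%:E.
Proof.
move=> t0 tl Ft j_inf; apply/le_anti/andP; split; first exact: edge_coord_le.
rewrite /edge_coord; case: asboolP => [[/j_inf]|_]; first by rewrite leNgt => /negbTE ->.
apply: le_ereal_inf_tmp => _ [u [u0 ul] <-]; rewrite lee_fin.
by have := Ft u u0 ul; rewrite mulrBr; lra.
Qed.

Let line_le e (j : 'I_N) (t : R) : (0 <= t)%R -> t%:E <= len e ->
  line D e (slope_at j) t%:E + edge_coord e j <= f (edge_pt e t%:E).
Proof.
move=> t0 tl; rewrite f_edgeE//.
apply: le_trans (leeD2l _ (edge_coord_le j t0 tl)) _.
by rewrite /= -EFinD lee_fin; lra.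
Qed.

Let tangent_value e (j : 'I_N) (t : R) : (0 <= t)%R -> t%:E <= len e ->
  (forall u, (0 <= u)%R -> u%:E <= len e -> (F e t + (slope_at j)%:~R * (u - t) <= F e u)%R) ->
  (len e = +oo -> (slope_at j <= mass_total D e)%R) ->
  line D e (slope_at j) t%:E + edge_coord e j = f (edge_pt e t%:E).
Proof.
move=> t0 tl Ft j_inf; rewrite f_edgeE// (tangent_coord t0 tl Ft j_inf)/= -EFinD.
by congr EFin; lra.
Qed.

Let right_value e (t : R) (n : int) : (0 <= t)%R -> t%:E < len e ->
  rslope (F e) t n%:~R -> exists j : 'I_N, slope_at j = n /\
  line D e (slope_at j) t%:E + edge_coord e j = f (edge_pt e t%:E).
Proof.
move=> t0 tl Fn; have [[j jn] n_inf] := rslope_index t0 tl Fn.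
exists j; split=> //; apply: (tangent_value t0 (ltW tl)); rewrite jn// => u u0 ul.
exact: (rtangent fD).
Qed.

Let left_value e (L : R) (n : int) : len e = L%:E ->
  lslope (F e) L n%:~R -> exists j : 'I_N, slope_at j = n /\
  line D e (slope_at j) L%:E + edge_coord e j = f (edge_pt e L%:E).
Proof.
move=> le Fn; have [j jn] := lslope_index le Fn.
have L0 : (0 < L)%R by rewrite -lte_fin -le len_gt0.
have Ll : L%:E <= len e by rewrite le.
exists j; split=> //; apply: (tangent_value (ltW L0) Ll); rewrite jn ?le// => u u0 ul.
by apply: (ltangent fD); rewrite ?le.
Qed.

(** At the leaf end only the line of slope [mass_total D e] counts. If the tail of f has negative
    slope, its coordinate is -oo; if the slope is 0, this line is tangent to the tail and gives its
    constant value. *)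
Let infinite_value e : len e = +oo ->
  \big[maxe/-oo]_(j < N) (line D e (slope_at j) +oo + edge_coord e j) = f (Vertex (tgt e)).
Proof.
move=> le; have [_ _ /(_ e le)[m [m0 [C [a [fE fy]]]]]] := fD.
have [b b0 bE] := hinge_tail D e.
have FE u : (a < u)%R -> (b <= u)%R ->
    F e u = (C + m%:~R * u + ((mass_total D e)%:~R * u - moment D e))%R.
  by move=> au bu; rewrite /F /convexified fE//= bE.
have u_le u : u%:E <= len e by rewrite le leey.
rewrite fy; apply/le_anti/andP; split.
  apply: bigmax_le => [|j _]; first exact: leNye.
  rewrite /=; case: eqP => [jH|_]; last by rewrite addNye leNye.
  have cle u : (a < u)%R -> (b <= u)%R ->
      edge_coord e j <= (C + m%:~R * u - moment D e)%:E.
    move=> au bu; have u0 := le_trans b0 bu.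
    apply: (le_trans (edge_coord_le j u0 (u_le u))).
    by rewrite FE// jH lee_fin; lra.
  have au1 : (a < Num.max a b + 1)%R.
    by have : (a <= Num.max a b)%R; [rewrite le_max lexx|lra].
  have bu1 : (b <= Num.max a b + 1)%R.
    by have : (b <= Num.max a b)%R; [rewrite le_max lexx orbT|lra].
  have c1 := cle _ au1 bu1.
  have [mE|mn0] := eqVneq m 0%R.
    move: c1; rewrite mE mul0r addr0 => H; apply: (le_trans (leeD2l _ H)).
    by rewrite -EFinD lee_fin; lra.
  have mlt : (m%:~R <= -1 :> R)%R.
    have : (m <= -1)%R by lia.
    by rewrite -(ler_int R).
  case cj: (edge_coord e j) => [r| |]; last by rewrite addeNy.
  - pose u := (Num.max (Num.max a b) (C - moment D e - r) + 1)%R.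
    have : (Num.max (Num.max a b) (C - moment D e - r) < u)%R by rewrite /u; lra.
    rewrite !gt_max => /andP[/andP[au bu] ru].
    have := cle u au (ltW bu); rewrite cj lee_fin => H; exfalso.
    have u0 : (0 <= u)%R by exact: le_trans b0 (ltW bu).
    have : (m%:~R * u <= -1 * u)%R by exact: ler_wpM2r.
    lra.
  - by move: c1; rewrite cj.
case: eqP => [mE|_]; last exact: leNye.
pose u := (Num.max a b + 1)%R.
have [au bu] : (a < u)%R /\ (b < u)%R.
  have : (Num.max a b < u)%R by rewrite /u; lra.
  by rewrite gt_max => /andP[].
have u0 : (0 <= u)%R by exact: le_trans b0 (ltW bu).
have Fu : rslope (F e) u (mass_total D e)%:~R.
  exists 1%R => // s /andP[s0 _]; have us : (a < u + s)%R /\ (b <= u + s)%R by split; lra.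
  by rewrite (FE _ us.1 us.2) (FE _ au (ltW bu)) mE; ring.
have ul : u%:E < len e by rewrite le ltry.
have [[j jn] _] := rslope_index u0 ul Fu.
apply: le_trans (le_bigmax _ (fun j => line D e (slope_at j) +oo + edge_coord e j) j).
have -> : edge_coord e j = (F e u - (slope_at j)%:~R * u)%:E.
  apply: tangent_coord => //; last by rewrite jn.
  by move=> w w0 wl; rewrite jn; exact: (rtangent fD).
rewrite /= jn eqxx -EFinD lee_fin (FE _ au (ltW bu)) mE mulr0z; lra.
Qed.

Let edge_value e (t : \bar R) : 0 <= t <= len e ->
  \big[maxe/-oo]_(j < N) (line D e (slope_at j) t + edge_coord e j) = f (edge_pt e t).
Proof.
case: t => [t| |]; [|move=> /andP[_]; rewrite leye_eq => /eqP le|by rewrite leeNy_eq]; last first.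
  by rewrite infinite_value// edge_pt_ge// leey.
rewrite lee_fin => /andP[t0 tl].
have [j jE] : exists j : 'I_N, line D e (slope_at j) t%:E + edge_coord e j = f (edge_pt e t%:E).
  have [tl'|] := boolP (t%:E < len e).
    have [m gm] := ex_gslope fD (g := (e, t, true)) (conj t0 tl').
    by have [j [_ jE]] := right_value t0 tl' (convexified_rslope D gm); exists j.
  rewrite -leNgt => lt; have le : len e = t%:E by apply/le_anti; rewrite tl lt.
  by have [b [_ _ Fb]] := ex_end le; have [j [_ jE]] := left_value le Fb; exists j.
apply/le_anti/andP; split.
  by apply: bigmax_le => [|k _]; [exact: leNye|exact: line_le].
rewrite -jE; exact: (le_bigmax _ (fun j => line D e (slope_at j) t%:E + edge_coord e j)).
Qed.

Lemma coords_weight x : tdot (weight x) coords = f x.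
Proof.
case: (pointP x) => [v|e t t0 tl]; first by rewrite /= tdot_at_vertex.
have t_in : in_interior (e, t) by rewrite /in_interior/= t0.
rewrite edge_ptE /= tdot_at_edge -edge_ptE; apply: edge_value.
by rewrite lee_fin !ltW.
Qed.

Lemma coords_cone : coord_cone coords.
Proof.
have r0 e : 0 <= (0 : \bar R) <= len e by rewrite lexx ltW// len_gt0.
have rL e : 0 <= len e <= len e by rewrite lexx ltW// len_gt0.
split.
- case=> [v|[e j]]; first exact: germ_system_ltey fD _.
  by apply: le_lt_trans (edge_coord_le j (lexx 0%R) _) (ltry _); exact: ltW (len_gt0 e).
- by move=> e; rewrite tdot_at_edge tdot_at_vertex edge_value// edge_pt0.
- by move=> e; rewrite tdot_at_edge tdot_at_vertex edge_value// edge_pt_ge.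
- by move=> e j le nj; rewrite /= /edge_coord asboolT.
move=> v jj [vfin neg]; rewrite tdot_at_vertex.
have [_ /(_ _ vfin)[s [sP sD]] _] := fD.
(* The slopes of f satisfy the inequality at v and the slopes [jj] do not, so on some germ f is
   strictly steeper; the tangent to f there is the required line. *)
have [g gv gs] : exists2 g, g \in germs (Vertex v) &
    (out_slope g.1.1 g.2 (jj (g.1.1, g.2)) < s g)%R.
  apply: contrapT => H.
  have : (\sum_(g <- germs (Vertex v)) s g <=
      \sum_(g <- germs (Vertex v)) out_slope g.1.1 g.2 (jj (g.1.1, g.2)))%R.
    rewrite big_seq [leRHS]big_seq; apply: ler_sum => g gv.
    by rewrite leNgt; apply/negP => gs; apply: H; exists g.
  lia.
have sg := sP g gv; have [gx gval] := (germsP g vfin).1 gv.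
move: gv gs sg gx gval; rewrite mem_cat => /orP[]/mapP[e]; rewrite mem_enum inE => /eqP ev ->.
  rewrite /out_slope/= => js sg gx gval.
  have Fs := convexified_rslope D sg; rewrite mass_upto0 addr0 in Fs.
  have [j [jE jv]] := right_value (lexx 0%R) (len_gt0 e) Fs.
  apply: le_trans (le_bigmax _ (fun i => steeper v jj i + coords i) (inr (e, j))).
  rewrite /steeper ev eqxx.
  have -> : (jj (e, true) < j)%N by move: js; rewrite -jE /slope_at ltrD2r ltz_nat.
  rewrite addeC adde_maxr le_max; apply/orP; left.
  by rewrite addeC jv edge_pt0 ev.
rewrite /out_slope/= => js sg gx gval.
have le := finite_tgt_len vfin ev.
have le' := len_fin le.
have Fs := convexified_lslope D sg; rewrite (mass_before_len D le') in Fs.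
have [j [jE jv]] := left_value le' Fs.
apply: le_trans (le_bigmax _ (fun i => steeper v jj i + coords i) (inr (e, j))).
rewrite /steeper ev eqxx.
have -> : (j < jj (e, false))%N 
    by move: js; rewrite ltrBlDr -ltrBlDl -jE /slope_at ltrD2r ltz_nat.
rewrite addeC adde_maxr le_max; apply/orP; right.
by rewrite addeC [X in line _ _ _ X]le' jv -le' edge_pt_ge// ev.
Qed.

End ToCoordinates.

Section FiniteGeneration.
Context {R : realType} {G : weighted_graph R}.
Variable D : divisor G.
Hypotheses (D0 : effective D) (Dinf : forall x, at_infinity x -> D x = 0%R).

Lemma linear_system_finitely_generated : exists S : set (points G -> \bar R),
  finite_set S /\ tropical_span S = linear_system_functions D.
Proof.
have [S [finS _ SE]] := coord_cone_finitely_generated D.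
exists ((fun c x => tdot (weight x) c) @` S); split; first exact: finite_image.
rewrite -tropical_span_image SE; apply/seteqP; split.
  move=> _ [c cP <-].
  have [->|fNy] := pselect ((fun x => tdot (weight x) c) = cst -oo); first by right.
  by have [] := (germ_systemP _ D0 Dinf).2 (coord_germ_system cP fNy).
move=> f [fD|->]; last first.
  exists (cst -oo); last by apply/funext => x; rewrite tdotNy.
  split=> //.
  - by move=> e; rewrite !tdotNy.
  - by move=> e; rewrite !tdotNy.
  - by move=> v jj _; rewrite tdotNy leNye.
have [_ fNy _] := fD.
have fG := (germ_systemP f D0 Dinf).1 (conj (or_introl fD) fNy).
exists (@coords R G D f); first exact: (coords_cone D0 fG).
by apply/funext => x; exact: (coords_weight D0 fG).
Qed.

End FiniteGeneration.

(** * Finite generation of the invariant part *)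

Section Symmetrization.
Context {R : realType} {G : weighted_graph R} {K : finGroupType}.
Variables (to : {action K &-> points G}) (D : divisor G).
Hypotheses (hto : isometric_action to) (D0 : effective D)
  (Dinf : forall x, at_infinity x -> D x = 0%R) (DK : invariant_divisor to D).
Implicit Types (f : points G -> \bar R) (x y : points G) (k : K).

Definition symmetrize f x : \bar R := \big[maxe/-oo]_(k : K) f (to x k).

Lemma symmetrize_act f k x : symmetrize f (to x k) = symmetrize f x.
Proof.
rewrite /symmetrize [RHS](reindex_inj (mulgI k)).
by apply: eq_bigr => k' _; rewrite act_ptM.
Qed.

Lemma symmetrize_id f : (forall k x, f (to x k) = f x) -> symmetrize f = f.
Proof.
move=> fK; apply/funext => x; apply/le_anti/andP; split.
  by apply: bigmax_le => [|k _]; rewrite ?leNye ?fK.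
by apply: le_trans (le_bigmax _ (fun k => f (to x k)) 1%g); rewrite fK.
Qed.

Lemma symmetrize_bigmax n (F : 'I_n -> points G -> \bar R) (a : 'I_n -> \bar R) :
  symmetrize (fun x => \big[maxe/-oo]_i (a i + F i x)) =
  fun x => \big[maxe/-oo]_i (a i + symmetrize (F i) x).
Proof.
apply/funext => x; rewrite /symmetrize.
apply/le_anti/andP; split.
  apply: bigmax_le => [|k _]; first exact: leNye.
  apply: bigmax_le => [|i _]; first exact: leNye.
  apply: le_trans (le_bigmax _ _ i).
  by apply: leeD2l; exact: (le_bigmax _ (fun k => F i (to x k))).
apply: bigmax_le => [|i _]; first exact: leNye.
rewrite adde_bigmaxr; apply: bigmax_le => [|k _]; first exact: leNye.
apply: le_trans (le_bigmax _ (fun k => \big[maxe/-oo]_i (a i + F i (to x k))) k).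
exact: (le_bigmax _ (fun i => a i + F i (to x k))).
Qed.

Lemma linear_system_act f k : linear_system_functions D f ->
  linear_system_functions D (fun x => f (to x k)).
Proof.
move=> [fD|->]; last by right.
have [_ fNy _] := fD.
have fG := (germ_systemP f D0 Dinf).1 (conj (or_introl fD) fNy).
have := germ_system_act hto (DK k) fG.
by move=> /(germ_systemP _ D0 Dinf)[].
Qed.

Lemma symmetrize_linear_system f : linear_system_functions D f ->
  invariant_linear_system_functions to D (symmetrize f).
Proof.
move=> fD; split; last by move=> k x; exact: symmetrize_act.
have [S [_ SE]] := linear_system_finitely_generated D0 Dinf.
rewrite -SE; apply: tropical_span_bigmax => k; rewrite SE.
exact: linear_system_act.
Qed.

(** Symmetrization is a retraction of R(D) onto R(D)^K compatible with tropical combinations, so it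
    carries generators to generators. *)
Lemma invariant_linear_system_finitely_generated :
  exists S : set (points G -> \bar R), finite_set S /\
    tropical_span S = invariant_linear_system_functions to D.
Proof.
have [S [finS SE]] := linear_system_finitely_generated D0 Dinf.
exists (symmetrize @` S); split; first exact: finite_image.
apply/seteqP; split.
  move=> f fS; split; last first.
    move: f fS; apply: tropical_span_ind => [//|a _ g alt [s Ss <-] IH k x].
    by rewrite symmetrize_act IH.
  rewrite -SE; move: f fS; apply: tropical_span_min => _ [s Ss <-].
  rewrite SE; apply: (symmetrize_linear_system _).1.
  by rewrite -SE; exact: sub_tropical_span.
move=> f [+ fK]; rewrite -SE => -[n [F [a [FS alt fE]]]].
exists n, (fun i => symmetrize (F i)), a; split=> // [i|x]; first by exists (F i).
rewrite -(symmetrize_id fK) (_ : f = fun x => \big[maxe/-oo]_i (a i + F i x)); last exact/funext.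
by rewrite symmetrize_bigmax.
Qed.

End Symmetrization.

Section AffineTail.
Context {R : realType} {J : finType}.
Local Open Scope ring_scope.

(** Eventually a term of greatest slope wins and, among these, one of greatest constant term. *)
Lemma max_affine_tail (A n : J -> R) (j0 : J) : exists j, exists b : R, forall t, b < t ->
  \big[maxe/-oo%E]_j (A j + n j * t)%:E = (A j + n j * t)%:E.
Proof.
have [j1 _ j1max] := @arg_maxP _ _ _ j0 xpredT n isT.
have [j /eqP jn jmax] := @arg_maxP _ _ _ j1 (fun j => n j == n j1) A (eqxx _).
have /choice[b bP] : forall k, exists b : R, forall t, b < t ->
    A k + n k * t <= A j + n j * t.
  move=> k; have [kn|kn] := eqVneq (n k) (n j1).
    exists 0 => t _; rewrite kn jn lerD2r; apply: jmax; exact/eqP.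
  have kj : 0 < n j - n k.
    by rewrite subr_gt0 jn lt_neqAle kn; exact: j1max.
  exists ((A k - A j) / (n j - n k)) => t; rewrite ltr_pdivrMr// => tb.
  by move: tb; rewrite mulrBr; lra.
exists j, (\big[Num.max/0]_k b k) => t bt.
apply/le_anti/andP; split; last exact: (le_bigmax _ (fun j => (A j + n j * t)%:E)).
apply: bigmax_le => [|k _]; first exact: leNye.
rewrite lee_fin; apply: bP; apply: le_lt_trans bt; exact: le_bigmax.
Qed.

End AffineTail.

(** * Separation of orbits *)

Section Tents.
Context {R : realType} {G : weighted_graph R}.
Variable D : divisor G.
Hypotheses (D0 : effective D) (Dinf : forall x, at_infinity x -> D x = 0%R)
  (Dvertex : forall v, ~ at_infinity (Vertex v) -> D (Vertex v) != 0%R).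
Implicit Types (e : edge G) (v : vertex G) (x y z : points G) (s t : R).

(** The candidates are the two ends and the interior support. On an infinite edge [fine (len e)] is
    0, a candidate already present. *)
Definition positions e : seq R :=
  [seq s <- 0%R :: fine (len e) :: supp D e |
    [&& (0 <= s)%R, s%:E <= len e & D (edge_pt e s%:E) != 0%R]].

Lemma positionsP e s : s \in positions e <->
  [/\ (0 <= s)%R, s%:E <= len e & D (edge_pt e s%:E) != 0%R].
Proof.
rewrite mem_filter; split=> [/andP[/and3P[]]//|[s0 sl Ds]].
rewrite s0 sl Ds/= !inE; have [//|s0'] := eqVneq s 0%R.
have [sL|sl'] := eqVneq s%:E (len e); first by rewrite -sL eqxx.
apply/orP; right; apply/orP; right; apply/suppP; split=> //.
  by rewrite lt_neqAle eq_sym s0'.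
by rewrite lt_neqAle sl'.
Qed.

Lemma positions0 e : 0%R \in positions e.
Proof.
apply/positionsP; split=> //; first exact: ltW (len_gt0 e).
by rewrite edge_pt0; apply: Dvertex; exact: src_finite.
Qed.

Lemma positions_len e (L : R) : len e = L%:E -> L \in positions e.
Proof.
move=> le; apply/positionsP; split; rewrite -?lee_fin -?le ?lexx//.
  exact: ltW (len_gt0 e).
by rewrite edge_pt_ge//; apply: Dvertex; apply: tgt_finite; rewrite le.
Qed.

Variables (beta : points G -> R) (w : edge G -> R -> bool -> int) (vinf : pred (vertex G)).

Definition spike e s t : R :=
  (- beta (edge_pt e s%:E) - (w e s (s <= t)%R)%:~R * `|t - s|)%R.

Hypotheses (w0 : forall e s b, (0 <= w e s b)%R) (w2 : forall e s b, (w e s b <= 2)%R)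
  (spike_le : forall e s s', s \in positions e -> s' \in positions e ->
    (spike e s s' <= - beta (edge_pt e s'%:E))%R)
  (vinf_flat : forall e, len e = +oo -> vinf (tgt e) ->
    (exists s, [/\ s \in positions e, w e s true = 0%R & beta (edge_pt e s%:E) = 0%R]) /\
    forall s, s \in positions e -> (0 <= beta (edge_pt e s%:E))%R)
  (vinf_steep : forall e, len e = +oo -> ~~ vinf (tgt e) ->
    forall s, s \in positions e -> (1 <= w e s true)%R)
  (Dlarge : forall x, D x != 0%R -> (2 * (size (germs x))%:Z <= D x)%R).

Definition edge_tent e t : \bar R :=
  \big[maxe/-oo]_(j < size (positions e)) (spike e (nth 0%R (positions e) j) t)%:E.

Definition tent x : \bar R :=
  match x with
  | Vertex v => if `[< at_infinity (Vertex v) >] then (if vinf v then 0 else -oo)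
                else (- beta (Vertex v))%:E
  | Interior p => edge_tent (val p).1 (val p).2
  end.

Lemma edge_tent_ge e s t : s \in positions e -> (spike e s t)%:E <= edge_tent e t.
Proof.
move=> se; have jP : (index s (positions e) < size (positions e))%N by rewrite index_mem.
have := le_bigmax -oo (fun j : 'I__ => (spike e (nth 0%R (positions e) j) t)%:E) (Ordinal jP).
by rewrite /= nth_index.
Qed.

Lemma edge_tent_le e t (a : \bar R) :
  (forall s, s \in positions e -> (spike e s t)%:E <= a) -> edge_tent e t <= a.
Proof.
by move=> H; apply: bigmax_le => [|j _]; [exact: leNye|apply/H/mem_nth].
Qed.

Lemma edge_tent_position e s : s \in positions e ->
  edge_tent e s = (- beta (edge_pt e s%:E))%:E.
Proof.
move=> se; apply/le_anti/andP; split.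
  by apply: edge_tent_le => s' s'e; rewrite lee_fin spike_le.
by apply: le_trans (edge_tent_ge _ se); rewrite lee_fin /spike subrr normr0 mulr0 subr0.
Qed.

Lemma tent_edge e t : (0 <= t)%R -> t%:E <= len e -> tent (edge_pt e t%:E) = edge_tent e t.
Proof.
move=> t0 tl; have [tE|t0'] := eqVneq t 0%R.
  rewrite tE edge_tent_position ?positions0// edge_pt0/=.
  by case: asboolP => // /src_finite.
have [tL|tl'] := eqVneq t%:E (len e).
  rewrite edge_tent_position; last exact: positions_len.
  rewrite edge_pt_ge ?tL//=; case: asboolP => // /tgt_finite; case; by rewrite -tL.
have t_in : in_interior (e, t).
  by rewrite /in_interior/= lt_neqAle eq_sym t0' t0 lt_neqAle tl'.
by rewrite edge_ptE.
Qed.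

Lemma tent_fin x : ~ at_infinity x -> tent x \is a fin_num.
Proof.
case: (pointP x) => [v vfin|e t t0 tl _] /=; first by case: asboolP.
rewrite tent_edge ?ltW// fin_numElt; apply/andP; split.
  by apply: lt_le_trans (edge_tent_ge t (positions0 e)); rewrite ltNyr.
by apply: bigmaxe_ltey => j; rewrite ltry.
Qed.

Definition spike_slope (g : @germ R G) s : int :=
  let: (e, t, b) := g in
  if b then (if (s <= t)%R then - w e s true else w e s false)%R
  else (if (s < t)%R then w e s true else - w e s false)%R.

Lemma spike_affine g s : exists2 d : R, (0 < d)%R & forall r, (0 <= r < d)%R ->
  spike g.1.1 s (gpos g r) = (spike g.1.1 s g.1.2 + (spike_slope g s)%:~R * r)%R.
Proof.
case: g => -[e t] []; rewrite /spike /gpos/=.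
  have [st|ts] := @leP _ R s t.
    exists 1%R => // r /andP[r0 _]; rewrite (_ : (s <= t + r)%R); last by lra.
    by rewrite rmorphN/= !ger0_norm; [ring|lra|lra].
  exists (s - t)%R; first lra.
  move=> r /andP[r0 rd]; rewrite (_ : (s <= t + r)%R = false);
    last by apply/negbTE; rewrite -ltNge; lra.
  by rewrite !ltr0_norm; [ring|lra|lra].
have [st|ts] := @ltP _ R s t.
  exists (t - s)%R; first lra.
  move=> r /andP[r0 rd]; rewrite (_ : (s <= t - r)%R); last by lra.
  by rewrite (ltW st) !ger0_norm; [ring|lra|lra].
exists 1%R => // r /andP[r0 _].
(* When s = t the flag [s <= t - r] changes right after r = 0, so r = 0 is treated apart. *)
have [->|r_neq0] := eqVneq r 0%R; first by rewrite subr0 mulr0 addr0.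
have r_gt0 : (0 < r)%R by rewrite lt_neqAle eq_sym r_neq0.
rewrite (_ : (s <= t - r)%R = false); last by apply/negbTE; rewrite -ltNge; lra.
rewrite rmorphN/= (ltr0_norm (x := (t - r - s)%R)); last lra.
have [stE|st] := eqVneq s t.
  by rewrite stE lexx subrr normr0; ring.
have ts' : (t < s)%R by rewrite lt_neqAle eq_sym st.
by rewrite leNgt ts'/= ltr0_norm; [ring|lra].
Qed.

Lemma spike_slope_ge g s : (-2 <= spike_slope g s)%R.
Proof.
case: g => -[e t] b /=; have := w0 e s true; have := w0 e s false.
have := w2 e s true; have := w2 e s false.
by case: b; case: ifP => _; lia.
Qed.

Lemma tent_germ g : valid_germ g -> exists s,
  [/\ s \in positions g.1.1, (spike g.1.1 s g.1.2)%:E = tent (gpt g 0),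
    gslope tent g (spike_slope g s) &
    forall s', s' \in positions g.1.1 -> (spike g.1.1 s' g.1.2)%:E = tent (gpt g 0) ->
      (spike_slope g s' <= spike_slope g s)%R].
Proof.
move=> gv; have f0 := tent_fin (valid_germ_finite gv).
have [d1 d10 d1P] := germ_room gv.
set P := positions g.1.1.
have [d2 d20 d2P] := finite_radius (fun j : 'I_(size P) => spike_affine g (nth 0%R P j)).
pose d0 := Num.min d1 d2.
have d00 : (0 < d0)%R by rewrite lt_min d10.
have posP r : (0 <= r < d0)%R -> (0 <= gpos g r)%R /\ (gpos g r)%:E <= len g.1.1.
  rewrite lt_min => /and3P[r0 rd _]; move: r0; rewrite le_eqVlt => /predU1P[<-|r0].
    by move: gv; rewrite gpos0 /valid_germ; case: ifP => _ [a b]; split=> //; exact: ltW.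
  by have [|a b] := d1P r; rewrite ?r0//; split; exact: ltW.
have [||j [jE [d d_gt0 dP] jmax]] := @max_affine_germ R _ (fun r => tent (gpt g r))
    (fun j : 'I_(size P) => fun r => (spike g.1.1 (nth 0%R P j) (gpos g r))%:E)
    (fun j => (spike_slope g (nth 0%R P j))%:~R) d0 d00 f0.
- by move=> r rd; rewrite /gpt tent_edge; have [] := posP r rd.
- move=> j; right; exists (spike g.1.1 (nth 0%R P j) g.1.2) => r.
  by rewrite lt_min => /and3P[r0 _ rd]; rewrite d2P ?r0.
rewrite gpos0 in jE.
exists (nth 0%R P j); split=> //.
- exact: mem_nth.
- by exists d.
- move=> s' s'P s'E; rewrite -(ler_int R).
  have kP : (index s' P < size P)%N by rewrite index_mem.
  have := jmax (Ordinal kP); rewrite /= nth_index// gpos0; exact.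
Qed.

(** At a marked leaf end a flat spike of height 0 dominates all others; at an unmarked one every
    spike descends with slope at least 1 and the tent tends to -oo. *)
Lemma tent_tail e : len e = +oo -> exists m : int, (m <= 0)%R /\ tail_slope tent e m.
Proof.
move=> le; have [a a0 aP] : exists2 a : R, (0 <= a)%R & forall s, s \in positions e -> (s <= a)%R.
  exists (\big[Num.max/0%R]_(s <- positions e) s); first exact: bigmax_ge_id.
  by move=> s se; exact: (le_bigmax_seq (0%R : R) s xpredT id).
have spikeE s t : s \in positions e -> (a <= t)%R ->
    spike e s t = (- beta (edge_pt e s%:E) + (w e s true)%:~R * s - (w e s true)%:~R * t)%R.
  move=> se at_; have st : (s <= t)%R by exact: le_trans (aP s se) at_.
  by rewrite /spike st ger0_norm ?subr_ge0//; ring.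
have tentE t : (a < t)%R -> tent (edge_pt e t%:E) = edge_tent e t.
  by move=> at_; rewrite tent_edge ?le ?leey//; lra.
have inf : at_infinity (Vertex (tgt e)) by apply/at_infinityP; exists e.
have [vi|vi] := boolP (vinf (tgt e)).
  have [[s [se ws bs]] b0] := vinf_flat le vi.
  exists 0%R; split=> //; exists 0%R, a; split; last by rewrite /= asboolT// vi.
  move=> t at_; rewrite tentE// mul0r addr0; apply/le_anti/andP; split.
    apply: edge_tent_le => s' s'e; rewrite lee_fin /spike.
    have := b0 s' s'e.
    have : (0 <= (w e s' (s' <= t)%R)%:~R * `|t - s'|)%R.
      by apply: mulr_ge0 => //; rewrite -[0%R]/(0%:~R) ler_int.
    lra.
  apply: le_trans (edge_tent_ge t se).
  by rewrite (spikeE _ _ se (ltW at_)) ws bs lee_fin; lra.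
have w1 := vinf_steep le vi.
have p0 : (0 < size (positions e))%N by case: positions (positions0 e).
pose S (j : 'I_(size (positions e))) := nth 0%R (positions e) j.
have [j [b jP]] := @max_affine_tail R _
  (fun j => (- beta (edge_pt e (S j)%:E) + (w e (S j) true)%:~R * (S j))%R)
  (fun j => (- w e (S j) true)%:~R)%R (Ordinal p0).
have wj := w1 (S j) (mem_nth _ (ltn_ord j)).
exists (- w e (S j) true)%R; split; first lia.
exists (- beta (edge_pt e (S j)%:E) + (w e (S j) true)%:~R * (S j))%R, (Num.max a b); split.
  move=> t; rewrite gt_max => /andP[at_ bt]; rewrite tentE// -jP//.
  apply: eq_bigr => k _; rewrite spikeE ?ltW// ?mem_nth//.
  by rewrite rmorphN/= mulNr.
by rewrite /= asboolT// (negbTE vi); case: eqP => //; lia.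
Qed.

(** At a support point each germ has slope at least -2, which [Dlarge] compensates. Any other finite
    point is interior to an edge and not the centre of a spike, so the tent is convex there. *)
Lemma tent_germ_system : germ_system D tent.
Proof.
split; [exact: tent_fin| |exact: tent_tail].
move=> x xfin.
have [Dx|Dx] := eqVneq (D x) 0%R; last first.
  have /choice[s sP] : forall g, exists s, g \in germs x ->
      gslope tent g (spike_slope g s) /\ (-2 <= spike_slope g s)%R.
    move=> g; have [gx|_] := boolP (g \in germs x); last by exists 0%R.
    have [_ gv] := (germsP g xfin).1 gx.
    by have [s [_ _ gs _]] := tent_germ gv; exists s => _; split=> //; exact: spike_slope_ge.
  exists (fun g => spike_slope g (s g)); split=> [g /sP[]//|].
  have : (\sum_(g <- germs x) (-2) <= \sum_(g <- germs x) spike_slope g (s g))%R.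
    by rewrite big_seq [leRHS]big_seq; apply: ler_sum => g /sP[].
  have := Dlarge Dx.
  rewrite big_const_seq count_predT iter_addr_0.
  have -> : ((-2 : int) *+ size (germs x) = - (2 * (size (germs x))%:Z))%R.
    by rewrite -mulr_natr natz; lia.
  lia.
case: (pointP x) xfin Dx => [v vfin Dv|e t t0 tl _ Dx].
  by have := Dvertex vfin; rewrite Dv eqxx.
have [|s [se sE gs smax]] := @tent_germ (e, t, true); first by split=> //; exact: ltW.
have [|s' [s'e s'E gs' s'max]] := @tent_germ (e, t, false); first by split=> //; exact: ltW.
exists (fun g => spike_slope g (if g.2 then s else s')).
have t_in : in_interior (e, t) by rewrite /in_interior/= t0.
rewrite Dx add0r edge_ptE/= !big_cons big_nil addr0; split.
  by move=> g; rewrite !inE => /orP[]/eqP ->.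
have s's : (spike_slope (e, t, true) s' <= spike_slope (e, t, true) s)%R.
  by apply: smax => //; rewrite [LHS]s'E /gpt !gpos0.
have s't : s' != t.
  apply/eqP => E; move: s'e => /positionsP[_ _]; by rewrite E Dx eqxx.
(* Away from its centre a spike is straight, so its two outgoing slopes cancel. *)
suff : (spike_slope (e, t, true) s' = - spike_slope (e, t, false) s')%R.
  by move: s's => /= h1 h2; move: h1; rewrite h2; lia.
by rewrite /=; case: ltgtP s't => // _ _; rewrite opprK.
Qed.

End Tents.

(** * Distance to the support and functions with a prescribed peak *)

Section NearestPoint.
Context {R : realType} {G : weighted_graph R}.
Variable D : divisor G.
Hypotheses (D0 : effective D) (Dinf : forall x, at_infinity x -> D x = 0%R)
  (Dvertex : forall v, ~ at_infinity (Vertex v) -> D (Vertex v) != 0%R)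
  (Dlarge : forall x, D x != 0%R -> (2 * (size (germs x))%:Z <= D x)%R).
Implicit Types (e : edge G) (v : vertex G) (x y z p : points G) (s t : R).

Lemma bigmine_attained (A : eqType) (r : seq A) (F : A -> \bar R) : r != [::] ->
  exists2 a, a \in r & \big[mine/+oo]_(a <- r) F a = F a.
Proof.
elim: r => // a [|b r] IH _; first by exists a; rewrite ?inE// big_seq1.
have [c cr E] := IH isT; rewrite big_cons E.
have [le|lt] := leP (F a) (F c); first by exists a; rewrite ?inE ?eqxx.
by exists c; rewrite // inE cr orbT.
Qed.

Lemma bigmine_le (A : eqType) (r : seq A) (F : A -> \bar R) a : a \in r ->
  \big[mine/+oo]_(a <- r) F a <= F a.
Proof.
elim: r => // b r IH; rewrite inE big_cons ge_min => /predU1P[->|/IH ->]; last by rewrite orbT.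
by rewrite lexx.
Qed.

(* The distance to the support of D, when all finite vertices belong to it. *)
Definition nearest x : \bar R :=
  match x with
  | Vertex v => if `[< at_infinity (Vertex v) >] then +oo else 0
  | Interior p => \big[mine/+oo]_(s <- positions D (val p).1) `|(val p).2 - s|%:E
  end.

Let pos_neq0 e : positions D e != [::].
Proof. by apply/eqP => E; have := positions0 Dvertex e; rewrite E. Qed.

Lemma nearest_edge e t : (0 <= t)%R -> t%:E <= len e ->
  nearest (edge_pt e t%:E) = \big[mine/+oo]_(s <- positions D e) `|t - s|%:E.
Proof.
move=> t0 tl.
have zero : t \in positions D e ->
    0 = \big[mine/+oo]_(s <- positions D e) `|t - s|%:E :> \bar R.
  move=> te; apply/le_anti/andP; split.
    by have [s se ->] := bigmine_attained (fun s => `|t - s|%:E) (pos_neq0 e); rewrite lee_fin.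
  by have := bigmine_le (fun s => `|t - s|%:E) te; rewrite subrr normr0.
have [tE|t0'] := eqVneq t 0%R.
  rewrite -zero; last by rewrite tE; exact: positions0.
  by rewrite tE edge_pt0/=; case: asboolP => // /src_finite.
have [tL|tl'] := eqVneq t%:E (len e).
  rewrite -zero; last exact: (positions_len Dvertex).
  rewrite edge_pt_ge ?tL//=; case: asboolP => // /tgt_finite; case; by rewrite -tL.
have t_in : in_interior (e, t).
  by rewrite /in_interior/= lt_neqAle eq_sym t0' t0 lt_neqAle tl'.
by rewrite edge_ptE.
Qed.

Lemma nearest_le e s t : s \in positions D e -> (0 <= t)%R -> t%:E <= len e ->
  nearest (edge_pt e t%:E) <= `|t - s|%:E.
Proof.
by move=> se t0 tl; rewrite nearest_edge//; exact: (bigmine_le (fun s => `|t - s|%:E) se).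
Qed.

Lemma nearest_attained e t : (0 <= t)%R -> t%:E <= len e ->
  exists2 s, s \in positions D e & nearest (edge_pt e t%:E) = `|t - s|%:E.
Proof. by move=> t0 tl; rewrite nearest_edge//; exact: bigmine_attained. Qed.

Lemma nearest_support p : D p != 0%R -> nearest p = 0.
Proof.
move=> Dp; have pfin : ~ at_infinity p by move=> /Dinf Dp0; rewrite Dp0 eqxx in Dp.
move: Dp pfin; case: (pointP p) => [v _ vfin|e t t0 tl Dp _] /=; first by case: asboolP.
have te : t \in positions D e by apply/positionsP; split=> //; exact: ltW.
apply/le_anti/andP; split.
  by have := nearest_le te (ltW t0) (ltW tl); rewrite subrr normr0.
by have [s se ->] := nearest_attained (ltW t0) (ltW tl); rewrite lee_fin.
Qed.

Lemma nearest_infinity x : at_infinity x -> nearest x = +oo.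
Proof. by move=> /[dup] /at_infinityP[e le ->] xinf /=; rewrite asboolT. Qed.

Lemma nearest_dist p z : D p != 0%R -> nearest z <= dist p z.
Proof.
move=> Dp; have := nearest_support Dp => p0.
rewrite -[leRHS]add0e -p0; apply: lipschitz_dist; last by rewrite p0.
move=> e s t /andP[s0 sl] /andP[t0 tl].
case: s s0 sl => [s| |]//; last first.
  rewrite leye_eq => _ /eqP le.
  have -> : nearest (edge_pt e +oo) = +oo.
    by apply/nearest_infinity/at_infinityP; exists e; rewrite // edge_pt_ge// leey.
  by rewrite addye ?leey// gt_eqF// (lt_le_trans ltNy0 (abse_ge0 _)).
rewrite lee_fin => s0 sl; have [a ae ->] := nearest_attained s0 sl.
case: t t0 tl => [t| |]//; last first.
  by rewrite (_ : `|+oo - s%:E| = +oo)// addey ?leey.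
rewrite lee_fin => t0 tl; apply: (le_trans (nearest_le ae t0 tl)).
rewrite -EFinB abse_EFin -EFinD lee_fin [leRHS]addrC.
have -> : (t - a = (t - s) + (s - a))%R by lra.
exact: ler_normD.
Qed.

(** The image of a nearest support point is again a support point, at no greater distance from the
    image of z; the inverse element gives the opposite inequality. *)
Lemma nearest_act (K : finGroupType) (to : {action K &-> points G}) k z :
  isometric_action to -> invariant_divisor to D -> nearest (to z k) = nearest z.
Proof.
move=> hto DK.
suff le_act k' x : nearest (to x k') <= nearest x.
  apply/le_anti/andP; split=> //.
  by rewrite -{1}(act_ptK to k z); exact: le_act.
have [xinf|xfin] := pselect (at_infinity x); first by rewrite [leRHS]nearest_infinity ?leey.
case: (pointP x) xfin => [v vfin|e t t0 tl _].
  have Dv := Dvertex vfin.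
  by rewrite (nearest_support Dv) nearest_support// DK.
have [s se ->] := nearest_attained (ltW t0) (ltW tl).
have [s0 sl Ds] := (positionsP D e s).1 se.
have := @nearest_dist (to (edge_pt e s%:E) k') (to (edge_pt e t%:E) k').
rewrite DK => /(_ Ds) /le_trans; apply; rewrite (proj2 (hto k')).
have se' : 0 <= s%:E <= len e by rewrite lee_fin s0.
have te' : 0 <= t%:E <= len e by rewrite lee_fin !ltW.
by have := dist_edge_le se' te'; rewrite -EFinB abse_EFin.
Qed.

(** The spacing d bounds how far support points may be lowered without being covered by the spike of
    a neighbour. *)
Lemma position_gap : exists2 d : R, (0 < d)%R & forall e s s',
  s \in positions D e -> s' \in positions D e -> s != s' -> (d <= `|s - s'|)%R.
Proof.
have [d d0 dP] : exists2 d : R, (0 < d)%R & forall e r, (0 <= r < d)%R ->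
    forall s s', s \in positions D e -> s' \in positions D e -> s != s' -> (r < `|s - s'|)%R.
  apply: finite_radius => e.
  have [d d0 dP] : exists2 d : R, (0 < d)%R & forall s r, s \in positions D e ->
      (0 <= r < d)%R -> forall s', s' \in positions D e -> s != s' -> (r < `|s - s'|)%R.
    apply: common_radius => s se.
    have [d d0 dP] : exists2 d : R, (0 < d)%R & forall s' r, s' \in positions D e ->
        (0 <= r < d)%R -> s != s' -> (r < `|s - s'|)%R.
      apply: common_radius => s' s'e; have [->|ss'] := eqVneq s s'; first by exists 1%R.
      exists `|s - s'|%R; first by rewrite normr_gt0 subr_eq0.
      by move=> r /andP[].
    by exists d => // r rd s' s'e; exact: dP.
  by exists d => // r rd s s' se s'e; exact: dP.
exists (d / 2)%R; first by rewrite divr_gt0.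
move=> e s s' se s'e ss'; apply/ltW/(dP e) => //.
by apply/andP; split; lra.
Qed.

Lemma edge_tent_attained (beta : points G -> R) (w : edge G -> R -> bool -> int) e t :
  exists2 s, s \in positions D e & edge_tent D beta w e t = (spike beta w e s t)%:E.
Proof.
have [|j jE] := @bigmaxe_attained R _
    (fun j : 'I_(size (positions D e)) => (spike beta w e (nth 0%R (positions D e) j) t)%:E).
  rewrite -ltNye; apply: lt_le_trans (edge_tent_ge beta w t (positions0 Dvertex e)).
  by rewrite ltNyr.
by exists (nth 0%R (positions D e) j) => //; exact: mem_nth.
Qed.

Lemma exists_peak x : exists2 f, germ_system D f &
  forall z, z <> x -> nearest x <= nearest z -> f z < f x.
Proof.
have [/[dup] xinf /at_infinityP[e0 le0 xE]|xfin] := pselect (at_infinity x).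
  (* For x at infinity, the only flat half-spike runs from the source of its edge to x. The
     competitors are the other points at infinity, where the tent is -oo. *)
  pose w (e : edge G) (s : R) (b : bool) : int :=
    if [&& e == e0, s == 0%R & b] then 0%R else 2%R.
  pose vinf : pred (vertex G) := fun v => v == tgt e0.
  exists (tent D (fun=> 0%R) w vinf).
    apply: tent_germ_system => //.
    - by move=> e s b; rewrite /w; case: ifP.
    - by move=> e s b; rewrite /w; case: ifP.
    - move=> e s s' _ _; rewrite /spike oppr0 add0r oppr_le0.
      by apply: mulr_ge0 => //; rewrite -[0%R]/(0%:~R) ler_int /w; case: ifP.
    - move=> e le /eqP/(infinite_leaf le0) ->; split=> //.
      by exists 0%R; rewrite /w !eqxx; split=> //; exact: positions0.
    - move=> e le te s _; rewrite /w; case: (eqVneq e e0) => //= ee.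
      by move: te; rewrite ee /vinf eqxx.
  move=> z zx; rewrite (nearest_infinity xinf) leye_eq => /eqP zy.
  have zinf : at_infinity z.
    apply: contrapT => zfin; move: zfin zy; case: (pointP z) => [v vfin|e t t0 tl _] /=.
      by case: asboolP.
    by have [s _ ->] := nearest_attained (ltW t0) (ltW tl).
  have /at_infinityP[e1 le1 zE] := zinf.
  move: zinf xinf zx; rewrite xE zE /= => zinf xinf zx.
  rewrite !asboolT// /vinf eqxx; case: eqP => // E.
  by case: zx; rewrite E.
have [Dx|Dx] := eqVneq (D x) 0%R; last first.
  (* For x in the support, x has height 0 and all other support points have height -d; spikes of
     slope 2 respect these heights since support points on an edge are at least d apart. *)
  have [d d0 dP] := position_gap.
  pose beta z : R := if z == x then 0%R else d.
  pose w (e : edge G) (s : R) (b : bool) : int := 2%R.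
  have beta_ge0 z : (0 <= beta z)%R by rewrite /beta; case: ifP => // _; exact: ltW.
  have beta_le z : (beta z <= d)%R by rewrite /beta; case: ifP => // _; exact: ltW.
  have spikeP e s s' : s \in positions D e -> s' \in positions D e ->
      (spike beta w e s s' <= - beta (edge_pt e s'%:E))%R.
    move=> se s'e; rewrite /spike.
    have [->|ss'] := eqVneq s s'; first by rewrite subrr normr0 mulr0 subr0.
    have := dP e s' s s'e se; rewrite eq_sym => /(_ ss').
    have := beta_ge0 (edge_pt e s%:E); have := beta_le (edge_pt e s'%:E); lra.
  exists (tent D beta w pred0).
    by apply: tent_germ_system => // e; rewrite ?ltry.
  have -> : tent D beta w pred0 x = 0.
    have [[v xE]|[e [t [t0 tl xE]]]] : (exists v, x = Vertex v) \/
        exists e (t : R), [/\ (0 < t)%R, t%:E < len e & x = edge_pt e t%:E].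
      by case: (pointP x) => [v|e t t0 tl]; [left; exists v|right; exists e, t].
      by rewrite {1}xE /= /beta xE eqxx oppr0; case: asboolP => //; rewrite -xE.
    rewrite {1}xE (tent_edge Dvertex _ spikeP) ?ltW// (edge_tent_position spikeP).
      by rewrite /beta xE eqxx oppr0.
    by apply/positionsP; rewrite -xE; split=> //; exact: ltW.
  move=> z zx _; move: zx; case: (pointP z) => [v vx|e t t0 tl tx] /=.
    case: asboolP => // _; rewrite lte_fin oppr_lt0 /beta.
    by case: eqP.
  rewrite (tent_edge Dvertex _ spikeP) ?ltW//.
  have [s se ->] := edge_tent_attained beta w e t.
  rewrite lte_fin /spike; have := beta_ge0 (edge_pt e s%:E).
  have [ts|ts] := eqVneq t s.
    rewrite -ts subrr normr0 mulr0 subr0 oppr_lt0 /beta.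
    by case: eqP.
  have : (0 < `|t - s|)%R by rewrite normr_gt0 subr_eq0.
  lra.
move: xfin Dx; case: (pointP x) => [v /Dvertex Dv Dv0|e0 t0 t00 t0l _ Dt0].
  by rewrite Dv0 eqxx in Dv.
have [a ae xa] := nearest_attained (ltW t00) (ltW t0l).
have [a0 al Da] := (positionsP D e0 a).1 ae.
have ta : t0 != a by apply/eqP => E; move: Da; rewrite -E Dt0 eqxx.
have r0 : (0 < `|t0 - a|)%R by rewrite normr_gt0 subr_eq0.
(* For x off the support, all spikes have height 0 and slope 2, except that the one at the nearest
   support point a has slope 1 on the side of x. Thus the tent is at least minus the distance from x
   to the support at x. *)
pose w (e : edge G) (s : R) (b : bool) : int :=
  if [&& e == e0, s == a & b == (a <= t0)%R] then 1%R else 2%R.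
have w1 e s b : (1 <= w e s b)%R by rewrite /w; case: ifP.
have spikeP e s s' : s \in positions D e -> s' \in positions D e ->
    (spike (fun=> 0) w e s s' <= - 0 :> R)%R.
  move=> _ _; rewrite /spike oppr0 add0r oppr_le0; apply: mulr_ge0 => //.
  by rewrite -[0%R]/(0%:~R) ler_int; have := w1 e s (s <= s')%R; lia.
exists (tent D (fun=> 0%R) w pred0).
  apply: tent_germ_system => //.
  - by move=> e s b; have := w1 e s b; lia.
  - by move=> e s b; rewrite /w; case: ifP.
have fx : (- `|t0 - a|)%:E <= tent D (fun=> 0%R) w pred0 (edge_pt e0 t0%:E).
  rewrite (tent_edge Dvertex _ spikeP (ltW t00) (ltW t0l));
  apply: (le_trans _ (edge_tent_ge (fun=> 0%R) w t0 ae)).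
  by rewrite lee_fin /spike /w !eqxx/=; lra.
move=> z zx; rewrite xa => xz; apply: lt_le_trans fx.
move: zx xz; case: (pointP z) => [v _|e t te0 tl tx].
  rewrite /=; case: asboolP => [_ _|_]; first by rewrite ltNyr.
  by rewrite lee_fin leNgt r0.
rewrite (tent_edge Dvertex _ spikeP (ltW te0) (ltW tl)).
have [s se -> le_r] := edge_tent_attained (fun=> 0%R) w e t.
have := le_trans le_r (nearest_le se (ltW te0) (ltW tl)); rewrite lee_fin => rs.
rewrite lte_fin /spike oppr0 add0r ltrN2 /w.
case: ifP => [/and3P[/eqP ee /eqP sa /eqP side]|_]; last by lra.
rewrite mul1r lt_neqAle -sa in rs *; rewrite rs andbT.
(* On the gentle half-spike a point at the same distance from a as x is x itself, both lying on the
   same side of a. *)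
apply/eqP => E; apply: tx; rewrite ee; congr (edge_pt e0 _%:E).
move: E side; rewrite -sa; case: (leP s t0) => h1; case: (leP s t) => h2 // + _.
- by rewrite !ger0_norm ?subr_ge0//; lra.
- by rewrite !ltr0_norm ?subr_lt0//; lra.
Qed.

End NearestPoint.

Section Separation.
Context {R : realType} {G : weighted_graph R} {K : finGroupType}.
Variable to : {action K &-> points G}.
Hypothesis hto : isometric_action to.

Lemma separating_function (D : divisor G) (x y : points G) :
  effective D -> (forall x, at_infinity x -> D x = 0%R) -> invariant_divisor to D ->
  (forall v, ~ at_infinity (Vertex v) -> D (Vertex v) != 0%R) ->
  (forall x, D x != 0%R -> (2 * (size (germs x))%:Z <= D x)%R) ->
  orbit_of to x <> orbit_of to y ->
  exists2 f, invariant_linear_system_functions to D f & f x <> f y.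
Proof.
move=> D0 Dinf DK Dvertex Dlarge.
wlog xy : x y / nearest D x <= nearest D y.
  move=> H; have [|/ltW yx] := leP (nearest D x) (nearest D y); first exact: H.
  move=> orb; have [f fD fxy] := H _ _ yx (fun E => orb (esym E)).
  by exists f => // E; apply: fxy.
move=> orb.
(* No translate of y is x, so each translate is a competitor over which the peak at x is strict. *)
have kyx k : to y k <> x.
  move=> E; apply: orb; apply/seteqP; split=> z [k' _ <-].
    by exists (k * k')%g => //; rewrite act_ptM E.
  by exists (k^-1 * k')%g => //; rewrite act_ptM -E act_ptK.
have [f fD fx] := exists_peak Dvertex Dlarge x.
exists (symmetrize to f).
  apply: (symmetrize_linear_system hto D0 Dinf DK).
  exact: ((germ_systemP f D0 Dinf).2 fD).1.
apply/eqP; rewrite gt_eqF//.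
apply: (@lt_le_trans _ _ (f x)); last first.
  by have := le_bigmax -oo (fun k => f (to x k)) 1%g; rewrite act_pt1.
have ltk k : f (to y k) < f x.
  by apply: fx => //; rewrite nearest_act.
rewrite /symmetrize; elim/big_ind: _ => // [|a b al bl].
  by apply: le_lt_trans (ltk 1%g); exact: leNye.
by rewrite gt_max al.
Qed.

Lemma separating_divisor : exists D : divisor G,
  [/\ effective D, forall x, at_infinity x -> D x = 0%R, invariant_divisor to D,
    forall v, ~ at_infinity (Vertex v) -> D (Vertex v) != 0%R &
    forall x, D x != 0%R -> (2 * (size (germs x))%:Z <= D x)%R].
Proof.
(* Twice a bound on the number of germs: at most 2 #|E| at a vertex, and 2 at an interior point. *)
pose N : nat := (4 * #|edge G| + 4)%N.
pose P : seq (points G) := [seq to (Vertex v) k |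
  v <- [seq v <- enum (vertex G) | ~~ `[< at_infinity (Vertex v) >]], k <- enum K].
have PP x : x \in P <-> exists v k, ~ at_infinity (Vertex v) /\ x = to (Vertex v) k.
  split=> [/allpairsP[[v k]/= [+ _ ->]]|[v [k [vfin ->]]]].
    by rewrite mem_filter => /andP[/asboolPn vfin _]; exists v, k.
  apply/allpairsP; exists (v, k); rewrite mem_filter !mem_enum; split=> //=.
  by rewrite andbT; exact/asboolPn.
(* The same coefficient is used wherever a point occurs in the list, irrespective of repetitions;
   this gives invariance at once. *)
pose D : divisor G := [fsfun x in [fset x in P]%fset => N%:Z | 0%R].
have DE x : D x = if x \in P then N%:Z else 0%R.
  by rewrite /D fsfunE inE.
have PK k x : x \in P -> to x k \in P.
  by move=> /PP[v [k' [vfin ->]]]; apply/PP; exists v, (k' * k)%g; rewrite act_ptM.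
exists D; split.
- by move=> x; rewrite DE; case: ifP.
- move=> x xinf; rewrite DE; case: ifP => // /PP[v [k [vfin xE]]].
  by exfalso; move: xinf; rewrite xE; exact: act_finite.
- move=> k x; rewrite !DE; congr (if _ then _ else _).
  by apply/idP/idP => [/(PK k^-1%g)|]; [rewrite act_ptK|exact: PK].
- move=> v vfin; rewrite DE ifT; first by rewrite /N addnS.
  by apply/PP; exists v, 1%g; rewrite act_pt1.
- move=> x; rewrite DE; case: ifP => // _ _.
  suff : (size (germs x) <= 2 * #|edge G| + 2)%N by rewrite /N; lia.
  case: x => [v|p] /=; last by lia.
  rewrite size_cat !size_map -!cardE.
  by apply: (leq_trans (leq_add (max_card _) (max_card _))); rewrite addnn -mul2n leq_addr.
Qed.

End Separation.

(** * The associated rational map *)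

Section MinimalGenerators.
Context {R : realType} {X : Type}.
Implicit Types (M S : set (X -> \bar R)).

Definition spans M n : Prop := exists f : 'I_n -> X -> \bar R, tropical_span (range f) = M.

Lemma spans_subset M n (f : 'I_n -> X -> \bar R) (A : {set 'I_n}) :
  tropical_span (f @` [set i | i \in A]) = M -> spans M #|A|.
Proof.
move=> <-; exists (fun i : 'I_#|A| => f (enum_val i)); congr tropical_span.
apply/seteqP; split=> [_ [i _ <-]|_ [i iA <-]].
  by exists (enum_val i) => //; exact: enum_valP.
by exists (enum_rank_in iA i); rewrite ?enum_rankK_in.
Qed.

(** A generating family with the least number of members has no proper generating subfamily, which
    yields both injectivity and minimality for inclusion. *)
Lemma exists_minimal_generating_set M S : finite_set S -> tropical_span S = M ->
  exists n (f : 'I_n -> X -> \bar R), injective f /\ minimal_generating_set M (range f).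
Proof.
move=> /finite_seqP[s ->] sM.
have ex_n : exists n, `[< spans M n >].
  exists (size s); apply/asboolP; exists (tnth (in_tuple s)).
  rewrite -sM; congr tropical_span; apply/seteqP; split=> [_ [i _ <-]|x /= xs].
    exact: mem_tnth.
  by have /tnthP[i ->] : x \in in_tuple s by []; exists i.
have [n /asboolP[f fM] nmin] := find_ex_minn ex_n.
have no_smaller (A : {set 'I_n}) :
    tropical_span (f @` [set i | i \in A]) = M -> forall i, i \in A.
  move=> /spans_subset sA i; apply/negPn/negP => iA.
  have : (#|A| < #|[set: 'I_n]%SET|)%N.
    by apply: proper_card; rewrite properT; apply: contraNneq iA => ->; rewrite inE.
  by rewrite cardsT card_ord ltnNge nmin//; apply/asboolP.
exists n, f; split.
  move=> i j fij; apply/eqP/negPn/negP => ij.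
  suff /no_smaller/(_ i) : tropical_span (f @` [set k | k \in [set~ i]%SET]) = M.
    by rewrite !inE eqxx.
  rewrite -fM; congr tropical_span; apply/seteqP; split=> [_ [k _ <-]|_ [k _ <-]].
    by exists k.
  have [->|ki] := eqVneq k i; last by exists k; rewrite //= !inE.
  by exists j; rewrite //= !inE eq_sym.
split=> // S' S'f S'M.
pose A := [set i | `[< S' (f i) >]]%SET.
have fA : f @` [set i | i \in A] = S'.
  apply/seteqP; split=> [_ [i /= iA <-]|g S'g].
    by move: iA; rewrite inE => /asboolP.
  by have [i _ fi] := S'f _ S'g; exists i => //=; rewrite inE fi; apply/asboolP.
have allA := no_smaller A; rewrite fA in allA.
apply/seteqP; split=> // _ [i _ <-].
by have := allA S'M i; rewrite inE => /asboolP.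
Qed.

End MinimalGenerators.

Lemma cvg_maxe (R : realType) (T : Type) (F : set_system T) {FF : Filter F}
    (f g : T -> \bar R) (a b : \bar R) :
  f @ F --> a -> g @ F --> b -> (fun t => maxe (f t) (g t)) @ F --> maxe a b.
Proof.
wlog ab : f g a b / a <= b => [WH fa gb|fa gb].
  have /orP[ab|ba] := le_total a b; first exact: WH.
  by under eq_fun do rewrite maxC; rewrite maxC; exact: WH.
rewrite max_r// => U bU; have Ug : F (g @^-1` U) by exact: gb.
suff : F [set t | U (maxe (f t) (g t))] by [].
move: ab; rewrite le_eqVlt => /predU1P[ab|ab].
  have Uf : F (f @^-1` U) by apply: fa; rewrite ab.
  by apply: filterS2 _ Uf Ug => t /= ft gt; rewrite /maxe; case: ifP.
suff fg : \forall t \near F, f t <= g t.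
  by apply: filterS2 _ fg Ug => t /= /max_r ->.
have flt c : a < c -> \forall t \near F, f t < c.
  by move=> ac; exact: (fa [set x | x < c] (open_ereal_lt' ac)).
have glt c : c < b -> \forall t \near F, c < g t.
  by move=> cb; exact: (gb [set x | c < x] (open_ereal_gt' cb)).
have [[c /andP[ac cb]]|noc] := pselect (exists c, a < c < b).
  by apply: filterS2 _ (flt c ac) (glt c cb) => t h1 h2; exact/ltW/(lt_trans h1).
apply: filterS2 _ (flt b ab) (glt a ab) => t h1 h2.
by rewrite leNgt; apply/negP => h; apply: noc; exists (f t); rewrite h1 (lt_trans h2).
Qed.

Lemma cvg_bigmaxe (R : realType) (T I : Type) (F : set_system T) {FF : Filter F}
    (r : seq I) (f : I -> T -> \bar R) (a : I -> \bar R) :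
  (forall i, f i @ F --> a i) ->
  (fun t => \big[maxe/-oo]_(i <- r) f i t) @ F --> \big[maxe/-oo]_(i <- r) a i.
Proof.
move=> fa; elim: r => [|i r IH].
  by under eq_fun do rewrite big_nil; rewrite big_nil; exact: cvg_cst.
by under eq_fun do rewrite big_cons; rewrite big_cons; exact: cvg_maxe.
Qed.

Section TropicalProjectiveTopology.
Context {R : realType} {n : nat}.
Implicit Types u v : tvec R n.

Lemma tcoord_continuous (i : 'I_n) : continuous (fun u => tcoord u i).
Proof.
have entry : continuous (fun M : 'rV[\bar R]_n => M ord0 i).
  move=> M U MU; exists (fun k j => if (k == ord0) && (j == i) then U else setT).
    by move=> k j; case: andP => [[/eqP -> /eqP ->]//|_]; exact: filterT.
  by move=> N /(_ ord0 i); rewrite !eqxx.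
move=> u; apply: (@continuous_comp _ _ _ (set_val : tvec R n -> 'rV[\bar R]_n)
  (fun M => M ord0 i)); [exact: initial_continuous|exact: entry].
Qed.

Lemma tvec_continuous (T : topologicalType) (f : T -> tvec R n) :
  (forall i, continuous (fun x => tcoord (f x) i)) -> continuous f.
Proof.
move=> fc; apply: continuous_comp_initial => x A [P xP PA].
have : \forall y \near x, forall j : 'I_n, P ord0 j (tcoord (f y) j).
  by apply: filter_forall => j; apply: (fc j x); exact: xP.
by apply: filterS => y yP; apply: PA => i j; rewrite (ord1 i); exact: yP.
Qed.

(* The coordinates normalized to have maximum 0 are well defined on the tropical
   projective space, and show that it is Hausdorff. *)
Definition tmax u : \bar R := \big[maxe/-oo]_i tcoord u i.
Definition normalized (i : 'I_n) u : \bar R := tcoord u i - tmax u.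

Lemma tmax_fin u : tmax u \is a fin_num.
Proof.
have [u_lt [i ui]] := set_valP u.
rewrite fin_numElt; apply/andP; split; last by apply: bigmaxe_ltey => j; exact: u_lt.
by apply: lt_le_trans (le_bigmax _ (fun j => tcoord u j) i); rewrite ltNye; exact/eqP.
Qed.

Lemma tmax_continuous : continuous tmax.
Proof.
move=> u; have FF := nbhs_filter u; apply: cvg_bigmaxe => i; exact: tcoord_continuous.
Qed.

Lemma normalized_continuous i : continuous (normalized i).
Proof.
move=> u; have FF := nbhs_filter u; apply: cvgeB;
  [|exact: tcoord_continuous|exact: tmax_continuous].
by apply: fin_num_adde_defl; rewrite fin_numN tmax_fin.
Qed.

Lemma normalized_tequiv i u v : tequiv u v -> normalized i u = normalized i v.
Proof.
move=> /asboolP[l uv]; rewrite /normalized.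
have -> : tmax u = tmax v + l%:E.
  by rewrite addeC adde_bigmaxr /tmax; apply: eq_bigr => j _; rewrite uv addeC.
by rewrite uv fin_num_oppeD ?tmax_fin// addeACA subee// adde0.
Qed.

Lemma normalized_separates u v : (forall i, normalized i u = normalized i v) -> tequiv u v.
Proof.
move=> uv; apply/asboolP; exists (fine (tmax u) - fine (tmax v))%R => i.
have := uv i; rewrite /normalized => /(congr1 (fun a => a + tmax u)).
by rewrite subeK ?tmax_fin// => ->; rewrite EFinB !fineK ?tmax_fin// -addeA [- _ + _]addeC.
Qed.

Lemma tproj_eqP u v : reflect (\pi_(tproj R n) u = \pi_(tproj R n) v) (tequiv u v).
Proof. exact: (@eqquotP _ (@tequiv R n : rel (tvec R n))). Qed.

(** The normalized coordinates descend to the quotient, where they are continuous, take values in a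
    Hausdorff space and separate points. *)
Lemma tproj_limit_unique (T : topologicalType) (F : set_system T) (phi psi : T -> tproj R n)
    (a b : tproj R n) : ProperFilter F ->
  (\forall x \near F, phi x = psi x) -> phi @ F --> a -> psi @ F --> b -> a = b.
Proof.
move=> FF phipsi phia psib.
pose q i (c : tproj R n) := normalized i (generic_quotient.repr c).
have qE i u : q i (\pi_(tproj R n) u) = normalized i u.
  by apply: normalized_tequiv; apply/tproj_eqP; rewrite reprK.
have qc i : continuous (q i).
  apply: (@repr_comp_continuous _ _ _ (normalized i)); first exact: normalized_continuous.
  by move=> u v /eqP/tproj_eqP/normalized_tequiv ->.
rewrite -[a]reprK -[b]reprK; apply/tproj_eqP/normalized_separates => i.
rewrite -!/(q i _).
have h1 : (q i \o phi) @ F --> q i a by apply: cvg_comp phia _; exact: qc.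
have h2 : (q i \o psi) @ F --> q i b by apply: cvg_comp psib _; exact: qc.
apply: (cvg_unique (@ereal_hausdorff R)) h1 _.
apply: cvg_trans h2; apply: near_eq_cvg.
by apply: filterS phipsi => x; rewrite /= => ->.
Qed.

End TropicalProjectiveTopology.

Section RationalMap.
Context {R : realType} {G : weighted_graph R} {K : finGroupType}.
Variables (to : {action K &-> points G}) (D : divisor G).
Hypotheses (D0 : effective D) (Dinf : forall x, at_infinity x -> D x = 0%R).
Local Notation M := (invariant_linear_system_functions to D).
Implicit Types (x y : points G) (f : points G -> \bar R).

Lemma linear_system_continuous f : linear_system_functions D f -> continuous f.
Proof.
move=> [[[->|[fc _ _]] fNy _]|->] //; exact: cst_continuous.
Qed.

Lemma linear_system_ltey f x : linear_system_functions D f -> f x < +oo.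
Proof.
move=> [fD|->//]; have [_ fNy _] := fD.
exact: germ_system_ltey ((germ_systemP f D0 Dinf).1 (conj (or_introl fD) fNy)) x.
Qed.

Lemma constant_linear_system : M (cst 0).
Proof.
split=> //; apply: ((germ_systemP _ D0 Dinf).2 _).1; split=> //.
- move=> x _; exists (fun=> 0%R); split; last by rewrite big1_eq addr0; exact: D0.
  by move=> g _; exists 1%R => // s _; rewrite mul0r addr0.
- move=> e _; exists 0%R; split=> //; exists 0%R, 0%R; split=> // t _.
  by rewrite mul0r addr0.
Qed.

Section Generators.
Variables (n : nat) (f : 'I_n -> points G -> \bar R).
Hypothesis fM : tropical_span (range f) = M.

Let f_sys i : linear_system_functions D (f i).
Proof. by have [] : M (f i) by rewrite -fM; apply: sub_tropical_span; exists i. Qed.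

Lemma generators_not_all_Ny x : exists i, f i x <> -oo.
Proof.
have : tropical_span (range f) (cst 0) by rewrite fM; exact: constant_linear_system.
move=> [m [g [a [gf alt]]]] /(_ x) /= E.
have [|j] := @bigmaxe_attained _ _ (fun i => a i + g i x); first by rewrite -E.
rewrite -E => Ej; have [i _ fi] := gf j; exists i => fx.
by move: Ej; rewrite -fi fx addeNy.
Qed.

Lemma generators_tvec x : exists u : tvec R n, forall i, tcoord u i = f i x.
Proof.
pose r : 'rV[\bar R]_n := \row_i f i x.
have rP : [set u : 'rV[\bar R]_n | (forall i, u ord0 i < +oo) /\ exists i, u ord0 i <> -oo] r.
  split=> [i|]; first by rewrite mxE; exact: linear_system_ltey.
  by have [i fi] := generators_not_all_Ny x; exists i; rewrite mxE.
by exists (exist _ r (mem_set rP)) => i; rewrite /tcoord/= mxE.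
Qed.

Lemma generators_map : exists psi : points G -> tvec R n,
  continuous psi /\ forall x i, tcoord (psi x) i = f i x.
Proof.
have /choice[psi psiE] := generators_tvec.
exists psi; split=> //; apply: tvec_continuous => i.
rewrite (_ : (fun x => _) = f i); last by apply/funext => x; rewrite psiE.
exact: linear_system_continuous.
Qed.

Lemma generators_separate x y (l : R) : (forall i, f i x = f i y + l%:E) ->
  forall h, M h -> h x = h y.
Proof.
move=> fxy; have shift h : M h -> h x = h y + l%:E.
  rewrite -fM; move: h; apply: tropical_span_ind => [|a _ g alt [i _ <-] IH].
    by rewrite addNye.
  by rewrite fxy IH [RHS]addeC adde_maxr addeA ![l%:E + _]addeC.
(* All members of R(D)^K shift by the same l between x and y; the constant 0 forces l = 0. *)
have := shift _ constant_linear_system; rewrite /= add0e => -[l0].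
by move=> h /shift ->; rewrite -l0 adde0.
Qed.

End Generators.

Lemma tvec_ext n (u v : tvec R n) : (forall i, tcoord u i = tcoord v i) -> u = v.
Proof.
move=> uv; apply: val_inj; apply/rowP => i; exact: uv.
Qed.

Lemma exists_associated_rational_map S : finite_set S -> tropical_span S = M ->
  exists n (phi : points G -> tproj R n), associated_rational_map to D phi.
Proof.
move=> finS SM; have [n [f [finj fmin]]] := exists_minimal_generating_set finS SM.
have [psi [psic psiE]] := generators_map fmin.1.
exists n, (fun x => \pi_(tproj R n) (psi x)), f; split=> //.
  by move=> x; apply: (@continuous_comp _ _ _ psi); [exact: psic|exact: pi_continuous].
by move=> x _; exists (psi x).
Qed.

(** The map is prescribed only at finite points. The generators define a continuous map everywhere,
    never with all coordinates -oo, and at a point at infinity both maps have the same limit along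
    the edge, hence the same value. *)
Lemma associated_rational_map_separates n (phi : points G -> tproj R n) x y :
  associated_rational_map to D phi -> phi x = phi y -> forall h, M h -> h x = h y.
Proof.
move=> [f [finj fmin phic phiE]] phixy.
have [psi [psic psiE]] := generators_map fmin.1.
have phi_psi z : phi z = \pi_(tproj R n) (psi z).
  have fin_eq w : ~ at_infinity w -> phi w = \pi_(tproj R n) (psi w).
    move=> /phiE[u -> uE]; congr (\pi_(tproj R n) _); apply: tvec_ext => i.
    by rewrite uE psiE.
  have [zinf|] := pselect (at_infinity z); last exact: fin_eq.
  have [e le zE] := zinf.
  have lim : (fun t : R => edge_pt e t%:E) @ pinfty_nbhs R --> z.
    rewrite zE; apply: (@cvg_comp _ _ _ EFin (edge_pt e)); first exact: cvg_EFin_pinfty.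
    exact: edge_pt_continuous.
  apply: (@tproj_limit_unique R n R (pinfty_nbhs R) (phi \o (fun t : R => edge_pt e t%:E))
    (fun t : R => \pi_(tproj R n) (psi (edge_pt e t%:E)))).
  - by near=> t; apply: fin_eq; apply: edge_pt_finite; rewrite le leey.
  - by apply: (cvg_comp _ _ lim); exact: phic.
  - apply: (@cvg_comp _ _ _ (fun t : R => edge_pt e t%:E)
    (fun w => \pi_(tproj R n) (psi w)) _ (nbhs z)) => //.
    by apply: (@continuous_comp _ _ _ psi); [exact: psic|exact: pi_continuous].
move: phixy; rewrite !phi_psi => /tproj_eqP/asboolP[l fl].
by apply: (generators_separate fmin.1 (l := l)) => i; rewrite -!psiE.
Unshelve. all: by end_near. Qed.

End RationalMap.

Theorem theorem1p0p6 (R : realType) (G : weighted_graph R) (K : finGroupType)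
    (to : {action K &-> points G}) (hto : isometric_action to) :
  exists D : divisor G,
    [/\ effective D, invariant_divisor to D,
        exists (n : nat) (phi : points G -> tproj R n),
          associated_rational_map to D phi &
        forall (n : nat) (phi : points G -> tproj R n),
          associated_rational_map to D phi ->
          forall x y : points G,
            orbit_of to x <> orbit_of to y -> phi x <> phi y].
Proof.
have [D [D0 Dinf DK Dvertex Dlarge]] := separating_divisor hto.
exists D; split=> //.
  have [S [finS SM]] := invariant_linear_system_finitely_generated hto D0 Dinf DK.
  exact: exists_associated_rational_map finS SM.
move=> n phi phiP x y orb phixy.
have [f fM fxy] := separating_function hto D0 Dinf DK Dvertex Dlarge orb.
exact/fxy/(associated_rational_map_separates D0 Dinf phiP phixy).
Qed.
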